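(* Let $X$ be a compact Hausdorff space, let $\pi:\mathcal{E}\to X$ be a (continuously-normed) Banach bundle, let $A:=C(X)$ and let $E:=\Gamma(\mathcal{E})$ be the Banach $C(X)$-module of continuous global sections of $\mathcal{E}$. For $d\in\mathbb{Z}_{\ge 0}$ put $$X_d:=\{x\in X\mid \dim\mathcal{E}_x=d\},\qquad X_{>d}:=\{x\in X\mid \dim \mathcal{E}_x>d\}$$ (the sets $X_{>d}$ are automatically open in $X$). The following conditions are equivalent. (a) There is a finite upper bound on the fiber dimensions $\dim\mathcal{E}_x$, $x\in X$; each restriction $\mathcal{E}|_{X_d}$ is trivialized by a finite open cover of $X_d$; and each set $X_{>d}$ is $F_\sigma$ in $X$. (b) The Banach $C(X)$-module $E$ is topologically finitely generated. (c) Each set $X_{>d}$ is $F_\sigma$ in $X$, and for every (or equivalently, for some) $1\le p<\infty$ there is a $K=K_p\in\mathbb{Z}_{\ge 0}$ such that every element $(v_n)_n\in\ell^p(E)$ is decomposable as $$(v_n)_n=\sum_{i=1}^K (f_{ni})_n\cdot w_i,\qquad (f_{ni})_n\in \ell^p(A),\quad w_i\in E,$$ i.e. $v_n=\sum_{i=1}^K f_{ni}w_i$ for all $n$.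
   Context: Banach spaces are complex. A Banach bundle over $X$ (in the continuous-norm, or (F), sense) is a continuous open surjection $\pi:\mathcal{E}\to X$ of (Hausdorff) topological spaces whose fibers $\mathcal{E}_x:=\pi^{-1}(x)$ are Banach spaces, such that scaling $\mathbb{C}\times\mathcal{E}\to\mathcal{E}$, addition $\mathcal{E}\times_X\mathcal{E}\to\mathcal{E}$ and the norm $\mathcal{E}\to\mathbb{R}$ are continuous, and such that for every $x\in X$ the sets $\{z\in\mathcal{E}\mid \pi(z)\in U,\ \|z\|<\varepsilon\}$ ($\varepsilon>0$, $U$ a neighborhood of $x$) form a system of neighborhoods of the origin of $\mathcal{E}_x$ in $\mathcal{E}$. A section is a continuous right inverse of $\pi$; $\Gamma(\mathcal{E})$ denotes the space of all sections over $X$ with the supremum norm and the pointwise $C(X)$-module structure, where $C(X)$ is the algebra of continuous complex functions on $X$. A finite open cover $(V_i)$ of $X_d$ (by relatively open subsets) trivializes $\mathcal{E}|_{X_d}$ if each $\mathcal{E}|_{V_i}$ is trivial, i.e. isomorphic (by a fiberwise linear homeomorphism over $V_i$, not necessarily isometric) to a product bundle $V_i\times\mathbb{C}^d$. A set is $F_\sigma$ if it is a countable union of closed subsets. A Banach $C(X)$-module is topologically finitely generated if it has a dense, purely algebraic $C(X)$-submodule generated by finitely many elements. For a Banach space $E$ and $1\le p<\infty$, $\ell^p(E)$ is the space of sequences $(v_n)_{n\in\mathbb{Z}_{\ge0}}$ in $E$ with $\|(v_n)\|_p:=(\sum_n\|v_n\|^p)^{1/p}<\infty$. *)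

(* Defs.v *)
(* MathComp-Analysis; the scalars are the complex numbers R[i] over a realType R. *)
From HB Require Import structures.
From mathcomp Require Import all_boot all_order all_algebra.
From mathcomp Require Import all_classical all_reals all_analysis.
From mathcomp Require Import borel_hierarchy complex.

Set Implicit Arguments.
Unset Strict Implicit.
Unset Printing Implicit Defensive.

Import Order.TTheory GRing.Theory Num.Theory numFieldNormedType.Exports.

Local Open Scope classical_set_scope.
Local Open Scope ring_scope.

(* The library topologizes abstract numFieldTypes and aliases K^o only; this
   gives the concrete type R[i] its norm topology. *)
HB.instance Definition _ (R : realType) :=
  PseudoPointedMetric.copy R[i] R[i]^o.
HB.instance Definition _ (R : realType) :=
  PseudoMetricNormedZmod.copy R[i] R[i]^o.

(* Norms of complex normed spaces are R[i]-valued (with zero imaginary part);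
   this is the same norm as a real number. *)
Definition rnorm (R : realType) (V : normedModType R[i]) (v : V) : R :=
  complex.Re `|v|.

Section Dimension.
Variables (R : realType) (V : lmodType R[i]).

Definition is_basis d (e : 'I_d -> V) : Prop :=
  (forall c : 'I_d -> R[i], \sum_i c i *: e i = 0 -> forall i, c i = 0) /\
  (forall v : V, exists c : 'I_d -> R[i], v = \sum_i c i *: e i).

Definition dim_eq (d : nat) : Prop := exists e : 'I_d -> V, is_basis e.

Definition dim_le (d : nat) : Prop := exists2 k, (k <= d)%N & dim_eq k.

(* Infinite-dimensional spaces have dimension > d for every d. *)
Definition dim_gt (d : nat) : Prop := ~ dim_le d.

End Dimension.

(* The data of a Banach bundle: a map bproj from the total space to X, together
   with, for every x, a Banach space bfiber x whose underlying set is
   identified with bproj^-1(x) via the injection bincl x. *)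
Record bundle_data (R : realType) (X : topologicalType) := BundleData {
  btotal :> topologicalType;
  bproj : btotal -> X;
  bfiber : X -> completeNormedModType R[i];
  bincl : forall x, bfiber x -> btotal;
  bincl_inj : forall x, injective (@bincl x);
  bincl_range : forall x, range (@bincl x) = bproj @^-1` [set x]
}.

Section BundleOps.
Variables (R : realType) (X : topologicalType) (E : bundle_data R X).

(* The inverse of bincl x on bproj^-1(x), extended by 0. *)
Definition bcoord (x : X) (z : E) : bfiber E x :=
  xget 0 [set v | bincl v = z].

Definition bscale (a : R[i]) (z : E) : E :=
  bincl (a *: bcoord (bproj z) z).

(* Meaningful only when z and w lie in the same fiber. *)
Definition badd (z w : E) : E :=
  bincl (bcoord (bproj z) z + bcoord (bproj z) w).

Definition bnorm (z : E) : R := rnorm (bcoord (bproj z) z).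

End BundleOps.

(* Continuously normed, or (F), Banach bundles. *)
Record banach_bundle (R : realType) (X : topologicalType) := BanachBundle {
  bdata :> bundle_data R X;
  btotal_hausdorff : hausdorff_space bdata;
  bproj_continuous : continuous (@bproj R X bdata);
  bproj_open : forall U : set bdata, open U -> open (@bproj R X bdata @` U);
  bproj_surj : range (@bproj R X bdata) = [set: X];
  bscale_continuous :
    continuous (fun az : R[i] * bdata => bscale az.1 az.2);
  badd_continuous :
    {within [set zw : bdata * bdata | bproj zw.1 = bproj zw.2],
      continuous (fun zw : bdata * bdata => badd zw.1 zw.2)};
  bnorm_continuous : continuous (@bnorm R X bdata);
  bnbhs0 : forall (x : X) (W : set bdata),
    nbhs (bincl (0 : bfiber bdata x)) W <->
    exists (U : set X) (e : R), [/\ nbhs x U, 0 < e &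
      [set z : bdata | U (bproj z) /\ bnorm z < e] `<=` W]
}.

Section ContinuousFunctions.
Variables (R : realType) (X : topologicalType).

(* The algebra C(X), with pointwise operations. *)
Definition CX := continuousType X R[i].

HB.instance Definition _ := Choice.on CX.

Implicit Types f g h : CX.

Let cont_cst (c : R[i]) : continuous (fun _ : X => c).
Proof. by move=> x; exact: cvg_cst. Qed.

Let cont_opp f : continuous (fun x => - f x).
Proof. by move=> x; exact: (@cvgN R[i] R[i]^o X _ _ f _ (@cts_fun _ _ f x)). Qed.

Let cont_add f g : continuous (fun x => f x + g x).
Proof.
move=> x; exact: (@cvgD R[i] R[i]^o X _ _ f g _ _ (@cts_fun _ _ f x)
  (@cts_fun _ _ g x)).
Qed.

Let cont_mul f g : continuous (fun x => f x * g x).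
Proof.
move=> x; exact: (@cvgM R[i] X _ _ f g _ _ (@cts_fun _ _ f x)
  (@cts_fun _ _ g x)).
Qed.

Definition CX_cst (c : R[i]) : CX := mkcts (@cont_cst c).
Definition CX_opp f : CX := mkcts (@cont_opp f).
Definition CX_add f g : CX := mkcts (@cont_add f g).
Definition CX_mul f g : CX := mkcts (@cont_mul f g).

Let CX_addA : associative CX_add.
Proof. by move=> f g h; apply/continuousEP => x; exact: addrA. Qed.
Let CX_addC : commutative CX_add.
Proof. by move=> f g; apply/continuousEP => x; exact: addrC. Qed.
Let CX_add0 : left_id (CX_cst 0) CX_add.
Proof. by move=> f; apply/continuousEP => x; exact: add0r. Qed.
Let CX_addN : left_inverse (CX_cst 0) CX_opp CX_add.
Proof. by move=> f; apply/continuousEP => x; exact: addNr. Qed.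

HB.instance Definition _ :=
  GRing.isZmodule.Build CX CX_addA CX_addC CX_add0 CX_addN.

Let CX_mulA : associative CX_mul.
Proof. by move=> f g h; apply/continuousEP => x; exact: mulrA. Qed.
Let CX_mulC : commutative CX_mul.
Proof. by move=> f g; apply/continuousEP => x; exact: mulrC. Qed.
Let CX_mul1 : left_id (CX_cst 1) CX_mul.
Proof. by move=> f; apply/continuousEP => x; exact: mul1r. Qed.
Let CX_mulDl : left_distributive CX_mul CX_add.
Proof. by move=> f g h; apply/continuousEP => x; exact: mulrDl. Qed.

HB.instance Definition _ :=
  GRing.Zmodule_isComPzRing.Build CX CX_mulA CX_mulC CX_mul1 CX_mulDl.

(* Supremum norm; X is compact in all uses, so the supremum is that of a
   bounded set (and it is 0 when X is empty). *)
Definition CX_norm f : R := sup (range (fun x => rnorm (f x : R[i]^o))).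

End ContinuousFunctions.

Record section (R : realType) (X : topologicalType) (E : banach_bundle R X) :=
  MkSection {
    section_fun :> X -> E;
    section_continuous : continuous section_fun;
    section_proj : forall x, bproj (section_fun x) = x
  }.

Section Sections.
Variables (R : realType) (X : topologicalType) (E : banach_bundle R X).
Implicit Types (s t u : section E) (f g : CX R X).

Lemma bproj_bincl x (v : bfiber E x) : bproj (bincl v) = x.
Proof.
have : range (@bincl R X E x) (bincl v) by exists v.
by rewrite bincl_range.
Qed.

Lemma binclK x : cancel (@bincl R X E x) (bcoord x).
Proof.
move=> v; apply: (@bincl_inj R X E x).
by apply: (@xgetPex _ 0 [set w | bincl w = bincl v]); exists v.
Qed.

Lemma bcoordK x (z : E) : bproj z = x -> bincl (bcoord x z) = z.
Proof.
move=> zx; have : (@bproj R X E @^-1` [set x]) z by [].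
by rewrite -bincl_range => -[v _ <-]; rewrite binclK.
Qed.

Definition section_val s x : bfiber E x := bcoord x (s x).

Lemma section_valK s x : bincl (section_val s x) = s x.
Proof. by apply: bcoordK; exact: section_proj. Qed.

Lemma section_eq s t : (forall x, section_val s x = section_val t x) -> s = t.
Proof.
move=> st; have {st} : section_fun s = section_fun t.
  by apply/funext => x; rewrite -!section_valK st.
case: s t => [s cs ps] [t ct pt] /= e.
by subst t; rewrite (Prop_irrelevance cs ct) (Prop_irrelevance ps pt).
Qed.

Lemma badd_bincl x (v w : bfiber E x) :
  badd (bincl v) (bincl w) = bincl (v + w).
Proof. by rewrite /badd bproj_bincl !binclK. Qed.

Lemma bscale_bincl x (a : R[i]) (v : bfiber E x) :
  bscale a (bincl v) = bincl (a *: v).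
Proof. by rewrite /bscale bproj_bincl binclK. Qed.

Lemma bnorm_bincl x (v : bfiber E x) : bnorm (bincl v) = rnorm v.
Proof. by rewrite /bnorm bproj_bincl binclK. Qed.

Let cont0 : continuous (fun x => bincl (0 : bfiber E x)).
Proof.
move=> x W /(bnbhs0 (b := E)) [U [e [Ux e0 UeW]]].
rewrite /nbhs /=; near=> y; apply: UeW; split=> /=.
  by rewrite bproj_bincl; near: y.
by rewrite bnorm_bincl /rnorm normr0.
Unshelve. all: by end_near. Qed.

Let proj0 x : bproj (bincl (0 : bfiber E x)) = x.
Proof. exact: bproj_bincl. Qed.

Let cont_add s t : continuous (fun x => badd (s x) (t x)).
Proof.
move=> x.
have /subspace_continuousP/(_ (s x, t x)) := @badd_continuous R X E.
rewrite /= !section_proj => /(_ erefl) h.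
apply: (cvg_trans _ h) => W /=.
rewrite /nbhs /= /within /= => -[[A B] /= [As Bt] AB].
have sA : nbhs x (s @^-1` A) by exact: (section_continuous As).
have tB : nbhs x (t @^-1` B) by exact: (section_continuous Bt).
near=> y; apply: (AB (s y, t y)) => /=; last by rewrite !section_proj.
by split; near: y.
Unshelve. all: by end_near. Qed.

Let proj_add s t x : bproj (badd (s x) (t x)) = x.
Proof. by rewrite bproj_bincl section_proj. Qed.

Let cont_scale f s : continuous (fun x => bscale (f x) (s x)).
Proof.
move=> x; apply: (@continuous_comp _ _ _ (fun y => (f y, s y))
  (fun az : R[i] * E => bscale az.1 az.2)).
  exact: (cvg_pair (@cts_fun _ _ f x) (@section_continuous _ _ _ s x)).
exact: bscale_continuous.
Qed.

Let proj_scale f s x : bproj (bscale (f x) (s x)) = x.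
Proof. by rewrite bproj_bincl section_proj. Qed.

Definition section0 : section E := MkSection cont0 proj0.
Definition section_add s t : section E :=
  MkSection (@cont_add s t) (proj_add s t).
Definition section_scale f s : section E :=
  MkSection (@cont_scale f s) (proj_scale f s).
Definition section_opp s : section E := section_scale (-1) s.

Lemma section_val0 x : section_val section0 x = 0.
Proof. exact: binclK. Qed.

Lemma section_valD s t x :
  section_val (section_add s t) x = section_val s x + section_val t x.
Proof.
by rewrite [LHS]/section_val /= -2!section_valK badd_bincl binclK.
Qed.

Lemma section_valZ f s x :
  section_val (section_scale f s) x = f x *: section_val s x.
Proof.
by rewrite [LHS]/section_val /= -section_valK bscale_bincl binclK.
Qed.

Lemma section_valN s x : section_val (section_opp s) x = - section_val s x.
Proof. by rewrite section_valZ scaleN1r. Qed.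

HB.instance Definition _ := gen_eqMixin (section E).
HB.instance Definition _ := gen_choiceMixin (section E).

Let section_addA : associative section_add.
Proof. by move=> s t u; apply: section_eq => x; rewrite !section_valD addrA. Qed.
Let section_addC : commutative section_add.
Proof. by move=> s t; apply: section_eq => x; rewrite !section_valD addrC. Qed.
Let section_add0 : left_id section0 section_add.
Proof.
by move=> s; apply: section_eq => x; rewrite section_valD section_val0 add0r.
Qed.
Let section_addN : left_inverse section0 section_opp section_add.
Proof.
move=> s; apply: section_eq => x.
by rewrite section_valD section_valN section_val0 addNr.
Qed.

HB.instance Definition _ := GRing.isZmodule.Build (section E)
  section_addA section_addC section_add0 section_addN.

Let section_scaleA f g s :
  section_scale f (section_scale g s) = section_scale (f * g) s.
Proof. by apply: section_eq => x; rewrite !section_valZ scalerA. Qed.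
Let section_scale1 : left_id 1 section_scale.
Proof. by move=> s; apply: section_eq => x; rewrite section_valZ scale1r. Qed.
Let section_scaleDr : right_distributive section_scale +%R.
Proof.
move=> f s t; apply: section_eq => x.
by rewrite section_valZ !section_valD !section_valZ scalerDr.
Qed.
Let section_scaleDl s : {morph section_scale^~ s : f g / f + g}.
Proof.
move=> f g; apply: section_eq => x.
by rewrite section_valD !section_valZ scalerDl.
Qed.

HB.instance Definition _ := GRing.Zmodule_isLmodule.Build (CX R X) (section E)
  section_scaleA section_scale1 section_scaleDr section_scaleDl.

(* Supremum norm; same remark as for CX_norm. *)
Definition section_norm s : R := sup (range (fun x => bnorm (s x))).

End Sections.

(* The p-norm, possibly +oo, of a sequence in a space T with norm N. *)
Definition seq_norm (R : realType) (T : Type) (N : T -> R) (p : R)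
    (v : nat -> T) : \bar R :=
  ((\sum_(0 <= n <oo) ((N (v n)) `^ p)%:E) `^ p^-1)%E.

Definition in_ell (R : realType) (T : Type) (N : T -> R) (p : R)
    (v : nat -> T) : Prop := (seq_norm N p v < +oo)%E.

Section Conditions.
Variables (R : realType) (X : topologicalType) (E : banach_bundle R X).

Definition stratum (d : nat) : set X := [set x | dim_eq (bfiber E x) d].

Definition above (d : nat) : set X := [set x | dim_gt (bfiber E x) d].

(* The restriction of E to V is isomorphic to the product bundle V x C^d: phi
   and psi are mutually inverse homeomorphisms between bproj^-1(V) and V x C^d
   (their values elsewhere are irrelevant), over V and linear on fibers. *)
Definition trivial_over (d : nat) (V : set X) : Prop :=
  exists (phi : E -> X * 'rV[R[i]]_d) (psi : X * 'rV[R[i]]_d -> E),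
  [/\ {within (@bproj R X E) @^-1` V, continuous phi},
      {within V `*` [set: 'rV[R[i]]_d], continuous psi},
      (forall z, V (bproj z) -> (phi z).1 = bproj z /\ psi (phi z) = z),
      (forall xc, V xc.1 -> bproj (psi xc) = xc.1 /\ phi (psi xc) = xc) &
      (forall x, V x -> linear (fun v : bfiber E x => (phi (bincl v)).2))].

Definition finitely_trivialized (d : nat) : Prop :=
  exists (m : nat) (V : 'I_m -> set X),
    \bigcup_i V i = stratum d /\
    forall i, (exists2 U : set X, open U & V i = stratum d `&` U) /\
              trivial_over d (V i).

Definition condition_a : Prop :=
  [/\ exists N, forall x, dim_le (bfiber E x) N,
      forall d, finitely_trivialized d &
      forall d, Fsigma (above d)].

Definition generated_submodule (K : nat) (w : 'I_K -> section E) :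
    set (section E) :=
  [set s | exists f : 'I_K -> CX R X, s = \sum_i f i *: w i].

Definition norm_dense (S : set (section E)) : Prop :=
  forall (s : section E) (e : R), 0 < e ->
    exists2 t, S t & section_norm (s - t) < e.

Definition topologically_finitely_generated : Prop :=
  exists (K : nat) (w : 'I_K -> section E),
    norm_dense (generated_submodule w).

Definition ell_decomposable (p : R) : Prop :=
  exists K : nat, forall v : nat -> section E, in_ell (@section_norm R X E) p v ->
    exists (f : nat -> 'I_K -> CX R X) (w : 'I_K -> section E),
      (forall i, in_ell (@CX_norm R X) p (fun n => f n i)) /\
      (forall n, v n = \sum_i f n i *: w i).

Definition condition_c_all : Prop :=
  (forall d, Fsigma (above d)) /\ (forall p : R, 1 <= p -> ell_decomposable p).

Definition condition_c_some : Prop :=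
  (forall d, Fsigma (above d)) /\ (exists2 p : R, 1 <= p & ell_decomposable p).

End Conditions.

(* Main.v *)
Require Import Defs.
From mathcomp Require Import all_boot all_order all_algebra.
From mathcomp Require Import all_classical all_reals all_analysis.
From mathcomp Require Import borel_hierarchy complex.
From mathcomp Require Import ring lra.

Set Implicit Arguments.
Unset Strict Implicit.
Unset Printing Implicit Defensive.

Import Order.TTheory GRing.Theory Num.Theory numFieldNormedType.Exports.

Local Open Scope classical_set_scope.
Local Open Scope ring_scope.

(** Every implication passes through one pointwise property, [spanning]: some
finite family of global sections generates each fibre algebraically.

Sections are abundant: a bounded section that is continuous on a closed set
extends to the whole compact base ([section_extension]). One starts from the
extension by zero, which is continuous up to a bounded error, and improves it
repeatedly: near each point the values can be moved, by at most the current
error, into a neighbourhood of the total space that is thin in every fibre, and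
a partition of unity glues these local choices because the estimates are convex.
The errors are halved at each step, so the sections converge uniformly. In
particular every vector lies on a global section, which makes the sets of large
fibre dimension open ([above_open]).

Spanning is the same as topological finite generation. The fibre values of a
dense submodule are dense, and a finite-dimensional subspace is closed, hence
they are everything ([dense_spanning]); conversely, combinations with constant
coefficients approximate a given section near each point and are glued by a
partition of unity ([spanning_dense]).

Spanning gives (a): where the fibre has dimension d, some d of the sections form
a basis, on a relatively open set, and a continuous basis is a trivialization
([frame_trivial]). The fibre dimension exceeds d exactly where some d + 1 of the
sections are independent, that is, where their combinations with coefficients of
maximum modulus 1 are bounded below by some 1 / (n + 1), a closed condition for
each n ([spanning_above_Fsigma]).

Conversely, under (a) the local bases of a stratum X_d, multiplied by functions
that are positive exactly on pieces of X_d, vanish continuously at the boundary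
of these pieces inside the closed set of points of fibre dimension at most d,
and extend to X. The functions exist because X_d is a countable union of closed
sets ([cozero_cover_Fsigma]), and finitely many strata need finitely many
sections ([condition_a_spanning]).

For (a) implies (c), a sequence v in l^p is decomposed stratum by stratum, by
increasing dimension ([stratum_decomposition]). Once the terms vanish where the
dimension is less than d, they have on the points of dimension at most d a
common profile theta that vanishes off X_d: the norm of v_n is at most
A_n theta^2 with A in l^p ([exists_profile]). With a partition of unity psi^2
and frames e on X_d, one takes w = theta psi e for the generators, and psi / theta
times the coordinates of v_n for the coefficients. Both vanish where theta or psi
does, provided that the frames have norm at most 1 and that coordinates are
bounded by a constant times the norm. Such frames come from a Gram-Schmidt
process in which the orthogonal projection onto the previous vectors is replaced
by a continuous choice of an almost best approximation ([bounded_frame]). After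
extending generators and coefficients to X, the difference vanishes also on X_d,
and the number of terms used depends on the strata alone.

Finally (c), for one p, gives a spanning family. If the fibre at x had more than
K dimensions, K + 1 sections with independent values at x would not decompose
along K generators. The strata are countable unions of compact sets, on each of
which finitely many sections span the fibres; all these sections, damped so as
to form a sequence in l^p, decompose along K sections, which therefore span
([decomposable_spanning]). *)

(** * Norms and limits over the complex numbers *)

(** The modulus: [R[i]] acts on itself through its regular copy, whose norm has
real values under [rnorm]. *)
Notation cabs z := (rnorm (z : _^o)).

Section ComplexNorm.
Variable R : realType.

Section NormedModule.
Variable V : normedModType R[i].
Implicit Types (v w : V) (a : R[i]).

Lemma rnormE v : `|v| = (rnorm v)%:C%C.
Proof. by rewrite /rnorm RRe_real // normr_real. Qed.

Lemma rnorm_ge0 v : 0 <= rnorm v.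
Proof. by have := normr_ge0 v; rewrite rnormE lecR. Qed.

Lemma rnorm0 : rnorm (0 : V) = 0.
Proof. by rewrite /rnorm normr0. Qed.

Lemma rnorm_eq0 v : (rnorm v == 0) = (v == 0).
Proof. by rewrite -(normr_eq0 v) rnormE fmorph_eq0. Qed.

Lemma rnormN v : rnorm (- v) = rnorm v.
Proof. by rewrite /rnorm normrN. Qed.

Lemma rnormB v w : rnorm (v - w) = rnorm (w - v).
Proof. by rewrite -rnormN opprB. Qed.

Lemma rnormD v w : rnorm (v + w) <= rnorm v + rnorm w.
Proof. by rewrite -lecR rmorphD /= -!rnormE ler_normD. Qed.

Lemma rnormZ a v : rnorm (a *: v) = cabs a * rnorm v.
Proof. by apply: complexI; rewrite rmorphM /= -!rnormE normrZ. Qed.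

Lemma rnorm_sum (I : Type) (r : seq I) (P : pred I) (F : I -> V) :
  rnorm (\sum_(i <- r | P i) F i) <= \sum_(i <- r | P i) rnorm (F i).
Proof.
elim/big_rec2 : _ => [|i x v _ ih]; first by rewrite rnorm0.
by rewrite (le_trans (rnormD _ _))// lerD2l.
Qed.

Lemma ler_rnorm_dist v w : `|rnorm v - rnorm w| <= rnorm (v - w).
Proof.
have h (a b : V) : rnorm a - rnorm b <= rnorm (a - b).
  by rewrite lerBlDr -[X in rnorm X <= _](subrK b) rnormD.
by rewrite ler_norml h andbT lerNl opprB rnormB h.
Qed.

End NormedModule.

Lemma cabsM (a b : R[i]) :
  cabs (a * b) = cabs a * cabs b.
Proof. exact: (rnormZ (V := R[i]^o)). Qed.

Lemma cabs_real (r : R) : cabs r%:C%C = `|r|.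
Proof.
change (complex.Re `|(r%:C)%C : R[i]| = `|r|).
by rewrite normc_def /= expr0n addr0 sqrtr_sqr.
Qed.

Lemma normed_cvgP (V : normedModType R[i]) (T : Type) (F : set_system T)
    (FF : Filter F) (f : T -> V) (v : V) :
  f @ F --> v <-> forall e : R, 0 < e -> \forall t \near F, rnorm (f t - v) < e.
Proof.
split.
  move=> /cvgrPdist_lt fv e e0.
  have := fv (e%:C)%C; rewrite ltcR => /(_ e0); apply: filterS => t.
  by rewrite rnormE ltcR rnormB.
move=> fv; apply/cvgrPdist_lt => e e0.
have er : e = (complex.Re e)%:C%C by rewrite RRe_real// gtr0_real.
have := fv (complex.Re e); rewrite er in e0.
rewrite -ltcR => /(_ e0); apply: filterS => t.
by rewrite er -ltcR => h; rewrite rnormE rnormB.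
Qed.

Lemma complex_cvgP (T : Type) (F : set_system T)
    (FF : Filter F) (f : T -> R[i]) (v : R[i]) :
  f @ F --> v <-> forall e : R, 0 < e ->
    \forall t \near F, cabs (f t - v) < e.
Proof. exact: (@normed_cvgP R[i]^o). Qed.

Lemma cvg_real_complex (T : Type) (F : set_system T)
    (FF : Filter F) (f : T -> R) (l : R) :
  f @ F --> l -> (fun t => (f t)%:C%C) @ F --> (l%:C%C : R[i]).
Proof.
move=> /cvgrPdist_lt fl; apply/complex_cvgP => e /fl; apply: filterS => t.
by rewrite -rmorphB cabs_real distrC.
Qed.

End ComplexNorm.

Lemma real_cvgP (R : realType) (T : Type) (F : set_system T)
    (FF : Filter F) (f : T -> R) (l : R) :
  f @ F --> l <-> forall e : R, 0 < e -> \forall t \near F, `|f t - l| < e.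
Proof.
split => [/cvgrPdist_lt h e /h|h].
  by apply: filterS => t; rewrite distrC.
by apply/cvgrPdist_lt => e /h; apply: filterS => t; rewrite distrC.
Qed.

Lemma cvg_real_sum (R : realType) (T I : Type) (F : set_system T)
    (FF : Filter F) (s : seq I) (P : pred I) (f : I -> T -> R) (l : I -> R) :
  (forall i, P i -> f i t @[t --> F] --> l i) ->
  \sum_(i <- s | P i) f i t @[t --> F] --> \sum_(i <- s | P i) l i.
Proof. by move=> fl; apply: cvg_big => //; exact: (@add_continuous R^o). Qed.

(** * Finite covers and partitions of unity *)

Lemma near_forall_seq (I : eqType) (T : Type) (F : set_system T)
    (FF : Filter F) (s : seq I) (P : I -> T -> Prop) :
  (forall i, i \in s -> \forall t \near F, P i t) ->
  \forall t \near F, forall i, i \in s -> P i t.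
Proof.
elim: s => [|j s ih] h; first by apply: nearW => t i; rewrite in_nil.
have hj : \forall t \near F, P j t by apply: h; rewrite inE eqxx.
have hs : \forall t \near F, forall i, i \in s -> P i t.
  by apply: ih => i si; apply: h; rewrite inE si orbT.
by apply: filterS2 hj hs => t ht hst i; rewrite inE => /orP[/eqP->|/hst].
Qed.

Section Covers.
Variable X : topologicalType.

(** The property of containing a given finite set is a filter base on finite sets,
and the near-covering form of compactness applied to it yields the subcover. *)
Lemma finite_nbhs_cover (K : set X) (V : X -> set X) :
  compact K -> (forall x, K x -> nbhs x (V x)) ->
  exists s : seq X, (forall x, x \in s -> K x) /\
    forall y, K y -> exists2 x, x \in s & V x y.
Proof.
move=> /compact_near_coveringP cK Vx.
pose F : set_system (seq X) :=
  fun A => exists s0 : seq X, forall s, {subset s0 <= s} -> A s.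
have FF : Filter F.
  split=> [|A B [s hs] [t ht]|A B AB [s hs]]; first by exists [::].
    exists (s ++ t) => u su; split; [apply: hs|apply: ht] => x xs; apply: su.
      by rewrite mem_cat xs.
    by rewrite mem_cat xs orbT.
  by exists s => t /hs; exact: AB.
have [|s0 hs0] := cK _ F (fun s y => exists2 x, x \in s & K x /\ V x y) FF.
  move=> x Kx; exists (V x, [set s : seq X | x \in s]) => /=.
    split; first exact: Vx.
    by exists [:: x] => s; apply; rewrite inE.
  by move=> [y s] /= [Vy xs]; exists x.
exists [seq x <- s0 | `[< K x >]]; split.
  by move=> x; rewrite mem_filter => /andP[/asboolP].
move=> y Ky; have [x xs [Kx Vxy]] := hs0 s0 (fun _ h => h) _ Ky.
by exists x => //; rewrite mem_filter xs andbT; apply/asboolP.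
Qed.

End Covers.

Section Partition.
Variables (R : realType) (X : topologicalType).
Hypothesis X_compact : compact [set: X].
Hypothesis X_hausdorff : hausdorff_space X.

Let X_normal : normal_space X := compact_normal X_hausdorff X_compact.

(** A point and a closed set not containing it are separated by Urysohn's lemma,
since a compact Hausdorff space is normal. *)
Lemma urysohn_bump (x : X) (V : set X) : open V -> V x ->
  exists u : X -> R, [/\ continuous u, forall y, 0 <= u y <= 1, u x = 1 &
    forall y, ~ V y -> u y = 0].
Proof.
move=> oV Vx.
have : uniform_separator (~` V) [set x].
  apply: normal_uniform_separator => //; first exact: open_closedC.
    exact: accessible_closed_set1 (hausdorff_accessible X_hausdorff) x.
  by apply/seteqP; split => // y [] Vy /= yx; apply: Vy; rewrite yx.
move=> /(@uniform_separatorP _ R)[f [fc f01 f0 f1]].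
exists f; split => //.
- by move=> y; have := f01 (f y); rewrite /= in_itv; apply; exists y.
- by apply: f1; exists x.
- by move=> y Vy; apply: f0; exists y.
Qed.

(** Cutting the Urysohn bumps off at height 1/2 makes each of them vanish in a
neighbourhood of every point outside its open set: the supports are closed
inside. Continuity of a product with a section known only on [V x] needs this. *)
Lemma partition_of_unity (V : X -> set X) :
  (forall x, open (V x)) -> (forall x, V x x) ->
  exists (s : seq X) (phi : X -> X -> R),
  [/\ forall x, continuous (phi x), forall x y, 0 <= phi x y,
      forall y, \sum_(x <- s) phi x y = 1 &
      forall x y, ~ V x y -> \forall z \near y, phi x z = 0].
Proof.
move=> oV Vxx.
have /choice[u hu] x : exists u : X -> R, [/\ continuous u,
    forall y, 0 <= u y <= 1, u x = 1 & forall y, ~ V x y -> u y = 0].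
  by have := urysohn_bump (oV x) (Vxx x).
pose b x y := Num.max (u x y - 2^-1) 0.
have bc x : continuous (b x).
  move=> y; have [uc _ _ _] := hu x.
  apply: (@continuous_max R X (fun z => u x z - 2^-1) (cst 0)).
    by apply: cvgB; [exact: uc|exact: cvg_cst].
  exact: cvg_cst.
have b0 x y : 0 <= b x y by rewrite le_max lexx orbT.
have [|s [_ scov]] := finite_nbhs_cover (V := fun x => [set y | 2^-1 < u x y])
    X_compact.
  move=> x _; have [uc _ ux _] := hu x.
  by apply: cvgr_gt (uc x) _ _; rewrite ux invf_lt1// ltr1n.
pose S y := \sum_(x <- s) b x y.
have Sc : continuous S.
  by move=> y; apply: cvg_real_sum => i _; exact: bc.
have S0 y : 0 < S y.
  have [x xs uxy] := scov y I.
  rewrite /S (big_rem x)//= ltr_pwDl// ?sumr_ge0//.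
  by rewrite /b lt_max subr_gt0 uxy.
exists s, (fun x y => b x y / S y); split.
- move=> x y; apply: cvgM; first exact: bc.
  by apply: cvgV; [rewrite gt_eqF|exact: Sc].
- by move=> x y; apply: divr_ge0 => //; exact: ltW.
- move=> y; rewrite -mulr_suml; apply: divff.
  by rewrite gt_eqF// S0.
- move=> x y Vy; have [uc _ ux u0] := hu x.
  have : \forall z \near y, u x z < 2^-1.
    by apply: cvgr_lt (uc y) _ _; rewrite u0// invr_gt0.
  apply: filterS => z uz; rewrite /b max_r ?mul0r// subr_le0.
  exact: ltW.
Qed.

End Partition.

(** * Convergence in the total space *)

Section Bundle.
Variables (R : realType) (X : topologicalType) (E : banach_bundle R X).
Local Notation fiber := (bfiber E).

Lemma nbhs_badd x (v w : fiber x) (W : set E) :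
  nbhs (bincl (v + w)) W ->
  exists A B : set E, [/\ nbhs (bincl v) A, nbhs (bincl w) B &
    forall y (a b : fiber y), A (bincl a) -> B (bincl b) -> W (bincl (a + b))].
Proof.
have /subspace_continuousP/(_ (bincl v, bincl w)) := @badd_continuous R X E.
rewrite /= !bproj_bincl => /(_ erefl) h; rewrite -badd_bincl => /h.
rewrite /nbhs /= /within /= => -[[A B] /= [Av Bw] AB].
exists A, B; split=> // y a b Aa Bb.
rewrite -badd_bincl; apply: (AB (bincl a, bincl b)) => //=.
by rewrite !bproj_bincl.
Qed.

Lemma nbhs_bscale x (a : R[i]) (v : fiber x) (W : set E) :
  nbhs (bincl (a *: v)) W ->
  exists (A : set R[i]) (B : set E), [/\ nbhs a A, nbhs (bincl v) B &
    forall y c (b : fiber y), A c -> B (bincl b) -> W (bincl (c *: b))].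
Proof.
rewrite -bscale_bincl => aW.
have [[A B] /= [Aa Bv] AB] := @bscale_continuous R X E (a, bincl v) W aW.
exists A, B; split=> // y c b Ac Bb.
by rewrite -bscale_bincl; exact: (AB (c, bincl b)).
Qed.

(** Openness of the projection: nearby fibres meet every neighbourhood of a vector.
It is what replaces local sections before any is known to exist. *)
Lemma nbhs_lift x (v : fiber x) (W : set E) : nbhs (bincl v) W ->
  \forall y \near x, exists w : fiber y, W (bincl w).
Proof.
rewrite nbhsE => -[U [oU Uv] UW].
have : nbhs x (@bproj R X E @` U).
  apply: open_nbhs_nbhs; split; first exact: bproj_open.
  by exists (bincl v) => //; exact: bproj_bincl.
apply: filterS => y [z Uz zy]; exists (bcoord y z); apply: UW.
by rewrite bcoordK.
Qed.

Lemma nbhs_bnorm x (v : fiber x) (e : R) : 0 < e ->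
  nbhs (bincl v) [set z : E | `|bnorm z - rnorm v| < e].
Proof.
move=> e0; have /real_cvgP/(_ _ e0) := @bnorm_continuous R X E (bincl v).
by rewrite bnorm_bincl.
Qed.

Section Tends.
Variables (T : Type) (F : set_system T) (q : T -> X).
Context {FF : Filter F}.
Implicit Types (s t : forall a, fiber (q a)).

(** The base point moves along with the vectors, so that continuity of sections,
of maps into the bundle and of their restrictions to subsets are all instances. *)
Definition tends s x (v : fiber x) :=
  (fun a => bincl (s a) : E) @ F --> (bincl v : E).

Lemma tendsD s t x (v w : fiber x) :
  tends s v -> tends t w -> tends (fun a => s a + t a) (v + w).
Proof.
move=> sv tw W /nbhs_badd[A [B [/sv sA /tw tB AB]]].
by apply: (@filterS2 _ F) sA tB => a; exact: AB.
Qed.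

Lemma tendsZ (f : T -> R[i]) s x (c : R[i]) (v : fiber x) :
  f @ F --> c -> tends s v -> tends (fun a => f a *: s a) (c *: v).
Proof.
move=> fc sv W /nbhs_bscale[A [B [/fc fA /sv sB AB]]].
by apply: (@filterS2 _ F) fA sB => a; exact: AB.
Qed.

Lemma tends0 x : q @ F --> x -> tends (fun a => 0 : fiber (q a)) (0 : fiber x).
Proof.
move=> qx W /(bnbhs0 (b := E)) [U [e [Ux e0 UeW]]].
have := qx _ Ux; apply: (@filterS _ F) => a Ua; apply: UeW => /=.
by rewrite bproj_bincl bnorm_bincl rnorm0.
Qed.

Lemma tends_sum (I : Type) (r : seq I) (s : I -> forall a, fiber (q a)) x
    (v : I -> fiber x) :
  q @ F --> x -> (forall i, tends (s i) (v i)) ->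
  tends (fun a => \sum_(i <- r) s i a) (\sum_(i <- r) v i).
Proof.
move=> qx sv; elim: r => [|i r ih].
  rewrite big_nil; under [fun a => _]functional_extensionality_dep do rewrite big_nil.
  exact: tends0.
rewrite big_cons.
under [fun a => _]functional_extensionality_dep do rewrite big_cons.
exact: tendsD.
Qed.

Lemma tends_norm s x (v : fiber x) :
  tends s v -> rnorm (s a) @[a --> F] --> rnorm v.
Proof.
move=> sv; apply/real_cvgP => e /(nbhs_bnorm v)/sv.
by apply: (@filterS _ F) => a /=; rewrite bnorm_bincl.
Qed.

Lemma tendsB s t x (v w : fiber x) :
  tends s v -> tends t w -> tends (fun a => s a - t a) (v - w).
Proof.
move=> sv tw; under [fun a => _]functional_extensionality_dep do rewrite -scaleN1r.
by rewrite -scaleN1r; apply: tendsD => //; apply: tendsZ => //; exact: cvg_cst.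
Qed.

(** The description of the neighbourhoods of zero vectors is used here: small norm
over a convergent base point means convergence to zero. *)
Lemma tends_small s x : q @ F --> x ->
  rnorm (s a) @[a --> F] --> (0 : R) -> tends s (0 : fiber x).
Proof.
move=> qx s0 W /(bnbhs0 (b := E)) [U [e [Ux e0 UeW]]].
have /real_cvgP/(_ _ e0) se := s0.
have := qx _ Ux; apply: (@filterS2 _ F) se => a se Ua; apply: UeW => /=.
rewrite bproj_bincl bnorm_bincl; split=> //.
by move: se; rewrite subr0 ger0_norm// rnorm_ge0.
Qed.

Lemma tends_dist s t x (v : fiber x) : tends s v -> tends t v ->
  rnorm (s a - t a) @[a --> F] --> (0 : R).
Proof. by move=> sv /(tendsB sv)/tends_norm; rewrite subrr rnorm0. Qed.

End Tends.

(** Subtraction is continuous and maps the pair of equal vectors to zero, where the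
norm is small. Thin neighbourhoods serve as the missing uniform structure. *)
Lemma nbhs_thin x (v : fiber x) (e : R) : 0 < e ->
  exists W : set E, [/\ open W, W (bincl v) &
    forall y (a b : fiber y), W (bincl a) -> W (bincl b) -> rnorm (a - b) < e].
Proof.
move=> e0.
have : nbhs (bincl (v + -1 *: v)) [set z : E | bnorm z < e].
  have := nbhs_bnorm (v + -1 *: v) e0; apply: filterS => z /=.
  by rewrite scaleN1r subrr rnorm0 subr0; exact: le_lt_trans (ler_norm _).
move=> /nbhs_badd[A [B [Av /nbhs_bscale[C [D [C1 Dv CD]]] AB]]].
have : nbhs (bincl v) (A `&` D) by exact: filterI.
rewrite nbhsE => -[W [oW Wv] WAD]; exists W; split => // y a b Wa Wb.
rewrite -[- b]scaleN1r -bnorm_bincl; apply: AB; first by have [] := WAD _ Wa.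
by apply: CD; [exact: nbhs_singleton|have [] := WAD _ Wb].
Qed.

(** Continuity up to an error [e]. The error is measured in the fibres, to the
trace of a neighbourhood of [s x], because vectors of different fibres have no
distance. *)
Definition almost_continuous (e : R) (s : forall x, fiber x) x :=
  forall W : set E, nbhs (bincl (s x)) W ->
    \forall y \near x, exists2 w : fiber y, W (bincl w) & rnorm (s y - w) < e.

Lemma almost_continuous_le e e' s x : e <= e' ->
  almost_continuous e s x -> almost_continuous e' s x.
Proof.
move=> ee sx W /sx; apply: filterS => y [w Ww sw].
by exists w => //; exact: lt_le_trans ee.
Qed.

Lemma almost_continuousD e e' s t x :
  almost_continuous e s x -> almost_continuous e' t x ->
  almost_continuous (e + e') (fun y => s y + t y) x.
Proof.
move=> sx tx W /nbhs_badd[A [B [/sx sA /tx tB AB]]].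
apply: filterS2 sA tB => y [a Aa sa] [b Bb tb].
exists (a + b); first exact: AB.
by rewrite opprD addrACA (le_lt_trans (rnormD _ _))// ltrD.
Qed.

Lemma almost_continuousZ (f : X -> R[i]) e e' s x :
  {for x, continuous f} -> 0 <= e -> cabs (f x) * e < e' ->
  almost_continuous e s x -> almost_continuous e' (fun y => f y *: s y) x.
Proof.
move=> fc e0 fe sx W /nbhs_bscale[A [B [/fc fA /sx sB AB]]].
have fe' : \forall y \near x, cabs (f y) * e < e'.
  apply: (cvgr_lt (cabs (f x) * e)) => //.
  apply: cvgMl; apply/real_cvgP => d d0.
  have /complex_cvgP/(_ _ d0) := fc; apply: filterS => y.
  exact: le_lt_trans (ler_rnorm_dist _ _).
have {}fA : \forall y \near x, A (f y) by exact: fA.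
apply: filterS3 fA sB fe' => y fA [b Bb sb] fye.
exists (f y *: b); first exact: AB.
rewrite -scalerBr rnormZ (le_lt_trans _ fye)// ler_wpM2l ?rnorm_ge0//.
exact: ltW.
Qed.

Lemma almost_continuous_sum (I : Type) (r : seq I) (e : I -> R) (e' : R)
    (s : I -> forall x, fiber x) x :
  0 < e' -> (forall i, almost_continuous (e i) (s i) x) ->
  almost_continuous (\sum_(i <- r) e i + e') (fun y => \sum_(i <- r) s i y) x.
Proof.
move=> e0 sx; elim: r => [|i r ih].
  move=> W; rewrite big_nil => /(tends0 (@cvg_id _ _)) h.
  have {}h : \forall y \near x, W (bincl (0 : fiber y)) by exact: h.
  apply: filterS h => y W0; exists 0 => //.
  by rewrite !big_nil subrr rnorm0 add0r.
have -> : (fun y => \sum_(i <- i :: r) s i y) =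
    (fun y => s i y + \sum_(i <- r) s i y).
  by apply: functional_extensionality_dep => y; rewrite big_cons.
by rewrite big_cons -addrA; exact: almost_continuousD.
Qed.

Lemma almost_continuous_near0 e (s : forall x, fiber x) x : 0 < e ->
  (\forall y \near x, s y = 0) -> almost_continuous e s x.
Proof.
move=> e0 s0 W; rewrite (nbhs_singleton s0) => /(tends0 (@cvg_id _ _)) h.
  have {}h : \forall y \near x, W (bincl (0 : fiber y)) by exact: h.
by apply: filterS2 h s0 => y /= Wy ->; exists 0; rewrite ?subrr ?rnorm0.
Qed.

(** Lift the jump [t x - s x] to the nearby fibres and add it to the vectors that
approximate [s]. The distance [d] counts twice, once for the lift and once
between [s] and [t]. *)
Lemma almost_continuous_perturb e d e' s t x : 0 <= d ->
  (forall y, rnorm (s y - t y) <= d) -> e + d + d < e' ->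
  almost_continuous e s x -> almost_continuous e' t x.
Proof.
move=> d0 st ee sx W; rewrite -[t x](subrK (s x)) addrC.
move=> /nbhs_badd[A [B [/sx sA Bst AB]]].
pose h := e' - (e + d + d); have h0 : 0 < h by rewrite subr_gt0.
have Bn : nbhs (bincl (t x - s x))
    (B `&` [set z : E | `|bnorm z - rnorm (t x - s x)| < h]).
  by apply: filterI => //; exact: nbhs_bnorm.
have bl := nbhs_lift Bn.
apply: filterS2 sA bl => y [a Aa sa] [b [Bb]] /=; rewrite bnorm_bincl => bd.
exists (a + b); first exact: AB.
have -> : t y - (a + b) = (t y - s y) + ((s y - a) - b).
  by rewrite opprD !addrA subrK.
have be : rnorm b < d + h.
  rewrite -ltrBlDl; apply: le_lt_trans bd; apply: le_trans (ler_norm _).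
  by rewrite lerB// rnormB.
rewrite (le_lt_trans (rnormD _ _))//.
have := rnormD (s y - a) (- b); rewrite rnormN => sab.
have := st y; rewrite rnormB; move: sab sa be; rewrite /h.
set r1 := rnorm _; set r2 := rnorm _; set r3 := rnorm _; set r4 := rnorm _.
lra.
Qed.

(** A small enough error is absorbed by a neighbourhood of zero. *)
Lemma almost_continuous_continuous (s : forall x, fiber x) x :
  (forall e, 0 < e -> almost_continuous e s x) ->
  (fun y => bincl (s y) : E) @ x --> (bincl (s x) : E).
Proof.
move=> sx W; rewrite -{1}[s x]addr0 => /nbhs_badd[A [B [Asx /(bnbhs0 (b := E)) BB AB]]].
have [U [e [Ux e0 UeB]]] := BB.
apply: filterS2 (sx e e0 _ Asx) Ux => y [a Aa sa] Uy /=.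
rewrite -[s y](subrK a) addrC; apply: AB => //; apply: UeB => /=.
by rewrite bproj_bincl bnorm_bincl.
Qed.

End Bundle.

(** * Extension of sections from closed sets *)

Lemma dependent_fun_choice (A : Type) (U : A -> Type) (P : forall a, U a -> Prop) :
  (forall a, exists u, P a u) -> exists f : forall a, U a, forall a, P a (f a).
Proof. by move=> h; exists (fun a => projT1 (cid (h a))) => a; case: cid. Qed.

(** The rate passes to the limit, which is what a uniform limit of sections
needs. *)
Lemma cauchy_rate_limit (R : realType) (V : completeNormedModType R[i])
    (u : nat -> V) (e : nat -> R) :
  e n @[n --> \oo] --> (0 : R) ->
  (forall n m, (n <= m)%N -> rnorm (u m - u n) <= e n) ->
  exists l, forall n, rnorm (l - u n) <= e n.
Proof.
move=> e0 ue.
have uc : cauchy (u n @[n --> \oo]).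
  apply/cauchy_ballP => a a0.
  have ar : a = (complex.Re a)%:C%C by rewrite RRe_real// gtr0_real.
  have a'0 : 0 < complex.Re a / 2 by rewrite divr_gt0// -ltcR -ar.
  have [N _ eN] := (real_cvgP _ _ _).1 e0 _ a'0.
  have uN m : (N <= m)%N -> rnorm (u m - u N) < complex.Re a / 2.
    move=> /ue/le_lt_trans; apply; apply: le_lt_trans (eN N (leqnn N)).
    by rewrite subr0 ler_norm.
  exists (u @` [set m | (N <= m)%N], u @` [set m | (N <= m)%N]).
    by split; exists N => // m Nm; exists m.
  move=> [_ _] /= [[m Nm <-] [k Nk <-]].
  rewrite -ball_normE /= ar rnormE ltcR.
  rewrite -(subrK (u N) (u m)) -addrA (le_lt_trans (rnormD _ _))//.
  rewrite [ltRHS](splitr (complex.Re a)) ltrD ?uN// -rnormN opprB.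
  by rewrite uN.
have /normed_cvgP ul : cvg (u n @[n --> \oo]) by exact: cauchy_cvg.
exists (lim (u n @[n --> \oo])) => n; apply/ler_addgt0Pr => d d0.
have [N _ /(_ (maxn N n) (leq_maxl _ _)) /= uN]  := ul _ d0.
rewrite -(subrK (u (maxn N n)) (lim _)) -addrA addrC.
by rewrite (le_trans (rnormD _ _))// lerD ?ue ?leq_maxr// rnormB ltW.
Qed.

Section Extension.
Variables (R : realType) (X : topologicalType) (E : banach_bundle R X).
Hypothesis X_compact : compact [set: X].
Hypothesis X_hausdorff : hausdorff_space X.
Local Notation fiber := (bfiber E).

Definition continuous_within (C : set X) (s : forall x, fiber x) x :=
  tends (within C (nbhs x)) (q := id) s (s x).

(** Near [x] the values of [s] can be moved by at most [e] into a thin neighbourhood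
of [s x]; any such choice is almost continuous with the thinness as error. A
partition of unity averages the choices, and averages of vectors at distance at
most [e] from [s y] stay at that distance. On [C] the values are kept: the cover
is chosen so that [s y] itself is an admissible choice for [y] in [C]. *)
Lemma improve_section (C : set X) (e d : R) (s : forall x, fiber x) :
  closed C -> 0 < e -> 0 < d -> (forall x, almost_continuous e s x) ->
  (forall x, C x -> continuous_within C s x) ->
  exists s' : forall x, fiber x,
    [/\ forall x, almost_continuous d s' x,
        forall x, rnorm (s' x - s x) <= e & forall x, C x -> s' x = s x].
Proof.
move=> cC e0 d0 sa sC; have d20 : 0 < d / 2 by rewrite divr_gt0.
have /choice[V /choice[W hVW]] x : exists V : set X, exists W : set E,
    [/\ open V, V x, open W,
        forall y (a b : fiber y), W (bincl a) -> W (bincl b) -> rnorm (a - b) < d / 2 &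
        forall y, V y -> exists w : fiber y,
          [/\ W (bincl w), rnorm (w - s y) <= e & C y -> w = s y]].
  have [W [oW Wx Wthin]] := nbhs_thin (s x) d20.
  have Wx' : nbhs (bincl (s x)) W by exact: open_nbhs_nbhs.
  have CW : \forall y \near x, C y -> W (bincl (s y)).
    have [Cx|nCx] := pselect (C x); first exact: sC Wx'.
    have : nbhs x (~` C) by apply: open_nbhs_nbhs; split=> //; exact: closed_openC.
    by apply: filterS.
  have /= h := filterI (sa x W Wx') CW.
  exists (interior ((fun y => exists2 w : fiber y, W (bincl w) & rnorm (s y - w) < e)
    `&` (fun y => C y -> W (bincl (s y))))), W; split.
  - exact: open_interior.
  - exact: h.
  - exact: oW.
  - exact: Wthin.
  - move=> y /interior_subset /= [[w Ww sw] CWy].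
    have [Cy|nCy] := pselect (C y).
      by exists (s y); split; [exact: CWy| rewrite subrr rnorm0 ltW |].
    by exists w; split=> //; rewrite rnormB ltW.
have /choice[t ht] x : exists t : forall y, fiber y, forall y, V x y ->
    [/\ W x (bincl (t y)), rnorm (t y - s y) <= e & C y -> t y = s y].
  apply: dependent_fun_choice (fun y (w : fiber y) => V x y ->
    [/\ W x (bincl w), rnorm (w - s y) <= e & C y -> w = s y]) _ => y.
  have [Vxy|nVxy] := pselect (V x y); last by exists 0.
  by have [_ _ _ _ /(_ y Vxy)[w hw]] := hVW x; exists w.
have oV x : open (V x) by have [] := hVW x.
have Vxx x : V x x by have [] := hVW x.
have [l [phi [phic phi0 phi1 phiV]]] :=
  partition_of_unity R X_compact X_hausdorff oV Vxx.
have phi_nV x y : ~ V x y -> phi x y = 0 by move/phiV/nbhs_singleton.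
exists (fun y => \sum_(x <- l) (phi x y)%:C%C *: t x y); split.
(* [h] is the loss allowed for each of the [size l] products, in total at most
   [d / 4]; the averages of the thinness account for [d / 2]. *)
- move=> y; pose h := d / 4 / (size l).+1%:R.
  have h0 : 0 < h by rewrite !divr_gt0.
  pose a x := phi x y * (d / 2) + h.
  have : almost_continuous (\sum_(x <- l) a x + d / 4)
      (fun y => \sum_(x <- l) (phi x y)%:C%C *: t x y) y.
    apply: (almost_continuous_sum (s := fun x y => (phi x y)%:C%C *: t x y)).
      by rewrite divr_gt0.
    move=> x; have [Vxy|nVxy] := pselect (V x y); last first.
      apply: almost_continuous_near0.
        by rewrite /a phi_nV// mul0r add0r.
      by apply: filterS (phiV _ _ nVxy) => z ->; rewrite scale0r.
    apply: (almost_continuousZ (f := fun z => (phi x z)%:C%C) (e := d / 2)).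
    + by apply: cvg_real_complex; exact: phic.
    + exact: ltW.
    + by rewrite cabs_real ger0_norm// ltrDl.
    have [Wt _ _] := ht x y Vxy; have [_ _ oW thinW _] := hVW x.
    move=> W' W't; have : nbhs (bincl (t x y)) (W' `&` W x).
      by apply: filterI => //; exact: open_nbhs_nbhs.
    move=> /nbhs_lift hl.
    have : \forall z \near y, V x z by apply: open_nbhs_nbhs.
    apply: filterS2 hl => z [w [W'w Ww]] Vxz; exists w => //.
    by apply: thinW => //; have [] := ht x z Vxz.
  apply: almost_continuous_le.
  rewrite big_split /= -mulr_suml phi1 mul1r big_const_seq count_predT iter_addr_0.
  have hl : h *+ size l <= d / 4.
    rewrite -[h *+ _]mulr_natr /h mulrAC ler_pdivrMr// ler_wpM2l//.
      by rewrite divr_ge0// ltW.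
    by rewrite ler_nat.
  lra.
- move=> y.
  have -> : \sum_(x <- l) (phi x y)%:C%C *: t x y - s y =
      \sum_(x <- l) (phi x y)%:C%C *: (t x y - s y).
    under [RHS]eq_bigr do rewrite scalerBr.
    by rewrite sumrB -scaler_suml -rmorph_sum phi1 scale1r.
  apply: le_trans (rnorm_sum _ _ _) _.
  rewrite -[leRHS]mul1r -(phi1 y) mulr_suml; apply: ler_sum => x _.
  rewrite rnormZ cabs_real ger0_norm//.
  have [Vxy|nVxy] := pselect (V x y); last by rewrite phi_nV// !mul0r.
  by rewrite ler_wpM2l//; have [] := ht x y Vxy.
- move=> y Cy.
  transitivity (\sum_(x <- l) (phi x y)%:C%C *: s y).
    apply: eq_bigr => x _.
    have [Vxy|nVxy] := pselect (V x y); last by rewrite phi_nV// !scale0r.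
    by have [_ _ ->] := ht x y Vxy.
  by rewrite -scaler_suml -rmorph_sum phi1 scale1r.
Qed.

(** The zero extension jumps by at most the bound [M]. *)
Lemma almost_continuous_extend0 (C : set X) (M : R) (s : forall x, fiber x) :
  closed C -> 0 <= M -> (forall x, C x -> rnorm (s x) <= M) ->
  (forall x, C x -> continuous_within C s x) ->
  (forall x, ~ C x -> s x = 0) ->
  forall x, almost_continuous (M + 1) s x.
Proof.
move=> cC M0 sM sC s0 x; have M1 : 0 < M + 1 by rewrite ltr_pwDr.
have [Cx|nCx] := pselect (C x); last first.
  apply: almost_continuous_near0 => //.
  have : nbhs x (~` C) by apply: open_nbhs_nbhs; split=> //; exact: closed_openC.
  by apply: filterS.
move=> W Wsx; have CW : \forall y \near x, C y -> W (bincl (s y)) by exact: sC Wsx.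
have : nbhs (bincl (s x)) (W `&` [set z : E | `|bnorm z - rnorm (s x)| < 1]).
  by apply: filterI => //; exact: nbhs_bnorm.
move=> /nbhs_lift; apply: filterS2 CW => y CWy [w [Ww]] /=.
rewrite bnorm_bincl => w1; have [Cy|nCy] := pselect (C y).
  by exists (s y); [exact: CWy|rewrite subrr rnorm0].
exists w => //; rewrite s0// sub0r rnormN -ltrBlDl.
apply: le_lt_trans w1; apply: le_trans (ler_norm _).
by rewrite lerB// sM.
Qed.

(** Improving the zero extension repeatedly, with halved errors, gives a uniformly
convergent sequence; its limit is almost continuous for every error, hence
continuous. *)
Theorem section_extension (C : set X) (M : R) (s : forall x, fiber x) :
  closed C -> 0 <= M -> (forall x, C x -> rnorm (s x) <= M) ->
  (forall x, C x -> continuous_within C s x) ->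
  exists t : section E, forall x, C x -> section_val t x = s x.
Proof.
move=> cC M0 sM sC.
pose s0 x : fiber x := if `[< C x >] then s x else 0.
have s0C x : C x -> s0 x = s x by rewrite /s0; case: asboolP.
have s0nC x : ~ C x -> s0 x = 0 by rewrite /s0; case: asboolP.
have s0cC x : C x -> continuous_within C s0 x.
  move=> Cx W; rewrite s0C// => /(sC x Cx).
  by apply: (@filterS _ (nbhs x)) => y h Cy /=; rewrite s0C//; exact: h.
have s0M x : C x -> rnorm (s0 x) <= M by move=> Cx; rewrite s0C// sM.
have M1 : 0 < M + 1 by rewrite ltr_pwDr.
(* The extension by zero is almost continuous with error [M + 1]. *)
pose e n : R := (M + 1) / 2 ^+ n.
have e0 n : 0 < e n by rewrite divr_gt0// exprn_gt0.
pose P n (u : forall x, fiber x) := (forall x, almost_continuous (e n) u x) /\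
  (forall x, C x -> u x = s x).
have /choice[f hf] (nu : nat * (forall x, fiber x)) : exists u', P nu.1 nu.2 ->
    P nu.1.+1 u' /\ forall x, rnorm (u' x - nu.2 x) <= e nu.1.
  case: nu => n u /=; have [Pu|nPu] := pselect (P n u); last by exists u.
  have [ua uC] := Pu.
  have ucC x : C x -> continuous_within C u x.
    move=> Cx W; rewrite uC// => /(sC x Cx).
    by apply: (@filterS _ (nbhs x)) => y h Cy /=; rewrite uC//; exact: h.
  have [u' [u'a u'u u'C]] := improve_section cC (e0 n) (e0 n.+1) ua ucC.
  by exists u' => _; split=> //; split=> // x Cx; rewrite u'C// uC.
pose fix u n := if n is n'.+1 then f (n', u n') else s0.
have uP n : P n (u n).
  elim: n => [|n ih] /=; last by have [] := hf (n, u n) ih.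
  split=> // x; rewrite /e expr0 divr1.
  exact: (almost_continuous_extend0 cC M0 s0M s0cC s0nC).
have uS n x : rnorm (u n.+1 x - u n x) <= e n by have [_ ] := hf (n, u n) (uP n).
have ue n m x : (n <= m)%N -> rnorm (u m x - u n x) <= 2 * e n.
  move=> nm; rewrite -(subnKC nm); move: (m - n)%N => k {nm m}.
  suff : rnorm (u (n + k)%N x - u n x) <= 2 * e n - 2 * e (n + k)%N.
    by move=> /le_trans; apply; rewrite gerBl// mulr_ge0// ltW.
  elim: k => [|k ih]; first by rewrite addn0 !subrr rnorm0.
  rewrite addnS -(subrK (u (n + k)%N x) (u _ x)) -addrA.
  rewrite (le_trans (rnormD _ _))//.
  have eS : 2 * e (n + k).+1 = e (n + k)%N.
    by rewrite /e exprS invfM mulrCA mulVKf.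
  have := uS (n + k)%N x; rewrite eS; lra.
have elim0 : 2 * e n @[n --> \oo] --> (0 : R).
  rewrite -(mulr0 2); apply: cvgMr; rewrite /e.
  rewrite -(mulr0 (M + 1)); apply: cvgMr.
  under eq_fun do rewrite -exprVn.
  by apply: cvg_expr; rewrite ger0_norm ?invr_ge0// invf_lt1// ltr1n.
have [l hl] : exists l : forall x, fiber x,
    forall x n, rnorm (l x - u n x) <= 2 * e n.
  apply: (dependent_fun_choice (P := fun x (l : fiber x) =>
    forall n, rnorm (l - u n x) <= 2 * e n)) => x.
  by apply: cauchy_rate_limit => // n m; exact: ue.
have lc : continuous (fun x => bincl (l x) : E).
  move=> x; apply: almost_continuous_continuous => d d0.
  have [n hn] : exists n, e n + 2 * e n + 2 * e n < d.
    have [N _ /(_ N (leqnn N))] := (real_cvgP _ _ _).1 elim0 (d / 3) (divr_gt0 d0 (ltr0n _ 3)).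
    by rewrite subr0 => h; exists N; have := ler_norm (2 * e N); lra.
  apply: almost_continuous_perturb hn _; [| |exact: (uP n).1].
    by rewrite mulr_ge0// ltW.
  by move=> y; rewrite rnormB hl.
have lp x : bproj (bincl (l x) : E) = x by exact: bproj_bincl.
exists (MkSection lc lp) => x Cx; rewrite /section_val /= binclK.
apply/eqP; rewrite -subr_eq0 -rnorm_eq0 eq_le rnorm_ge0 andbT.
apply/ler_addgt0Pr => d d0; rewrite add0r.
have [N _ /(_ N (leqnn N))] := (real_cvgP _ _ _).1 elim0 d d0.
rewrite subr0 => /(le_lt_trans (ler_norm _))/ltW; apply: le_trans.
by have := hl x N; rewrite (uP N).2.
Qed.

End Extension.

(** * Linear independence and dimension *)

Section Independence.
Variables (F : fieldType) (V : lmodType F).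

Definition independent d (e : 'I_d -> V) :=
  forall c : 'I_d -> F, \sum_i c i *: e i = 0 -> forall i, c i = 0.

Definition in_span d (e : 'I_d -> V) (v : V) :=
  exists c : 'I_d -> F, v = \sum_i c i *: e i.

Lemma in_span_mem d (e : 'I_d -> V) i : in_span e (e i).
Proof.
exists (fun j => (j == i)%:R); rewrite (bigD1 i)//= eqxx scale1r big1 ?addr0//.
by move=> j /negbTE ->; rewrite scale0r.
Qed.

Lemma in_span_trans d k (e : 'I_d -> V) (w : 'I_k -> V) v :
  (forall i, in_span w (e i)) -> in_span e v -> in_span w v.
Proof.
move=> /choice[a ea] [c ->]; exists (fun j => \sum_i c i * a i j).
under eq_bigr do rewrite ea scaler_sumr.
rewrite exchange_big; apply: eq_bigr => j _.
by rewrite scaler_suml; apply: eq_bigr => i _; rewrite scalerA.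
Qed.

(** Steinitz: with more vectors than generators, the matrix of coordinates has a
nonzero row vector in its kernel. *)
Lemma independent_le d k (e : 'I_d -> V) (w : 'I_k -> V) :
  independent e -> (forall i, in_span w (e i)) -> (d <= k)%N.
Proof.
move=> ei /choice[a ea]; rewrite leqNgt; apply/negP => kd.
pose A : 'M[F]_(d, k) := \matrix_(i, j) a i j.
have : kermx A != 0.
  rewrite -mxrank_eq0 mxrank_ker -lt0n subn_gt0.
  exact: leq_ltn_trans (rank_leq_col _) kd.
move=> /rowV0Pn[u /sub_kermxP uA u0]; case/negP: u0; apply/eqP/rowP => i.
rewrite mxE; apply: (ei (fun i => u 0 i)).
under eq_bigr do rewrite ea scaler_sumr.
rewrite exchange_big big1// => j _.
have /rowP/(_ j) := uA; rewrite !mxE => uAj.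
under eq_bigr do rewrite scalerA.
rewrite -scaler_suml.
by under eq_bigr do [rewrite -[a _ _](mxE matrix_key (fun i j => a i j))];
  rewrite uAj scale0r.
Qed.

Lemma independent_widen d k (dk : (d <= k)%N) (e : 'I_k -> V) :
  independent e -> independent (e \o widen_ord dk).
Proof.
move=> ei c c0 i.
pose c' (j : 'I_k) := if insub (j : nat) is Some i then c i else 0.
have c'E i' : c' (widen_ord dk i') = c i'.
  rewrite /c'; case: insubP => /= [j _ ji|]; last by rewrite ltn_ord.
  by congr c; exact: val_inj.
rewrite -c'E; apply: ei; rewrite -[RHS]c0 (bigID (fun j : 'I_k => (j < d)%N))/=.
rewrite [X in _ + X]big1 ?addr0; last first.
  by move=> j jd; rewrite /c' insubF ?scale0r//; exact: negbTE.
rewrite (big_ord_narrow_cond dk (P := xpredT)).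
by apply: eq_bigr => j _; rewrite c'E.
Qed.

Definition extend_family d (e : 'I_d -> V) (v : V) (i : 'I_d.+1) : V :=
  if unlift ord_max i is Some j then e j else v.

Lemma extend_family_sum d (e : 'I_d -> V) v (c : 'I_d.+1 -> F) :
  \sum_i c i *: extend_family e v i =
  \sum_i c (lift ord_max i) *: e i + c ord_max *: v.
Proof.
rewrite big_ord_recr /=; congr (_ + _); last by rewrite /extend_family unlift_none.
apply: eq_bigr => i _.
have -> : widen_ord (leqnSn d) i = lift ord_max i.
  by apply: val_inj; rewrite /= /bump leqNgt ltn_ord.
by rewrite /extend_family liftK.
Qed.

Lemma extend_independent d (e : 'I_d -> V) v :
  independent e -> ~ in_span e v -> independent (extend_family e v).
Proof.
move=> ei ev c; rewrite extend_family_sum => c0.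
have cm : c ord_max = 0.
  apply: contrapT => /eqP cm; apply: ev.
  exists (fun i => - (c ord_max)^-1 * c (lift ord_max i)).
  under eq_bigr do rewrite -scalerA.
  rewrite -scaler_sumr; move/eqP: c0; rewrite addr_eq0 => /eqP ->.
  by rewrite scalerN scaleNr opprK scalerA mulVf// scale1r.
move=> i; case: (unliftP ord_max i) => [j ->|-> //].
move: c0; rewrite cm scale0r addr0 => c0.
exact: (ei (fun j => c (lift ord_max j))) c0 j.
Qed.

(** An independent subfamily of maximal size cannot be extended by another
member, which is therefore in its span. *)
Lemma independent_subfamily k (w : 'I_k -> V) :
  exists d (g : 'I_d -> 'I_k), independent (w \o g) /\
    forall j, in_span (w \o g) (w j).
Proof.
pose P d := `[< exists g : 'I_d -> 'I_k, independent (w \o g) >].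
have P0 : exists d, P d.
  by exists 0%N; apply/asboolP; exists (ffun0 (card_ord 0)) => c _ [].
have Pk d : P d -> (d <= k)%N.
  move=> /asboolP[g /independent_le]; apply=> i; exact: in_span_mem.
case: (ex_maxnP P0 Pk) => d /asboolP[g gi] dmax; exists d, g; split=> // j.
apply: contrapT => /(extend_independent gi) gj.
suff /dmax : P d.+1 by rewrite ltnn.
apply/asboolP; exists (fun i => if unlift ord_max i is Some l then g l else j).
move=> c c0; apply: gj; rewrite -[RHS]c0; apply: eq_bigr => i _ /=.
by rewrite /extend_family /=; case: unlift.
Qed.

End Independence.

Section Dimension.
Variables (R : realType) (V : lmodType R[i]).

Lemma dim_eq_independent d k (e : 'I_k -> V) :
  dim_eq V d -> independent e -> (k <= d)%N.
Proof. by move=> [w [_ ws]] /independent_le; apply=> i; exact: ws. Qed.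

Lemma dim_eq_inj d k : dim_eq V d -> dim_eq V k -> d = k.
Proof.
move=> dd dk; apply/eqP; rewrite eqn_leq; apply/andP; split.
  by have [e [ei _]] := dd; exact: dim_eq_independent ei.
by have [e [ei _]] := dk; exact: dim_eq_independent ei.
Qed.

Lemma dim_eq_span d (e : 'I_d -> V) : dim_eq V d -> independent e ->
  forall v, in_span e v.
Proof.
move=> dd ei v; apply: contrapT => /(extend_independent ei).
by move=> /(dim_eq_independent dd); rewrite ltnn.
Qed.

(** An independent family of maximal size is a basis, so if none has more than [d]
elements the dimension is at most [d]. This covers infinite dimension. *)
Lemma dim_gtP d : dim_gt V d <-> exists e : 'I_d.+1 -> V, independent e.
Proof.
split=> [Vd|[e ei] [k kd dk]]; last first.
  by have := leq_trans (dim_eq_independent dk ei) kd; rewrite ltnn.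
apply: contrapT => nd; apply: Vd.
pose P k := `[< exists e : 'I_k -> V, independent e >].
have P0 : exists k, P k.
  by exists 0%N; apply/asboolP; exists (fun=> 0) => c _ [].
have Pd k : P k -> (k <= d)%N.
  move=> /asboolP[e ei]; rewrite leqNgt; apply/negP => dk; apply: nd.
  by exists (e \o widen_ord dk); exact: independent_widen.
case: (ex_maxnP P0 Pd) => k /asboolP[e ei] kmax; exists k.
  by apply: Pd; apply/asboolP; exists e.
exists e; split=> // v; apply: contrapT => /(extend_independent ei) ev.
by have /kmax : P k.+1; [apply/asboolP; exists (extend_family e v)|rewrite ltnn].
Qed.

Lemma dim_le_span k (w : 'I_k -> V) : (forall v, in_span w v) -> dim_le V k.
Proof.
move=> ws; have [d [g [gi gs]]] := independent_subfamily w; exists d.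
  by apply: independent_le gi _ => i; exact: in_span_mem.
by exists (w \o g); split=> // v; apply: in_span_trans (ws v).
Qed.

End Dimension.

(** * Lower bounds for frames *)

Lemma exists_max_coef (R : realType) d (f : 'I_d -> R) (j : 'I_d) :
  exists k, forall i, f i <= f k.
Proof.
exists [arg max_(k > j | true) f k]%O.
by case: arg_maxP => // k _ h i; exact: h.
Qed.

Lemma cabs_eq1 (R : realType) : cabs (1 : R[i]) = 1.
Proof. by rewrite -(rmorph1 (real_complex R)) cabs_real normr1. Qed.

Lemma cabsV (R : realType) (c : R[i]) : cabs c^-1 = (cabs c)^-1.
Proof.
have [->|c0] := eqVneq c 0; first by rewrite invr0 rnorm0 invr0.
have n0 : cabs c != 0 by rewrite (rnorm_eq0 (V := R[i]^o)).
by apply: (mulfI n0); rewrite divff// -cabsM divff// cabs_eq1.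
Qed.

Lemma cabs_sqr (R : realType) (c : R[i]) :
  cabs c ^+ 2 = complex.Re c ^+ 2 + complex.Im c ^+ 2.
Proof.
have -> : cabs c = Num.sqrt (complex.Re c ^+ 2 + complex.Im c ^+ 2).
  by transitivity (complex.Re `|c : R[i]|); rewrite // normc_def.
by rewrite sqr_sqrtr// addr_ge0// sqr_ge0.
Qed.

Lemma cabs_Re (R : realType) (c : R[i]) : `|complex.Re c| <= cabs c.
Proof.
rewrite -(ler_pXn2r (ltn0Sn 1)) ?nnegrE ?rnorm_ge0// cabs_sqr.
by rewrite real_normK ?num_real// lerDl sqr_ge0.
Qed.

Lemma cabs_Im (R : realType) (c : R[i]) : `|complex.Im c| <= cabs c.
Proof.
rewrite -(ler_pXn2r (ltn0Sn 1)) ?nnegrE ?rnorm_ge0// cabs_sqr.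
by rewrite real_normK ?num_real// lerDr sqr_ge0.
Qed.

Lemma compact_polydisc (R : realType) d : exists K : set 'rV[R[i]]_d,
  compact K /\ forall c : 'I_d -> R[i], (forall j, cabs (c j) <= 1) ->
    K (\row_j c j).
Proof.
pose S : set R[i] := (fun z : R * R => z.1%:C + 'i * z.2%:C)%C @`
  (`[-1, 1] `*` `[-1, 1]).
have cS : compact S.
  apply: continuous_compact; last by apply: compact_setX; exact: segment_compact.
  apply: continuous_subspaceT => z.
  apply: (@cvgD R[i] R[i]^o).
    by apply: cvg_real_complex; exact: cvg_fst.
  apply: (@cvgM R[i]); first exact: cvg_cst.
  by apply: cvg_real_complex; exact: cvg_snd.
exists [set c | forall j, S (c ord0 j)]; split.
  exact: (rV_compact (A := fun=> S)).
move=> c c1 j /=; rewrite mxE.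
have re := le_trans (cabs_Re (c j)) (c1 j).
have im := le_trans (cabs_Im (c j)) (c1 j).
exists (complex.Re (c j), complex.Im (c j)) => /=.
  by rewrite /= !in_itv /= -!ler_norml.
by rewrite -complexE.
Qed.

Section Frames.
Variables (R : realType) (X : topologicalType) (E : banach_bundle R X).
Local Notation fiber := (bfiber E).

Section Uniform.
Variables (T : Type) (F : set_system T) (q : T -> X) (x : X) (d : nat).
Context {FF : Filter F}.
Variables (e : 'I_d -> forall a, fiber (q a)) (v : 'I_d -> fiber x).
Hypotheses (qx : q @ F --> x) (ev : forall j, tends F (e j) (v j)).

Lemma tends_combination (c : 'I_d -> R[i]) :
  tends F (fun a => \sum_j c j *: e j a) (\sum_j c j *: v j).
Proof.
by apply: tends_sum => // j; apply: tendsZ => //; exact: cvg_cst.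
Qed.

(** The norm of a combination is jointly continuous in the coefficients and the
base point; compactness of the polydisc makes this uniform in the coefficients,
and homogeneity removes the restriction to the polydisc. *)
Lemma near_combination_norm (h : R) : 0 < h ->
  \forall a \near F, forall (c : 'I_d -> R[i]) (B : R),
    0 <= B -> (forall j, cabs (c j) <= B) ->
    `|rnorm (\sum_j c j *: e j a) - rnorm (\sum_j c j *: v j)| <= h * B.
Proof.
move=> h0; have [K [/compact_near_coveringP cK Kc]] := compact_polydisc R d.
have {}cK : \forall a \near F, K `<=` [set c |
    `|rnorm (\sum_j c ord0 j *: e j a) - rnorm (\sum_j c ord0 j *: v j)| < h].
  apply: cK => c _.
  pose G := filter_prod (nbhs c) F.
  have GF : Filter G by exact: filter_prod_filter.
  have cj j : (fun z : 'rV[R[i]]_d * T => z.1 ord0 j) @ G --> c ord0 j.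
    apply: (@cvg_comp _ _ _ (fun z => z.1) (fun M : 'rV[R[i]]_d => M ord0 j) G (nbhs c)).
      exact: cvg_fst.
    exact: coord_continuous.
  have qG : (fun z : 'rV[R[i]]_d * T => q z.2) @ G --> x.
    exact: cvg_comp cvg_snd qx.
  have eG j : tends G (q := fun z : 'rV[R[i]]_d * T => q z.2)
      (fun z => e j z.2) (v j).
    have evj : tends F (e j) (v j) by exact: ev.
    move: evj; rewrite /tends.
    apply: (@cvg_comp _ _ _ (fun z => z.2) (fun a => bincl (e j a) : E) G F).
    exact: cvg_snd.
  have h20 : 0 < h / 2 by rewrite divr_gt0.
  have t1 : tends G (q := fun z : 'rV[R[i]]_d * T => q z.2)
      (fun z => \sum_j z.1 ord0 j *: e j z.2) (\sum_j c ord0 j *: v j).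
    by apply: tends_sum => // j; apply: tendsZ.
  have t2 : tends G (q := fun z : 'rV[R[i]]_d * T => x)
      (fun z => \sum_j z.1 ord0 j *: v j) (\sum_j c ord0 j *: v j).
    apply: tends_sum; first exact: cvg_cst.
    by move=> j; apply: tendsZ => //; exact: cvg_cst.
  have /real_cvgP/(_ _ h20) n1 := tends_norm (FF := GF) t1.
  have /real_cvgP/(_ _ h20) n2 := tends_norm (FF := GF) t2.
  apply: filterS2 n1 n2 => z /= n1 n2.
  set r := rnorm (\sum_j c ord0 j *: v j) in n1 n2.
  rewrite -(subrK r (rnorm (\sum_j z.1 _ _ *: e j z.2))) -addrA.
  by rewrite (le_lt_trans (ler_normD _ _))// (splitr h) ltrD// distrC.
apply: filterS cK => a ha c B B0 cB.
have [Bz|Bp] := eqVneq B 0.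
  have c0 j : c j = 0.
    apply/eqP; rewrite -(rnorm_eq0 (V := R[i]^o)) eq_le rnorm_ge0 andbT.
    by rewrite -Bz cB.
  rewrite !big1 ?rnorm0 ?subrr ?normr0 ?mulr_ge0// => [|j _|j _]; first exact: ltW.
    by rewrite c0 scale0r.
  by rewrite c0 scale0r.
have {Bp}B0 : 0 < B by rewrite lt_def Bp.
pose b j := (B%:C)^-1%C * c j.
have cb j : c j = B%:C%C * b j.
  by rewrite mulVKf// fmorph_eq0 gt_eqF.
have cB' : cabs (B%:C%C : R[i]) = B by rewrite cabs_real gtr0_norm.
have b1 j : cabs (b j) <= 1.
  by rewrite /b cabsM cabsV cB' mulrC ler_pdivrMr// mul1r.
have rowE (y : X) (w : 'I_d -> fiber y) :
    \sum_j (\row_i b i) ord0 j *: w j = \sum_j b j *: w j.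
  by apply: eq_bigr => j _; rewrite mxE.
have := ha _ (Kc b b1); rewrite /= !rowE.
have scaleE (y : X) (w : 'I_d -> fiber y) :
    rnorm (\sum_j c j *: w j) = B * rnorm (\sum_j b j *: w j).
  under eq_bigr do rewrite cb -scalerA.
  by rewrite -scaler_sumr rnormZ cB'.
rewrite !scaleE -mulrBr normrM gtr0_norm// [h * B]mulrC => /ltW.
by apply: ler_wpM2l; exact: ltW.
Qed.

Lemma near_frame_relative (h m : R) : 0 < h -> 0 < m ->
  (forall (c : 'I_d -> R[i]) j, m * cabs (c j) <= rnorm (\sum_j c j *: v j)) ->
  \forall a \near F, forall (c : 'I_d -> R[i]),
    `|rnorm (\sum_j c j *: e j a) - rnorm (\sum_j c j *: v j)|
      <= h * rnorm (\sum_j c j *: v j).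
Proof.
move=> h0 m0 vm; have hm : 0 < h * m by rewrite mulr_gt0.
apply: filterS (near_combination_norm hm) => a ha c.
have := ha c (m^-1 * rnorm (\sum_j c j *: v j)).
rewrite -mulrA mulVKf ?gt_eqF//; apply.
  by rewrite mulr_ge0 ?rnorm_ge0// invr_ge0 ltW.
by move=> j; rewrite mulrC ler_pdivlMr// mulrC.
Qed.

Lemma near_frame_lower_bound (m : R) : 0 < m ->
  (forall (c : 'I_d -> R[i]) j, m * cabs (c j) <= rnorm (\sum_j c j *: v j)) ->
  \forall a \near F, forall (c : 'I_d -> R[i]) j,
    m / 2 * cabs (c j) <= rnorm (\sum_j c j *: e j a).
Proof.
move=> m0 vm; have h0 : (0 : R) < 2^-1 by rewrite invr_gt0.
apply: filterS (near_frame_relative h0 m0 vm) => a ha c j.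
have := ha c; rewrite ler_norml => /andP[+ _]; have := vm c j.
set r1 := rnorm _; set r2 := rnorm _; set r3 := rnorm _; lra.
Qed.

End Uniform.

Arguments tends_combination {T F q x d FF e v} qx ev c [t] _.

(** The norm of the combination is positive on the coefficients of maximum modulus
1, a compact set; a maximal coefficient is normalized to 1. *)
Lemma independent_lower_bound x d (v : 'I_d -> fiber x) : independent v ->
  exists2 m : R, 0 < m & forall (c : 'I_d -> R[i]) j,
    m * cabs (c j) <= rnorm (\sum_j c j *: v j).
Proof.
move=> vi; have [K [/compact_near_coveringP cK Kc]] := compact_polydisc R d.
have [N _ hN] : \forall n \near \oo, K `<=` [set c : 'rV[R[i]]_d |
    (exists j, 1 <= cabs (c ord0 j)) ->
    n.+1%:R^-1 <= rnorm (\sum_j c ord0 j *: v j)].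
  apply: cK => c _.
  pose N (b : 'rV[R[i]]_d) := rnorm (\sum_j b ord0 j *: v j).
  have Nc : N @ c --> N c.
    have : tends (nbhs c) (q := fun=> x) (fun b : 'rV[R[i]]_d =>
        \sum_j b ord0 j *: v j) (\sum_j c ord0 j *: v j).
      apply: tends_sum; first exact: cvg_cst.
      by move=> j; apply: tendsZ; [exact: coord_continuous|exact: cvg_cst].
    exact: tends_norm.
  have [c0|cn0] := pselect (forall j, c ord0 j = 0).
    have cc : \forall b \near c, forall j, j \in enum 'I_d ->
        cabs ((b : 'rV[R[i]]_d) ord0 j) < 1.
      apply: (@near_forall_seq _ _ (nbhs c) _ (enum 'I_d)
        (fun j b => is_true (cabs ((b : 'rV[R[i]]_d) ord0 j) < 1))) => j _.
      have /complex_cvgP/(_ 1 ltr01) := @coord_continuous R[i] 1 d ord0 j c.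
      by apply: filterS => b; rewrite c0 subr0.
    exists ([set b | forall j, j \in enum 'I_d -> cabs ((b : 'rV[R[i]]_d) ord0 j) < 1],
      setT); first by split=> //; exact: filterT.
    by move=> [b n] /= [b1 _] [j]; rewrite leNgt b1// mem_enum.
  have Nc0 : 0 < N c.
    rewrite lt_def rnorm_ge0 andbT rnorm_eq0; apply/eqP => Nc0; apply: cn0 => j.
    exact: vi Nc0 j.
  have Nc2 : \forall b \near c, N c / 2 < N b.
    by apply: cvgr_gt Nc _ _; rewrite ltr_pdivrMr// ltr_pMr// ltr1n.
  have n2 : \forall n \near \oo, n.+1%:R^-1 < N c / 2.
    have /real_cvgP h := @cvg_harmonic R.
    have := h (N c / 2) (divr_gt0 Nc0 (ltr0n _ 2)).
    by apply: filterS => n /=; rewrite subr0 => /(le_lt_trans (ler_norm _)).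
  exists ([set b | N c / 2 < N b], [set n | n.+1%:R^-1 < N c / 2]) => //=.
  by move=> [b n] /= [Nb nN] _; apply: ltW; exact: lt_trans Nb.
exists N.+1%:R^-1 => // c j.
have [k ck] := exists_max_coef (fun i => cabs (c i)) j.
have [ck0|ck0] := eqVneq (cabs (c k)) 0.
  apply: (@le_trans _ _ 0) (rnorm_ge0 _).
  by rewrite mulr_ge0_le0// -ck0.
have ckp : 0 < cabs (c k) by rewrite lt_def ck0 rnorm_ge0.
have ckn : c k != 0 by rewrite -(rnorm_eq0 (V := R[i]^o)).
pose b i := (c k)^-1 * c i.
have /= := hN N (leqnn N) _ (Kc b _); under eq_bigr do rewrite mxE.
have -> : rnorm (\sum_j b j *: v j) = (cabs (c k))^-1 * rnorm (\sum_j c j *: v j).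
  by under eq_bigr do rewrite -scalerA; rewrite -scaler_sumr rnormZ cabsV.
move=> h; apply: le_trans (_ : N.+1%:R^-1 * cabs (c k) <= _).
  by rewrite ler_wpM2l.
rewrite -ler_pdivlMr// mulrC; apply: h.
  by move=> i; rewrite /b cabsM cabsV mulrC ler_pdivrMr// mul1r.
by exists k; rewrite mxE /b mulVf// cabs_eq1.
Qed.

Lemma lower_bound_independent x d (v : 'I_d -> fiber x) (m : R) : 0 < m ->
  (forall (c : 'I_d -> R[i]) j, m * cabs (c j) <= rnorm (\sum_j c j *: v j)) ->
  independent v.
Proof.
move=> m0 vm c c0 j; have := vm c j; rewrite c0 rnorm0 pmulr_rle0//.
by move=> h; apply/eqP; rewrite -(rnorm_eq0 (V := R[i]^o)) eq_le h rnorm_ge0.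
Qed.

(** Independence is an open condition: a lower bound for the frame survives, with a
worse constant, nearby. *)
Lemma near_independent (T : Type) (F : set_system T) (FF : Filter F)
    (q : T -> X) x d (e : 'I_d -> forall a, fiber (q a)) (v : 'I_d -> fiber x) :
  q @ F --> x -> (forall j, tends F (e j) (v j)) -> independent v ->
  \forall a \near F, independent (fun j => e j a).
Proof.
move=> qx ev /independent_lower_bound[m m0 vm].
apply: filterS (near_frame_lower_bound qx ev m0 vm) => a.
by apply: lower_bound_independent; rewrite divr_gt0.
Qed.

End Frames.

Arguments tends_combination {R X E T F q x d FF e v} qx ev c [t] _.

(** * Global sections over a compact base *)

Section SectionValues.
Variables (R : realType) (X : topologicalType) (E : banach_bundle R X).
Implicit Types (s t : section E) (f : CX R X).

Lemma val_add s t x : section_val (s + t) x = section_val s x + section_val t x.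
Proof. exact: section_valD. Qed.

Lemma val_scale f s x : section_val (f *: s) x = f x *: section_val s x.
Proof. exact: section_valZ. Qed.

Lemma val_sub s t x : section_val (s - t) x = section_val s x - section_val t x.
Proof. by rewrite val_add; congr (_ + _); exact: section_valN. Qed.

Lemma val_sum (I : Type) (r : seq I) (s : I -> section E) x :
  section_val (\sum_(i <- r) s i) x = \sum_(i <- r) section_val (s i) x.
Proof.
elim: r => [|i r ih]; first by rewrite !big_nil; exact: section_val0.
by rewrite !big_cons val_add ih.
Qed.

Lemma val_combination K (f : 'I_K -> CX R X) (w : 'I_K -> section E) x :
  section_val (\sum_i f i *: w i) x = \sum_i f i x *: section_val (w i) x.
Proof. by rewrite val_sum; apply: eq_bigr => i _; rewrite val_scale. Qed.

Lemma section_tends s x : tends (nbhs x) (q := id) (section_val s) (section_val s x).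
Proof.
rewrite /tends section_valK.
have -> : (fun a => bincl (section_val s a) : E) = s.
  by apply/funext => a; rewrite section_valK.
exact: section_continuous.
Qed.

Arguments section_tends s x : clear implicits.

Lemma section_tends_within (V : set X) s x :
  tends (within V (nbhs x)) (q := id) (section_val s) (section_val s x).
Proof. by move=> W /section_tends; apply: (@filterS _ (nbhs x)) => y h _. Qed.

Lemma section_rnorm_continuous s : continuous (fun x => rnorm (section_val s x)).
Proof.
move=> x; have := section_tends s x.
exact: (@tends_norm R X E X (nbhs x) id _ (section_val s)).
Qed.

Lemma CX_real_continuous (h : X -> R) :
  continuous h -> continuous (fun x => (h x)%:C%C : R[i]).
Proof. by move=> hc x; apply: cvg_real_complex; exact: hc. Qed.

Definition CX_real (h : X -> R) (hc : continuous h) : CX R X :=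
  mkcts (CX_real_continuous hc).

End SectionValues.

Arguments section_tends {R X E} s x [t] _.

Lemma open_lt_continuous (R : realType) (X : topologicalType) (h : X -> R) (r : R) :
  continuous h -> open [set x | h x < r].
Proof.
by move=> hc; rewrite openE => x hx; apply: cvgr_lt (hc x) _ hx.
Qed.

Lemma open_gt_continuous (R : realType) (X : topologicalType) (h : X -> R) (r : R) :
  continuous h -> open [set x | r < h x].
Proof.
by move=> hc; rewrite openE => x hx; apply: cvgr_gt (hc x) _ hx.
Qed.

Section CompactBase.
Variables (R : realType) (X : topologicalType) (E : banach_bundle R X).
Hypothesis X_compact : compact [set: X].
Hypothesis X_hausdorff : hausdorff_space X.
Local Notation fiber := (bfiber E).
Implicit Types (s t : section E) (f : CX R X).

Lemma continuous_bounded (h : X -> R) : continuous h ->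
  exists2 M : R, 0 < M & forall x, `|h x| <= M.
Proof.
move=> hc; have [|l [_ lc]] :=
    finite_nbhs_cover (V := fun x => [set y | `|h y - h x| < 1]) X_compact.
  by move=> x _; have /real_cvgP/(_ 1 ltr01) := hc x.
exists (1 + \sum_(x <- l) `|h x|); first by rewrite ltr_pwDl// sumr_ge0.
move=> y; have [x xl /= yx] := lc y I.
rewrite -(subrK (h x) (h y)) (le_trans (ler_normD _ _))// lerD//; first exact: ltW.
by rewrite (big_rem x)//= lerDl sumr_ge0.
Qed.

Lemma sup_range_ub (h : X -> R) x : continuous h -> h x <= sup (range h).
Proof.
move=> /continuous_bounded[M _ hM]; apply: ub_le_sup; last by exists x.
by exists M => _ [y _ <-]; exact: le_trans (ler_norm _) (hM y).
Qed.

Lemma sup_range_le (h : X -> R) M : 0 <= M -> (forall x, h x <= M) ->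
  sup (range h) <= M.
Proof.
move=> M0 hM; have [x|nx] := pselect (exists x : X, True); last first.
  rewrite (_ : range h = set0) ?sup0// -subset0 => y [x _ _]; apply: nx.
  by exists x.
by case: x => x _; apply: ge_sup; [exists (h x); exists x|move=> _ [y _ <-]].
Qed.

Lemma sup_range_ge0 (h : X -> R) : continuous h -> (forall x, 0 <= h x) ->
  0 <= sup (range h).
Proof.
move=> hc h0; have [[x _]|nx] := pselect (exists x : X, True).
  exact: le_trans (h0 x) (sup_range_ub x hc).
rewrite (_ : range h = set0) ?sup0// -subset0 => y [x _ _].
by apply: nx; exists x.
Qed.

Let bnorm_section_continuous s : continuous (fun x => bnorm (s x)).
Proof.
by move=> x; apply: continuous_comp; [exact: section_continuous|exact: bnorm_continuous].
Qed.

Lemma section_norm_ub s x : rnorm (section_val s x) <= section_norm s.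
Proof.
rewrite -bnorm_bincl section_valK.
by apply: (sup_range_ub (h := fun x => bnorm (s x))); exact: bnorm_section_continuous.
Qed.

Lemma section_norm_le s M : 0 <= M -> (forall x, rnorm (section_val s x) <= M) ->
  section_norm s <= M.
Proof.
move=> M0 sM; apply: sup_range_le => // x.
by rewrite -section_valK bnorm_bincl.
Qed.

Lemma section_norm_ge0 s : 0 <= section_norm s.
Proof.
apply: sup_range_ge0; first exact: bnorm_section_continuous.
by move=> x; exact: rnorm_ge0.
Qed.

Lemma CX_norm_le f M : 0 <= M -> (forall x, cabs (f x) <= M) -> CX_norm f <= M.
Proof. by move=> M0 fM; exact: sup_range_le. Qed.

Lemma CX_norm_ge0 f : 0 <= CX_norm f.
Proof.
apply: sup_range_ge0 => x; last exact: rnorm_ge0.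
apply/real_cvgP => e e0; have /complex_cvgP/(_ e e0) := @cts_fun _ _ f x.
by apply: filterS => y; exact: le_lt_trans (ler_rnorm_dist _ _).
Qed.

(** A vector is a section on a one-point closed set. *)
Lemma section_through x (v : fiber x) : exists s, section_val s x = v.
Proof.
have cx : closed [set x].
  exact: accessible_closed_set1 (hausdorff_accessible X_hausdorff) x.
have [|||s sx] := section_extension X_compact X_hausdorff
    (s := fun y => bcoord y (bincl v)) (M := rnorm v) cx.
- exact: rnorm_ge0.
- by move=> y ->; rewrite binclK.
- by move=> y -> W /nbhs_singleton Wx; apply: nearW => z /= ->.
- by exists s; rewrite sx// binclK.
Qed.

Lemma sections_near_independent d (s : 'I_d -> section E) x :
  independent (fun j => section_val (s j) x) ->
  \forall y \near x, independent (fun j => section_val (s j) y).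
Proof.
move=> si; apply: (@near_independent R X E X (nbhs x) _ id x d
  (fun j => section_val (s j))) si => // j.
exact: section_tends.
Qed.

Lemma open_independent d (s : 'I_d -> section E) :
  open [set x | independent (fun j => section_val (s j) x)].
Proof. by rewrite openE => x; exact: sections_near_independent. Qed.

Lemma above_open d : open (above E d).
Proof.
rewrite openE => x /dim_gtP[e ei].
have /choice[s se] j := section_through (e j).
have : \forall y \near x, independent (fun j => section_val (s j) y).
  by apply: sections_near_independent; under eq_fun do rewrite se.
by apply: filterS => y yi; apply/dim_gtP; exists (fun j => section_val (s j) y).
Qed.

(** The fibrewise form of topological finite generation, through which all the
implications pass. *)
Definition spanning K (u : 'I_K -> section E) :=
  forall x (v : fiber x), in_span (fun i => section_val (u i) x) v.

(** A vector outside the span would have a positive distance to it, by the lower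
bound for an independent family, whereas density makes the distance zero. *)
Lemma dense_spanning K (w : 'I_K -> section E) :
  norm_dense (generated_submodule w) -> spanning w.
Proof.
move=> wd x v; apply: contrapT => nv.
have [d [g [gi gs]]] := independent_subfamily (fun i => section_val (w i) x).
have nvg : ~ in_span ((fun i => section_val (w i) x) \o g) v.
  move=> /in_span_trans vg; apply: nv; apply: vg => i /=.
  exact: (in_span_mem (fun i => section_val (w i) x)).
have [m m0 vm] := independent_lower_bound (extend_independent gi nvg).
have [s sv] := section_through v.
have [_ [f ->] sf] := wd s m m0.
have [a fa] : in_span ((fun i => section_val (w i) x) \o g)
    (section_val (\sum_i f i *: w i) x).
  by rewrite val_combination; apply: in_span_trans gs _; exists (fun i => f i x).
pose c (i : 'I_d.+1) := if unlift ord_max i is Some j then - a j else 1.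
have := vm c ord_max; rewrite extend_family_sum /c unlift_none cabs_eq1 mulr1.
under eq_bigr do rewrite liftK scaleNr.
rewrite sumrN -fa scale1r addrC -sv -val_sub leNgt.
by rewrite (le_lt_trans (section_norm_ub _ _)).
Qed.

(** Near each point the given section is approximated by the combination that
represents it at that point; a partition of unity averages these combinations,
and their coefficients. *)
Lemma spanning_dense K (w : 'I_K -> section E) :
  spanning w -> norm_dense (generated_submodule w).
Proof.
move=> ws s e e0; have e20 : 0 < e / 2 by rewrite divr_gt0.
have /choice[c hc] x := ws x (section_val s x).
pose a x : section E := \sum_i CX_cst X (c x i) *: w i.
have aE x y : section_val (a x) y = \sum_i c x i *: section_val (w i) y.
  by rewrite val_combination.
pose V x := [set y | rnorm (section_val (s - a x) y) < e / 2].
have oV x : open (V x).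
  by apply: open_lt_continuous; exact: section_rnorm_continuous.
have Vxx x : V x x by rewrite /V /= val_sub aE -hc subrr rnorm0.
have [l [phi [phic phi0 phi1 phiV]]] :=
  partition_of_unity R X_compact X_hausdorff oV Vxx.
pose t : section E := \sum_(x <- l) CX_real (phic x) *: a x.
exists t.
  exists (fun i => \sum_(x <- l) CX_real (phic x) * CX_cst X (c x i)).
  rewrite /t; under eq_bigr do rewrite scaler_sumr.
  rewrite exchange_big; apply: eq_bigr => i _.
  by rewrite scaler_suml; apply: eq_bigr => x _; rewrite scalerA.
apply: le_lt_trans (_ : e / 2 < e); last by rewrite ltr_pdivrMr// ltr_pMr// ltr1n.
apply: section_norm_le => [|y]; first exact: ltW.
have -> : section_val (s - t) y =
    \sum_(x <- l) (phi x y)%:C%C *: section_val (s - a x) y.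
  rewrite val_sub val_sum.
  under [RHS]eq_bigr do rewrite val_sub scalerBr.
  rewrite sumrB -scaler_suml -rmorph_sum phi1 scale1r; congr (_ - _).
  by apply: eq_bigr => x _; rewrite val_scale.
apply: le_trans (rnorm_sum _ _ _) _.
rewrite -[leRHS]mul1r -[X in X * (e / 2)](phi1 y) mulr_suml; apply: ler_sum => x _.
rewrite rnormZ cabs_real ger0_norm//.
have [Vxy|/phiV/nbhs_singleton ->] := pselect (V x y); last by rewrite !mul0r.
by apply: ler_wpM2l => //; move: Vxy; rewrite /V /=; exact: ltW.
Qed.

End CompactBase.

(** * Coordinates and local triviality *)

Lemma closed_ge_continuous (R : realType) (X : topologicalType) (h : X -> R) (r : R) :
  continuous h -> closed [set x | r <= h x].
Proof.
move=> hc; rewrite -openC (_ : ~` _ = [set x | h x < r]).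
  exact: open_lt_continuous.
by apply/seteqP; split=> x /=; rewrite ltNge => /negP.
Qed.

Lemma cvg_rowP (R : realType) d (T : Type) (F : set_system T) (FF : Filter F)
    (f : T -> 'rV[R[i]]_d) (c : 'rV[R[i]]_d) :
  (forall j, f a ord0 j @[a --> F] --> c ord0 j) -> f @ F --> c.
Proof.
move=> fc A [P /= cP PA].
have h : \forall a \near F, forall j, j \in enum 'I_d -> P ord0 j (f a ord0 j).
  apply: (@near_forall_seq _ _ F FF (enum 'I_d)
    (fun j a => P ord0 j (f a ord0 j))) => j _.
  exact: fc (cP ord0 j).
apply: (@filterS _ F) h => a h; apply: PA => i j.
by rewrite ord1; apply: h; rewrite mem_enum.
Qed.

Section Coordinates.
Variables (R : realType) (X : topologicalType) (E : banach_bundle R X).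
Local Notation fiber := (bfiber E).

(** The difference to the combination with limit coordinates tends to zero, and the
lower bound for the frame transfers this to each coordinate. *)
Lemma coordinates_cvg (T : Type) (F : set_system T) (FF : Filter F)
    (q : T -> X) x d (e : 'I_d -> forall a, fiber (q a)) (v : 'I_d -> fiber x)
    (s : forall a, fiber (q a)) (k : T -> 'I_d -> R[i]) (c : 'I_d -> R[i]) :
  q @ F --> x -> (forall j, tends F (e j) (v j)) -> independent v ->
  tends F s (\sum_j c j *: v j) ->
  (\forall a \near F, s a = \sum_j k a j *: e j a) ->
  forall j, k a j @[a --> F] --> c j.
Proof.
move=> qx ev vi sc sk j.
have [m m0 vm] := independent_lower_bound vi.
have ke := near_frame_lower_bound (FF := FF) qx ev m0 vm.
have /real_cvgP sd := tends_dist (FF := FF) sc (tends_combination (FF := FF) qx ev c).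
apply/complex_cvgP => h h0.
have hm : 0 < m / 2 * h by rewrite mulr_gt0// divr_gt0.
apply: filterS3 ke sk (sd _ hm) => a ke sk.
rewrite subr0 ger0_norm ?rnorm_ge0// sk -sumrB => sd'.
have := ke (fun j => k a j - c j) j; under eq_bigr do rewrite scalerBl.
by move=> /le_lt_trans/(_ sd'); rewrite ltr_pM2l// divr_gt0.
Qed.

(** Coordinates in the frame give the trivialization; its continuity is that of the
coordinates along the identity of the total space. *)
Lemma frame_trivial d (V : set X) (e : 'I_d -> forall x, fiber x) :
  (forall x j, V x -> continuous_within V (e j) x) ->
  (forall x, V x -> is_basis (fun j => e j x)) -> trivial_over E d V.
Proof.
move=> ec eb.
have [k hk] : exists k : forall x, fiber x -> 'I_d -> R[i],
    forall x, V x -> forall v, v = \sum_j k x v j *: e j x.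
  apply: (dependent_fun_choice (P := fun x (k : fiber x -> 'I_d -> R[i]) =>
    V x -> forall v, v = \sum_j k v j *: e j x)) => x.
  have [Vx|nVx] := pselect (V x); last by exists (fun _ _ => 0).
  by have [_ /choice[k hk]] := eb x Vx; exists k.
have kU x (v : fiber x) c : V x -> v = \sum_j c j *: e j x -> k x v = c.
  move=> Vx vc; apply/funext => j; apply/eqP; rewrite -subr_eq0; apply/eqP.
  have [ei _] := eb x Vx; apply: (ei (fun j => k x v j - c j)).
  under eq_bigr do rewrite scalerBl.
  by rewrite sumrB -vc -(hk x Vx v) subrr.
have eV T (G : set_system T) (FG : Filter G) (q : T -> X) x j : V x ->
    q @ G --> within V (nbhs x) -> tends G (q := q) (fun a => e j (q a)) (e j x).
  move=> Vx qG W /(ec x j Vx) h; exact: qG h.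
pose phi (z : E) : X * 'rV[R[i]]_d :=
  (bproj z, \row_j k (bproj z) (bcoord (bproj z) z) j).
pose psi (xc : X * 'rV[R[i]]_d) : E := bincl (\sum_j xc.2 ord0 j *: e j xc.1).
exists phi, psi; split.
- apply/subspace_continuousP => z Vz.
  set G := within _ _; have FG : Filter G by exact: within_filter.
  have pG : @bproj R X E @ G --> within V (nbhs (bproj z)).
    move=> A; rewrite /within /= => h.
    have := @bproj_continuous R X E z _ h.
    by apply: (@filterS _ (nbhs z)) => y h' Vy; exact: h'.
  have pz : @bproj R X E @ G --> bproj z by apply: cvg_trans pG _; exact: cvg_within.
  suff kz : (fun a : E => \row_j k (bproj a) (bcoord (bproj a) a) j) @ G -->
      \row_j k (bproj z) (bcoord (bproj z) z) j by exact: (cvg_pair pz kz).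
  apply: cvg_rowP => j; rewrite mxE.
  under eq_fun do rewrite mxE.
  apply: (@coordinates_cvg E G FG (@bproj R X E) (bproj z) d
    (fun j a => e j (bproj a)) (fun j => e j (bproj z))
    (fun a => bcoord (bproj a) a) (fun a => k (bproj a) (bcoord (bproj a) a))).
  + exact: pz.
  + by move=> i; exact: eV.
  + by have [] := eb _ Vz.
  + rewrite -hk// /tends; under [fun a => bincl _]funext do rewrite bcoordK//.
    by rewrite bcoordK//; exact: cvg_within.
  + rewrite /G; apply: (@filterS _ (nbhs z) _ setT); last exact: filterT.
    by move=> a _ Va; exact: hk.
- apply/subspace_continuousP => -[x c] [/= Vx _].
  set G := within _ _; have FG : Filter G by exact: within_filter.
  have pG : fst @ G --> within V (nbhs x).
    move=> A; rewrite /within /= => h.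
    exists ([set y | V y -> A y], setT); first by split=> //; exact: filterT.
    by move=> [y b] /= [h' _] [Vy _]; exact: h'.
  have : tends G (q := fst) (fun xc => \sum_j xc.2 ord0 j *: e j xc.1)
      (\sum_j c ord0 j *: e j x).
    apply: tends_sum; first by apply: cvg_trans pG _; exact: cvg_within.
    move=> j; apply: tendsZ; last exact: eV.
    have cG : (fun z : X * 'rV[R[i]]_d => z.2) @ G --> c.
      move=> A cA; exists (setT, A); first by split=> //; exact: filterT.
      by move=> [y b] /= [_ Ab] _.
    by move=> A cA; exact: (cG _ (@coord_continuous R[i] 1 d ord0 j c A cA)).
  exact.
- move=> z Vz; split=> //; rewrite /psi /phi /=.
  under eq_bigr do rewrite mxE.
  by rewrite -hk// bcoordK.
- move=> [x c] /= Vx; split; first by rewrite /psi bproj_bincl.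
  rewrite /phi /psi bproj_bincl binclK; congr (_, _); apply/rowP => j.
  by rewrite mxE (kU _ _ (fun j => c ord0 j)).
- move=> x Vx a v w; rewrite /phi /= !bproj_bincl !binclK; apply/rowP => j.
  rewrite !mxE (kU _ _ (fun j => a * k x v j + k x w j))//.
  under eq_bigr do rewrite scalerDl -scalerA.
  by rewrite big_split /= -scaler_sumr -!hk.
Qed.

End Coordinates.

Section TrivialFrame.
Variables (R : realType) (X : topologicalType) (E : banach_bundle R X).
Local Notation fiber := (bfiber E).

(** The constant sections of the product bundle, transported. *)
Lemma trivial_frame d (V : set X) : trivial_over E d V ->
  exists e : 'I_d -> forall x, fiber x,
    (forall x j, V x -> continuous_within V (e j) x) /\
    (forall x, V x -> is_basis (fun j => e j x)).
Proof.
move=> [phi [psi [_ psic phiK psiK phil]]].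
pose e j x : fiber x := bcoord x (psi (x, delta_mx ord0 j)).
have eE j x : V x -> bincl (e j x) = psi (x, delta_mx ord0 j).
  by move=> Vx; apply: bcoordK; have [] := psiK (x, delta_mx ord0 j) Vx.
exists e; split.
  move=> x j Vx W; rewrite eE// => Wx.
  move/subspace_continuousP : psic => /(_ (x, delta_mx ord0 j))/(_ _ _ Wx) [].
    by split.
  move=> [A B] /= [Ax Bj] AB; apply: (@filterS _ (nbhs x)) Ax => y Ay Vy /=.
  rewrite eE//; apply: AB; split=> //=; exact: nbhs_singleton.
move=> x Vx; pose L (v : fiber x) := (phi (bincl v)).2.
have Ll : linear L by exact: phil.
have L0 : L 0 = 0.
  by have := Ll (-1) 0 0; rewrite scaler0 addr0 scaleN1r addNr.
have Lsum (c : 'I_d -> R[i]) (w : 'I_d -> fiber x) :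
    L (\sum_j c j *: w j) = \sum_j c j *: L (w j).
  apply: (big_ind2 (fun a b => L a = b)) => [//|a _ b _ <- <-|j _].
    by have := Ll 1 a b; rewrite !scale1r.
  by have := Ll (c j) (w j) 0; rewrite L0 !addr0.
have Lpair v : phi (bincl v) = (x, L v).
  have Vb : V (bproj (bincl v)) by rewrite bproj_bincl.
  have [p1 _] := phiK _ Vb.
  by rewrite [LHS]surjective_pairing; congr (_, _); rewrite p1 ?bproj_bincl.
have Linj v w : L v = L w -> v = w.
  move=> vw; apply: (@bincl_inj R X E x).
  have [_ <-] : (phi (bincl v)).1 = bproj (bincl v) /\ psi (phi (bincl v)) = bincl v.
    by apply: phiK; rewrite bproj_bincl.
  have [_ <-] : (phi (bincl w)).1 = bproj (bincl w) /\ psi (phi (bincl w)) = bincl w.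
    by apply: phiK; rewrite bproj_bincl.
  by rewrite !Lpair vw.
have Le j : L (e j x) = delta_mx ord0 j.
  by rewrite /L eE//; have [_ ->] := psiK (x, delta_mx ord0 j) Vx.
have Lc (c : 'I_d -> R[i]) : L (\sum_j c j *: e j x) = \row_j c j.
  rewrite Lsum [RHS]row_sum_delta; apply: eq_bigr => j _.
  by rewrite Le mxE.
split=> [c|v].
  by move=> /(congr1 L); rewrite Lc L0 => /rowP h i; have := h i; rewrite !mxE.
exists (fun j => L v ord0 j); apply: Linj; rewrite Lc.
by apply/rowP => j; rewrite mxE.
Qed.

End TrivialFrame.

Section SpanningCondition.
Variables (R : realType) (X : topologicalType) (E : banach_bundle R X).
Hypothesis X_compact : compact [set: X].
Hypothesis X_hausdorff : hausdorff_space X.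
Variables (K : nat) (u : 'I_K -> section E).
Hypothesis u_span : spanning u.
Local Notation fiber := (bfiber E).

Let uval x (i : 'I_K) : fiber x := section_val (u i) x.

Let spanning_basis x : exists d (g : 'I_d -> 'I_K),
  is_basis (fun j => uval x (g j)).
Proof.
have [d [g [gi gs]]] := independent_subfamily (uval x).
by exists d, g; split=> // v; apply: in_span_trans gs _; exact: u_span.
Qed.

Lemma spanning_dim_le x : dim_le (fiber x) K.
Proof. exact: dim_le_span (u_span (x := x)). Qed.

(** The pieces are indexed by the choices of [d] of the spanning sections, with
repetitions allowed: those give empty pieces. *)
Lemma spanning_finitely_trivialized d : finitely_trivialized E d.
Proof.
pose I := {ffun 'I_d -> 'I_K}.
pose D (g : I) := [set x | independent (fun j => uval x (g j))].
pose V (i : 'I_#|I|) := stratum E d `&` D (enum_val i).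
exists #|I|, V; split.
  apply/seteqP; split=> [x [i _ []] //|x dx].
  have [k [g gb]] := spanning_basis x.
  have kd : k = d by apply: dim_eq_inj dx; exists (fun j => uval x (g j)).
  subst k; exists (enum_rank [ffun j => g j]) => //; split=> //.
  rewrite /D /= enum_rankK; under eq_fun do rewrite ffunE.
  by have [] := gb.
move=> i; split.
  exists (D (enum_val i)) => //.
  exact: (open_independent (fun j => u (enum_val i j))).
apply: (frame_trivial (e := fun j => section_val (u (enum_val i j)))).
  by move=> x j _; exact: section_tends_within.
by move=> x [dx xi]; split=> //; exact: dim_eq_span.
Qed.

(** Independence of [d + 1] of the sections amounts to a lower bound by some
[1 / (n + 1)] on combinations with coefficients of maximum modulus 1; for fixed
[n] this is an intersection of closed conditions, one for each choice of
coefficients. *)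
Lemma spanning_above_Fsigma d : Fsigma (above E d).
Proof.
pose I := {ffun 'I_d.+1 -> 'I_K}.
pose A (g : I) (n : nat) := \bigcap_(cj in [set: ('I_d.+1 -> R[i]) * 'I_d.+1])
  [set x | n.+1%:R^-1 * cabs (cj.1 cj.2) <=
           rnorm (\sum_j cj.1 j *: uval x (g j))].
have cA g n : closed (A g n).
  apply: closed_bigI => -[c j] _ /=; apply: closed_ge_continuous.
  pose s : section E := \sum_j CX_cst X (c j) *: u (g j).
  have sE x : section_val s x = \sum_j c j *: uval x (g j).
    by rewrite val_combination.
  by under eq_fun do rewrite -sE; exact: section_rnorm_continuous.
pose F k := if unpickle k is Some (g, n) then A g n else set0.
exists F.
  by move=> k; rewrite /F; case: unpickle => [[g n]|]; [exact: cA|exact: closed0].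
apply/seteqP; split=> [x|x [k _]].
  move=> /dim_gtP[e ei].
  have [k [g [gi gs]]] := spanning_basis x.
  have dk : (d.+1 <= k)%N by apply: independent_le ei _ => i; exact: gs.
  pose h : I := [ffun j => g (widen_ord dk j)].
  have hi : independent (fun j => uval x (h j)).
    have := @independent_widen _ _ _ _ dk (fun j => uval x (g j)) gi; congr independent.
    by apply/funext => j; rewrite /h ffunE.
  have [m m0 hm] := independent_lower_bound hi.
  have [n nm] : exists n : nat, n.+1%:R^-1 < m.
    have /real_cvgP/(_ m m0) := @cvg_harmonic R.
    move=> [N _ /(_ N (leqnn N))] /=; rewrite subr0 => h'; exists N.
    exact: le_lt_trans (ler_norm _) h'.
  exists (pickle (h, n)) => //; rewrite /F pickleK => -[c j] _ /=.
  apply: le_trans (hm c j); rewrite ler_wpM2r ?rnorm_ge0//.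
  exact: ltW.
rewrite /F; case: unpickle => [[g n] An|//]; apply/dim_gtP.
exists (fun j => uval x (g j)).
apply: (@lower_bound_independent _ _ _ _ _ _ n.+1%:R^-1) => // c j.
exact: (An (c, j)).
Qed.

Lemma spanning_condition_a : condition_a E.
Proof.
split; [by exists K => x; exact: spanning_dim_le| |].
  exact: spanning_finitely_trivialized.
exact: spanning_above_Fsigma.
Qed.

End SpanningCondition.

(** * Dyadic sums *)

Section WeightedSum.
Variable R : realType.
Implicit Types (h : nat -> R) (M : R).

(** The weights make any bounded family of terms summable, at a rate that depends
only on the bound. *)
Definition dyadic_sum h : R := limn (fun n => \sum_(k < n) h k / 2 ^+ k.+1).

Let partial h n : R := \sum_(k < n) h k / 2 ^+ k.+1.

Lemma partial_dyadic_sum_dist h M n m : (forall k, `|h k| <= M) -> (n <= m)%N ->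
  `|partial h m - partial h n| <= M / 2 ^+ n - M / 2 ^+ m.
Proof.
move=> hM nm; rewrite -(subnKC nm); move: (m - n)%N => k {nm m}.
elim: k => [|k ih]; first by rewrite addn0 !subrr normr0.
rewrite addnS {1}/partial big_ord_recr /= -/(partial h (n + k)) addrAC.
rewrite (le_trans (ler_normD _ _))// normrM [`|_^-1|]ger0_norm; last first.
  by rewrite invr_ge0 exprn_ge0.
have : `|h (n + k)%N| / 2 ^+ (n + k).+1 <= M / 2 ^+ (n + k).+1.
  by rewrite ler_wpM2r// invr_ge0 exprn_ge0.
have -> : M / 2 ^+ (n + k).+1 = M / 2 ^+ (n + k) / 2 by rewrite exprSr invfM mulrA.
move: ih; set a := `|_|; set b := `|_| / _; set c := _ / 2 ^+ (n + k); lra.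
Qed.

Lemma cvg_partial_dyadic_sum h M : (forall k, `|h k| <= M) ->
  partial h n @[n --> \oo] --> dyadic_sum h.
Proof.
move=> hM; suff : cvg (partial h n @[n --> \oo]) by [].
have M0 : 0 <= M by exact: le_trans (hM 0%N).
have : cvgn (series (fun k => h k / 2 ^+ k.+1)).
  apply: normed_cvg; apply: (series_le_cvg _ _ _
    (is_cvg_geometric_series (a := M / 2) (z := 2^-1) _)).
  - by move=> k /=.
  - by move=> k /=; rewrite /geometric /= mulr_ge0 ?divr_ge0// exprn_ge0.
  - move=> k /=; rewrite normrM [`|_^-1|]ger0_norm ?invr_ge0 ?exprn_ge0//.
    by rewrite /geometric /= exprVn -mulrA -invfM -exprS ler_wpM2r// invr_ge0 exprn_ge0.
  - by rewrite ger0_norm ?invr_ge0// invf_lt1// ltr1n.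
rewrite (_ : series _ = partial h)//.
by apply/funext => n; rewrite /series /= big_mkord.
Qed.

Lemma dyadic_sum_dist h M n : (forall k, `|h k| <= M) ->
  `|dyadic_sum h - partial h n| <= M / 2 ^+ n.
Proof.
move=> hM; apply/ler_addgt0Pr => e e0.
have [N _ hN] := (real_cvgP _ _ _).1 (cvg_partial_dyadic_sum hM) e e0.
have /= := hN (maxn N n) (leq_maxl _ _).
have := partial_dyadic_sum_dist hM (leq_maxr N n).
have : 0 <= M / 2 ^+ maxn N n.
  by rewrite divr_ge0 ?exprn_ge0//; exact: le_trans (hM 0%N).
set S := dyadic_sum h; set p := partial h (maxn N n); set q := partial h n.
rewrite !ler_norml !ltr_norml => m0 /andP[? ?] /andP[? ?].
by apply/andP; split; lra.
Qed.

Lemma dyadic_sum0 : dyadic_sum (fun=> 0) = 0.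
Proof.
have z (k : nat) : `|(fun _ : nat => 0 : R) k| <= 0 by rewrite normr0.
have := dyadic_sum_dist 0%N z.
by rewrite mul0r /partial big_ord0 subr0 normr_le0 => /eqP.
Qed.

Lemma dyadic_sum_ge0 h M : (forall k, 0 <= h k <= M) -> 0 <= dyadic_sum h.
Proof.
move=> hM; have hM' k : `|h k| <= M by have /andP[/ger0_norm -> ->] := hM k.
apply: limr_ge; first by apply/cvg_ex; eexists; exact: cvg_partial_dyadic_sum hM'.
apply: nearW => n; apply: sumr_ge0 => k _.
by rewrite divr_ge0 ?exprn_ge0//; have /andP[] := hM k.
Qed.

Lemma dyadic_sum_gt0 h M k : (forall k, 0 <= h k <= M) -> 0 < h k ->
  0 < dyadic_sum h.
Proof.
move=> hM hk; have hM' j : `|h j| <= M by have /andP[/ger0_norm -> ->] := hM j.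
have p0 : 0 < h k / 2 ^+ k.+1 by rewrite divr_gt0// exprn_gt0.
apply: lt_le_trans p0 _; apply: limr_ge.
  by apply/cvg_ex; eexists; exact: cvg_partial_dyadic_sum hM'.
exists k.+1 => // n /= kn; rewrite (bigD1 (Ordinal kn))//= lerDl sumr_ge0// => j _.
by rewrite divr_ge0 ?exprn_ge0//; have /andP[] := hM j.
Qed.

(** A uniform bound on the terms makes the convergence of the sums uniform, so
that the two limits commute. *)
Lemma cvg_dyadic_sum (T : Type) (F : set_system T) (FF : Filter F)
    (h : nat -> T -> R) (l : nat -> R) M :
  (forall k, h k t @[t --> F] --> l k) ->
  (\forall t \near F, forall k, `|h k t| <= M) -> (forall k, `|l k| <= M) ->
  dyadic_sum (h^~ t) @[t --> F] --> dyadic_sum l.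
Proof.
move=> hl hM lM; apply/real_cvgP => e e0.
have e30 : 0 < e / 3 by rewrite divr_gt0.
have [N hN] : exists N, M / 2 ^+ N < e / 3.
  have : M / 2 ^+ n @[n --> \oo] --> (0 : R).
    rewrite -(mulr0 M); apply: cvgMr; under eq_fun do rewrite -exprVn.
    by apply: cvg_expr; rewrite ger0_norm ?invr_ge0// invf_lt1// ltr1n.
  move=> /real_cvgP/(_ _ e30)[N _ /(_ N (leqnn N))] /=; rewrite subr0 => h'.
  by exists N; exact: le_lt_trans (ler_norm _) h'.
have : partial (h^~ t) N @[t --> F] --> partial l N.
  by apply: cvg_real_sum => k _; apply: cvgMl; exact: hl.
move=> /real_cvgP/(_ _ e30); apply: filterS2 hM => t hM.
have := dyadic_sum_dist N hM; have := dyadic_sum_dist N lM.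
set a := dyadic_sum _; set b := partial _ _; set c := dyadic_sum _; set d := partial _ _.
move: hN; rewrite !ler_norml !ltr_norml => hN /andP[? ?] /andP[? ?] /andP[? ?].
by apply/andP; split; lra.
Qed.

End WeightedSum.

(** * Cozero covers *)

Section CozeroCover.
Variables (R : realType) (X : topologicalType).
Hypothesis X_compact : compact [set: X].
Hypothesis X_hausdorff : hausdorff_space X.

Lemma cozero_cover_closed (K : set X) m (U : 'I_m -> set X) : closed K ->
  (forall i, open (U i)) -> K `<=` \bigcup_i U i ->
  exists h : 'I_m -> X -> R, [/\ forall i, continuous (h i),
    forall i x, 0 <= h i x <= 1, forall i x, ~ U i x -> h i x = 0 &
    forall x, K x -> exists i, 0 < h i x].
Proof.
move=> cK oU KU.
have cptK : compact K by exact: subclosed_compact cK X_compact _.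
have /choice[u hu] x : exists u : 'I_m -> X -> R,
    [/\ forall i, continuous (u i), forall i y, 0 <= u i y <= 1,
        forall i y, ~ U i y -> u i y = 0 & K x -> exists i, u i x = 1].
  have [Kx|nKx] := pselect (K x); last first.
    exists (fun _ _ => 0); split=> // i; last by rewrite lexx ler01.
    by move=> y; exact: cvg_cst.
  have [i _ Ux] := KU x Kx.
  have [f [fc f01 fx f0]] := urysohn_bump R X_compact X_hausdorff (oU i) Ux.
  exists (fun j => if j == i then f else fun=> 0); split=> [j|j y|j y|_].
  - by case: eqP => // _ y; exact: cvg_cst.
  - by case: eqP; rewrite ?lexx ?ler01.
  - by case: eqP => // ->; exact: f0.
  - by exists i; rewrite eqxx.
have [l [lK lc]] : exists l : seq X, (forall x, x \in l -> K x) /\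
    forall y, K y -> exists2 x, x \in l & exists i, 0 < u x i y.
  apply: finite_nbhs_cover cptK _ => x Kx.
  have [uc _ _ /(_ Kx)[i ux]] := hu x.
  have : \forall y \near x, 0 < u x i y.
    by apply: cvgr_gt (uc i x) _ _; rewrite ux.
  by apply: filterS => y uy; exists i.
pose n : R := (size l).+1%:R; have n0 : 0 < n by rewrite ltr0n.
exists (fun i y => (\sum_(x <- l) u x i y) / n); split=> [i y|i y|i y Uy|y Ky].
- apply: cvgMl; apply: cvg_real_sum => x _.
  by have [uc _ _ _] := hu x; exact: uc.
- apply/andP; split.
    apply: divr_ge0; last exact: ltW.
    by apply: sumr_ge0 => x _; have [_ /(_ i y)/andP[]] := hu x.
  rewrite ler_pdivrMr// mul1r; apply: (@le_trans _ _ (\sum_(x <- l) 1)).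
    by apply: ler_sum => x _; have [_ /(_ i y)/andP[]] := hu x.
  by rewrite big_const_seq count_predT iter_addr_0 ler_nat.
- by rewrite big1 ?mul0r// => x _; have [_ _ ->] := hu x.
- have [x xl [i uy]] := lc y Ky; exists i; rewrite divr_gt0//.
  rewrite (big_rem x)//= ltr_pwDl// sumr_ge0// => z _.
  by have [_ /(_ i y)/andP[]] := hu z.
Qed.

(** Add up, with dyadic weights, the functions obtained for the closed sets of which
[K] is the union. *)
Lemma cozero_cover_Fsigma (K : set X) m (U : 'I_m -> set X) : Fsigma K ->
  (forall i, open (U i)) -> K `<=` \bigcup_i U i ->
  exists g : 'I_m -> X -> R, [/\ forall i, continuous (g i),
    forall i x, 0 <= g i x, forall i x, 0 < g i x -> U i x &
    forall x, K x -> exists i, 0 < g i x].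
Proof.
move=> [F cF ->] oU FU.
have /choice[h hh] n := cozero_cover_closed (cF n) oU
  (subset_trans (bigcup_sup (F := F) (i := n) I) FU).
have h01 i x n : 0 <= h n i x <= 1 by have [] := hh n.
have h1 i x n : `|h n i x| <= 1 by have /andP[/ger0_norm -> ->] := h01 i x n.
exists (fun i x => dyadic_sum (fun n => h n i x)); split.
- move=> i x; apply: (@cvg_dyadic_sum R X (nbhs x) _ (fun n x => h n i x)
    (fun n => h n i x) 1) => //.
    by move=> n; have [hc _ _ _] := hh n; exact: hc.
  by apply: nearW => y n; exact: h1.
- by move=> i x; exact: (@dyadic_sum_ge0 R _ 1).
- move=> i x; apply: contraPP => Ux.
  have -> : (fun n => h n i x) = fun=> 0.
    by apply/funext => n; have [_ _ ->] := hh n.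
  by rewrite dyadic_sum0 ltxx.
- move=> x [n _ Fx]; have [_ _ _ /(_ x Fx)[i hi]] := hh n.
  by exists i; apply: dyadic_sum_gt0 hi => k; exact: h01.
Qed.

End CozeroCover.

(** * Strata *)

Lemma cvg_restrict (X Y : topologicalType) (C : set X) (f : X -> Y) (x : X) (l : Y) :
  f @ x --> l -> f @ within C (nbhs x) --> l.
Proof. by move=> fl W /fl; apply: (@filterS _ (nbhs x)) => y h _. Qed.

Section Strata.
Variables (R : realType) (X : topologicalType) (E : banach_bundle R X).
Hypothesis X_compact : compact [set: X].
Hypothesis X_hausdorff : hausdorff_space X.
Local Notation fiber := (bfiber E).

(** For [d = k + 1] this is [above k]. The shift of the index lets the stratum of
dimension 0 be treated like the others. *)
Definition at_least d : set X := [set x | exists e : 'I_d -> fiber x, independent e].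

Lemma at_least0 : at_least 0 = setT.
Proof. by apply/seteqP; split=> // x _; exists (fun=> 0) => c _ []. Qed.

Lemma at_leastS d : at_least d.+1 = above E d.
Proof. by apply/seteqP; split=> x /dim_gtP. Qed.

Lemma at_least_open d : open (at_least d).
Proof.
case: d => [|d]; first by rewrite at_least0; exact: openT.
by rewrite at_leastS; exact: above_open.
Qed.

Lemma at_least_Fsigma d : (forall k, Fsigma (above E k)) -> Fsigma (at_least d).
Proof.
move=> h; case: d => [|d]; last by rewrite at_leastS.
rewrite at_least0; exists (fun=> setT); first by move=> _; exact: closedT.
by apply/seteqP; split=> // x _; exists 0%N.
Qed.

Lemma stratumE d : stratum E d = at_least d `&` ~` above E d.
Proof.
apply/seteqP; split=> x.
  by move=> [e eb]; split; [exists e; case: eb|apply; exists d => //; exists e].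
move=> [[e ei] /contrapT[k kd dk]].
have dk' : d = k by apply/eqP; rewrite eqn_leq kd andbT; exact: dim_eq_independent ei.
by rewrite /stratum /= dk'.
Qed.

Lemma not_above_closed d : closed (~` above E d).
Proof. by apply: open_closedC; exact: above_open. Qed.

(** Continuity at a zero of the section follows from a continuous bound that
vanishes there. It is used wherever local frames are cut off. *)
Lemma continuous_within_small (C : set X) (s : forall x, fiber x) (b : X -> R) x :
  s x = 0 -> (forall y, C y -> rnorm (s y) <= b y) ->
  b @ within C (nbhs x) --> (0 : R) -> continuous_within C s x.
Proof.
move=> sx sb b0; rewrite /continuous_within sx.
apply: (@tends_small R X E X (within C (nbhs x)) id); first exact: cvg_within.
apply/real_cvgP => e e0; have /real_cvgP/(_ e e0) := b0.
apply: (@filterS _ (nbhs x)) => y h Cy; have := h Cy.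
rewrite !subr0 (ger0_norm (rnorm_ge0 _)).
by apply: le_lt_trans; apply: le_trans (sb y Cy) (ler_norm _).
Qed.

Lemma continuous_within_scale (C : set X) (f : X -> R) (s : forall x, fiber x) x :
  f @ within C (nbhs x) --> f x -> continuous_within C s x ->
  continuous_within C (fun y => (f y)%:C%C *: s y) x.
Proof.
move=> fc sc; apply: (@tendsZ R X E X (within C (nbhs x)) id) => //.
exact: cvg_real_complex.
Qed.

(** The stratum is an F-sigma set, so its trivializing cover can be refined to a
cover by the pieces where continuous functions on the whole space are positive.
Continuity relatively to the closed set of points of fibre dimension at most [d]
holds because the stratum is relatively open there. *)
Lemma stratum_frames d :
  (forall k, Fsigma (above E k)) -> finitely_trivialized E d ->
  exists m (g : 'I_m -> X -> R) (e : 'I_m -> 'I_d -> forall x, fiber x),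
  [/\ forall i, continuous (g i), forall i x, 0 <= g i x,
      forall i x, ~ above E d x -> 0 < g i x ->
        [/\ stratum E d x, is_basis (fun j => e i j x) &
            forall j, continuous_within (~` above E d) (e i j) x] &
      forall x, stratum E d x -> exists i, 0 < g i x].
Proof.
move=> FX [m [V [VE hV]]].
have /choice[U hU] i : exists U, open U /\ V i = stratum E d `&` U.
  by have [[U oU VU] _] := hV i; exists U.
have /choice[e he] i := trivial_frame (hV i).2.
have sF : Fsigma (stratum E d).
  have [F cF FE] := at_least_Fsigma d FX.
  exists (fun n => F n `&` ~` above E d).
    by move=> n; apply: closedI => //; exact: not_above_closed.
  by rewrite stratumE FE setI_bigcupl.
have oU i : open (U i `&` at_least d).
  by apply: openI; [have [] := hU i|exact: at_least_open].
have sU : stratum E d `<=` \bigcup_i (U i `&` at_least d).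
  move=> x dx; have : (\bigcup_i V i) x by rewrite VE.
  move=> [i _]; rewrite (hU i).2 => -[_ Ux]; exists i => //; split=> //.
  by move: dx; rewrite stratumE => -[].
have [g [gc g0 gU gs]] := cozero_cover_Fsigma R X_compact X_hausdorff sF oU sU.
exists m, g, e; split=> // i x Cx gx.
have [Ux lx] := gU i x gx.
have dx : stratum E d x by rewrite stratumE.
have Vx : V i x by rewrite (hU i).2.
have [ec eb] := he i; split=> //; first exact: eb.
move=> j W /(ec x j Vx) h.
have Un : \forall y \near x, (U i `&` at_least d) y by exact: open_nbhs_nbhs.
apply: (@filterS2 _ (nbhs x)) h Un => y h [Uy ly] Cy; apply: h.
by rewrite (hU i).2 stratumE.
Qed.

(** Lists rather than families indexed by ordinals, because spanning lists will be
concatenated. *)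
Definition list_spans (L : seq (section E)) x :=
  forall v : fiber x, in_span (fun i : 'I_(size L) => section_val L`_i x) v.

Lemma list_spans_family k (w : 'I_k -> section E) (L : seq (section E)) x :
  (forall i, w i \in L) ->
  (forall v : fiber x, in_span (fun i => section_val (w i) x) v) ->
  list_spans L x.
Proof.
move=> wL ws v; apply: in_span_trans (ws v) => i.
have iL : (index (w i) L < size L)%N by rewrite index_mem.
have := in_span_mem (fun i : 'I_(size L) => section_val L`_i x) (Ordinal iL).
by rewrite /= nth_index.
Qed.

Lemma list_spans_sub (L L' : seq (section E)) x :
  {subset L <= L'} -> list_spans L x -> list_spans L' x.
Proof. by move=> LL'; apply: list_spans_family => i; apply/LL'/mem_nth. Qed.

(** Normalized frames multiplied by cozero functions have norms bounded by these
functions, so they extend continuously by zero to the closed set of points of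
fibre dimension at most [d], and from there to [X]. *)
Lemma stratum_spanned d :
  (forall k, Fsigma (above E k)) -> finitely_trivialized E d ->
  exists L : seq (section E), forall x, stratum E d x -> list_spans L x.
Proof.
move=> FX /(stratum_frames FX)[m [g [e [gc g0 ge gs]]]].
pose C := ~` above E d.
pose N i x := 1 + \sum_k rnorm (e i k x).
have N1 i x : 1 <= N i x.
  by rewrite lerDl sumr_ge0// => k _; exact: rnorm_ge0.
have N0 i x : 0 < N i x by exact: lt_le_trans (N1 i x).
pose s i j x : fiber x := ((g i x / N i x)%:C)%C *: e i j x.
have sg i j x : rnorm (s i j x) <= g i x.
  rewrite /s rnormZ cabs_real ger0_norm ?divr_ge0 ?(ltW (N0 _ _))//.
  rewrite mulrAC ler_pdivrMr// ler_wpM2l// /N (bigD1 j)//= addrCA lerDl.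
  by rewrite addr_ge0// sumr_ge0// => k _; exact: rnorm_ge0.
have sc i j x : C x -> continuous_within C (s i j) x.
  move=> Cx; have gcx : g i @ within C (nbhs x) --> g i x.
    by apply: cvg_restrict; exact: gc.
  have := g0 i x; rewrite le_eqVlt => /orP[/eqP gx|gx].
    apply: (@continuous_within_small _ _ (g i)) => [|y _|]; rewrite ?gx//.
    by rewrite /s -gx mul0r scale0r.
  have [_ _ ec] := ge i x Cx gx.
  apply: continuous_within_scale (ec j); apply: cvgM => //.
  apply: cvgV; first by rewrite gt_eqF.
  apply: cvgD; first exact: cvg_cst.
  apply: cvg_real_sum => k _.
  exact: (@tends_norm R X E X (within C (nbhs x)) id _ (e i k) x _ (ec k)).
have /choice[t ht] (ij : 'I_m * 'I_d) : exists t : section E,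
    forall x, C x -> section_val t x = s ij.1 ij.2 x.
  have [M M0 gM] := continuous_bounded X_compact (gc ij.1).
  apply: (section_extension X_compact X_hausdorff (M := M)).
  - exact: not_above_closed.
  - exact: ltW.
  - by move=> x _; apply: le_trans (sg _ _ _) (le_trans (ler_norm _) (gM x)).
  - by move=> x Cx; exact: sc.
exists (codom t) => x dx; have [i gx] := gs x dx.
have Cx : C x by move: dx; rewrite stratumE => -[].
have [_ [_ eb] _] := ge i x Cx gx.
apply: (@list_spans_family d (fun j => t (i, j))) => [j|v]; first exact: codom_f.
have [c ->] := eb v; pose a : R[i] := ((g i x / N i x)%:C)%C.
have a0 : a != 0 by rewrite /a fmorph_eq0 gt_eqF// divr_gt0.
exists (fun j => c j / a); apply: eq_bigr => j _.
by rewrite ht//= /s scalerA divfK.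
Qed.

Lemma condition_a_spanning : condition_a E ->
  exists K (u : 'I_K -> section E), spanning u.
Proof.
move=> [[N hN] ft FX].
have /choice[L hL] d := stratum_spanned FX (ft d).
pose L' := flatten [seq L d | d <- iota 0 N.+1].
exists (size L'), (fun i => L'`_i) => x.
have [d dN dx] := hN x; apply: list_spans_sub (hL d x dx) => s sL.
by apply/flatten_mapP; exists d => //; rewrite mem_iota.
Qed.

End Strata.

(** * Well-conditioned frames *)

Lemma dense_coefficients (R : realType) d : exists y : nat -> 'I_d -> R[i],
  forall (c : 'I_d -> R[i]) (h : R), 0 < h ->
    exists k, forall j, cabs (y k j - c j) < h.
Proof.
(* Gaussian rationals as coordinates. *)
pose rc (q : rat * rat) : R[i] := ((ratr q.1)%:C + 'i * (ratr q.2)%:C)%C.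
exists (fun k => if @unpickle {ffun 'I_d -> rat * rat} k is Some t
  then fun j => rc (t j) else fun=> 0) => c h h0.
have near_rat (r : R) : exists q : rat, `|ratr q - r| < h / 2.
  have [|q] := @rat_in_itvoo R (r - h / 2) (r + h / 2).
    by rewrite ltrD2l gtrN// divr_gt0.
  by rewrite in_itv /= -ltr_distl; exists q.
have /fin_all_exists[t ht] (j : 'I_d) : exists q : rat * rat, cabs (rc q - c j) < h.
  have [a ha] := near_rat (complex.Re (c j)).
  have [b hb] := near_rat (complex.Im (c j)); exists (a, b).
  have -> : rc (a, b) - c j =
      ((ratr a - complex.Re (c j))%:C + 'i * (ratr b - complex.Im (c j))%:C)%C.
    by rewrite [X in _ - X]complexE /rc /= !rmorphB /= mulrBr opprD addrACA.
  rewrite (le_lt_trans (rnormD (V := R[i]^o) _ _))// cabsM.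
  have -> : cabs ('i%C : R[i]) = 1.
    by apply/eqP; rewrite -(eqrXn2 (n := 2)) ?rnorm_ge0// cabs_sqr /= expr0n add0r.
  by rewrite mul1r !cabs_real (splitr h) ltrD.
by exists (pickle [ffun j => t j]) => j; rewrite pickleK ffunE.
Qed.

Section DyadicMean.
Variable R : realType.
Implicit Types (w : nat -> R) (z : nat -> R[i]).

(** A convex combination of countably many complex numbers. The sums are taken
separately on real and imaginary parts because [dyadic_sum] is real-valued. *)
Definition dyadic_mean w z : R[i] :=
  ((dyadic_sum (fun k => w k * complex.Re (z k)))%:C +
   'i * (dyadic_sum (fun k => w k * complex.Im (z k)))%:C)%C /
  (dyadic_sum w)%:C%C.

Lemma cvg_complex_parts (T : Type) (F : set_system T) (FF : Filter F)
    (a b : T -> R) (la lb : R) : a @ F --> la -> b @ F --> lb ->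
  ((a t)%:C + 'i * (b t)%:C)%C @[t --> F] --> (la%:C + 'i * lb%:C : R[i])%C.
Proof.
move=> al bl; apply: (@cvgD R[i] R[i]^o); first exact: cvg_real_complex.
by apply: (@cvgM R[i]); [exact: cvg_cst|exact: cvg_real_complex].
Qed.

Lemma cvg_dyadic_mean (T : Type) (F : set_system T) (FF : Filter F)
    (w : nat -> T -> R) (l : nat -> R) z M :
  (forall k, w k t @[t --> F] --> l k) ->
  (\forall t \near F, forall k, 0 <= w k t <= M /\ w k t * cabs (z k) <= M) ->
  (forall k, 0 <= l k <= M /\ l k * cabs (z k) <= M) ->
  0 < dyadic_sum l ->
  dyadic_mean (w^~ t) z @[t --> F] --> dyadic_mean l z.
Proof.
move=> wl wM lM l0.
have bnd (a : R) (k : nat) (p : R) : `|p| <= cabs (z k) ->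
    0 <= a <= M /\ a * cabs (z k) <= M -> `|a * p| <= M.
  move=> pz [/andP[a0 _] aM]; rewrite normrM ger0_norm//.
  by apply: le_trans aM; rewrite ler_wpM2l.
have part (p : R[i] -> R) : (forall c, `|p c| <= cabs c) ->
    dyadic_sum (fun k => w k t * p (z k)) @[t --> F] -->
    dyadic_sum (fun k => l k * p (z k)).
  move=> hp; apply: (@cvg_dyadic_sum R T F FF (fun k t => w k t * p (z k)) _ M).
  - by move=> k; apply: cvgMl; exact: wl.
  - by apply: filterS wM => t wM k; exact: bnd.
  - by move=> k; exact: bnd.
apply: (@cvgM R[i]).
  by apply: cvg_complex_parts; apply: part; [exact: cabs_Re|exact: cabs_Im].
apply: (@cvgV R[i]).
  by rewrite fmorph_eq0 gt_eqF.
apply: cvg_real_complex; apply: (@cvg_dyadic_sum R T F FF w l M) => //.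
  by apply: filterS wM => t wM k; have [/andP[/ger0_norm ->]] := wM k.
by move=> k; have [/andP[/ger0_norm ->]] := lM k.
Qed.

(** A closed ball being convex, means of points at distance at most [b] from
[h] stay at distance at most [b]. *)
Lemma dyadic_mean_dist (X : topologicalType) (E : banach_bundle R X) (x : X) d
    (h : bfiber E x) (f : 'I_d -> bfiber E x) w (y : nat -> 'I_d -> R[i]) M b :
  (forall k, 0 <= w k <= M) -> (forall k j, w k * cabs (y k j) <= M) ->
  (forall k, 0 < w k -> rnorm (h - \sum_j y k j *: f j) <= b) ->
  0 < dyadic_sum w ->
  rnorm (h - \sum_j dyadic_mean w (y^~ j) *: f j) <= b.
Proof.
move=> wM wyM wb D0; pose D := dyadic_sum w.
pose A j := (dyadic_sum (fun k => w k * complex.Re (y k j)))%:C%C +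
  'i%C * (dyadic_sum (fun k => w k * complex.Im (y k j)))%:C%C : R[i].
have wM' k : `|w k| <= M by have /andP[/ger0_norm -> ->] := wM k.
have Dn0 : (D%:C%C : R[i]) != 0 by rewrite fmorph_eq0 gt_eqF.
have -> : h - \sum_j dyadic_mean w (y^~ j) *: f j =
    (D%:C%C)^-1 *: (D%:C%C *: h - \sum_j A j *: f j).
  rewrite scalerBr scalerA mulVf// scale1r scaler_sumr; congr (_ - _).
  by apply: eq_bigr => j _; rewrite scalerA /dyadic_mean mulrC.
rewrite rnormZ cabsV cabs_real gtr0_norm// mulrC ler_pdivrMr//.
pose Dn n : R := \sum_(k < n) w k / 2 ^+ k.+1.
pose An n j : R[i] := ((\sum_(k < n) (w k * complex.Re (y k j)) / 2 ^+ k.+1)%:C +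
  'i * (\sum_(k < n) (w k * complex.Im (y k j)) / 2 ^+ k.+1)%:C)%C.
have DnD : Dn n @[n --> \oo] --> D by exact: cvg_partial_dyadic_sum wM'.
have AnA j : An n j @[n --> \oo] --> A j.
  apply: cvg_complex_parts; apply: (@cvg_partial_dyadic_sum _ _ M) => k;
    rewrite normrM ger0_norm; try (by have /andP[] := wM k).
    by apply: le_trans (wyM k j); rewrite ler_wpM2l ?cabs_Re//; have /andP[] := wM k.
  by apply: le_trans (wyM k j); rewrite ler_wpM2l ?cabs_Im//; have /andP[] := wM k.
have lhs : rnorm ((Dn n)%:C%C *: h - \sum_j An n j *: f j) @[n --> \oo] -->
    rnorm (D%:C%C *: h - \sum_j A j *: f j).
  apply: (@tends_norm R X E nat \oo (fun=> x) _
    (fun n => (Dn n)%:C%C *: h - \sum_j An n j *: f j)).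
  apply: (@tendsB R X E nat \oo (fun=> x) _ (fun n => (Dn n)%:C%C *: h)
    (fun n => \sum_j An n j *: f j)).
    by apply: tendsZ; [exact: cvg_real_complex|exact: cvg_cst].
  apply: tends_sum; first exact: cvg_cst.
  by move=> j; apply: tendsZ => //; exact: cvg_cst.
have rhs : b * Dn n @[n --> \oo] --> b * D by apply: cvgMr.
apply: (ler_cvg_to lhs rhs); apply: nearW => n.
have -> : (Dn n)%:C%C *: h - \sum_j An n j *: f j =
    \sum_(k < n) (w k / 2 ^+ k.+1)%:C%C *: (h - \sum_j y k j *: f j).
  under [RHS]eq_bigr do rewrite scalerBr.
  rewrite sumrB -scaler_suml -rmorph_sum; congr (_ - _).
  under [RHS]eq_bigr do rewrite scaler_sumr.
  rewrite exchange_big; apply: eq_bigr => j _ /=.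
  under [RHS]eq_bigr do rewrite scalerA.
  rewrite -scaler_suml; congr (_ *: _).
  rewrite /An !rmorph_sum mulr_sumr -big_split; apply: eq_bigr => k _ /=.
  rewrite [y k j in RHS]complexE mulrDr; congr (_ + _).
    by rewrite -rmorphM; congr (_%:C)%C; rewrite mulrAC.
  by rewrite mulrCA -rmorphM; congr (_ * _%:C)%C; rewrite mulrAC.
apply: le_trans (rnorm_sum _ _ _) _; rewrite mulr_sumr; apply: ler_sum => k _.
have w0 : 0 <= w k / 2 ^+ k.+1 by rewrite divr_ge0 ?exprn_ge0//; have /andP[] := wM k.
rewrite rnormZ cabs_real ger0_norm// [b * _]mulrC.
have := w0; rewrite le_eqVlt => /orP[/eqP <-|wk]; first by rewrite !mul0r.
rewrite ler_wpM2l//; apply: wb; move: wk; rewrite pmulr_lgt0//.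
Qed.

End DyadicMean.

Lemma cvg_max0 (R : realType) (T : Type) (F : set_system T) (FF : Filter F)
    (f : T -> R) (l : R) :
  f @ F --> l -> Num.max (f t) 0 @[t --> F] --> Num.max l 0.
Proof.
move=> fl; rewrite maxr_absE; under eq_fun do rewrite maxr_absE.
rewrite addr0 subr0; under eq_fun do rewrite addr0 subr0.
by apply: cvgMl; apply: cvgD => //; exact: cvg_norm.
Qed.

Section Conditioning.
Variables (R : realType) (X : topologicalType) (E : banach_bundle R X).
Local Notation fiber := (bfiber E).

Definition span_dist x d (f : 'I_d -> fiber x) (h : fiber x) : R :=
  inf (range (fun c : 'I_d -> R[i] => rnorm (h - \sum_j c j *: f j))).

Lemma span_dist_le x d (f : 'I_d -> fiber x) h c :
  span_dist f h <= rnorm (h - \sum_j c j *: f j).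
Proof.
by apply: ge_inf; [exists 0 => _ [b _ <-]; exact: rnorm_ge0|exists c].
Qed.

Lemma le_span_dist x d (f : 'I_d -> fiber x) h m :
  (forall c, m <= rnorm (h - \sum_j c j *: f j)) -> m <= span_dist f h.
Proof.
move=> hm; apply: lb_le_inf; first by exists (rnorm (h - \sum_j 0 *: f j)); exists (fun=> 0).
by move=> _ [c _ <-].
Qed.

Lemma span_dist_lt x d (f : 'I_d -> fiber x) h m : span_dist f h < m ->
  exists c, rnorm (h - \sum_j c j *: f j) < m.
Proof.
move=> /inf_lt[]; first by exists (rnorm (h - \sum_j 0 *: f j)); exists (fun=> 0).
by move=> _ [c _ <-] cm; exists c.
Qed.

Lemma extend_family_sub x d (f : 'I_d -> fiber x) h (c : 'I_d -> R[i]) :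
  h - \sum_j c j *: f j =
  \sum_i (if unlift ord_max i is Some j then - c j else 1) *: extend_family f h i.
Proof.
rewrite extend_family_sum unlift_none scale1r addrC; congr (_ + _).
by rewrite -sumrN; apply: eq_bigr => j _; rewrite liftK scaleNr.
Qed.

Lemma span_dist_gt0 x d (f : 'I_d -> fiber x) h :
  independent (extend_family f h) -> 0 < span_dist f h.
Proof.
move=> /independent_lower_bound[m m0 hm]; apply: lt_le_trans m0 _.
apply: le_span_dist => c; rewrite extend_family_sub.
apply: le_trans (hm _ ord_max); by rewrite unlift_none cabs_eq1 mulr1.
Qed.

Section Filtered.
Variables (T : Type) (F : set_system T) (q : T -> X) (x : X) (d : nat).
Context {FF : Filter F}.
Variables (f : 'I_d -> forall a, fiber (q a)) (h : forall a, fiber (q a)).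
Variables (fx : 'I_d -> fiber x) (hx : fiber x).
Hypotheses (qx : q @ F --> x) (ff : forall j, tends F (f j) (fx j)).
Hypotheses (fh : tends F h hx) (fi : independent (extend_family fx hx)).

(** Norms of combinations of nearby frames have ratio close to 1, uniformly in the
coefficients; the infima inherit this. *)
Lemma cvg_span_dist :
  span_dist (fun j => f j a) (h a) @[a --> F] --> span_dist fx hx.
Proof.
have m0 := span_dist_gt0 fi; set m := span_dist fx hx in m0 *.
have [l l0 hl] := independent_lower_bound fi.
pose g (i : 'I_d.+1) a : fiber (q a) := extend_family (fun j => f j a) (h a) i.
have gF i : tends F (g i) (extend_family fx hx i).
  rewrite /g /extend_family; case: unlift => [j|]; [exact: ff|exact: fh].
apply/real_cvgP => e e0; pose r := e / (2 * m).
have r0 : 0 < r by rewrite divr_gt0// mulr_gt0.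
apply: filterS (near_frame_relative (FF := FF) qx gF r0 l0 hl) => a ha.
have cmp c : `|rnorm (h a - \sum_j c j *: f j a) - rnorm (hx - \sum_j c j *: fx j)|
    <= r * rnorm (hx - \sum_j c j *: fx j).
  by rewrite !extend_family_sub; exact: ha.
have rm : r * m = e / 2 by rewrite /r invfM mulrA divfK// gt_eqF.
have up : span_dist (fun j => f j a) (h a) <= m + e / 2.
  rewrite -rm; apply/ler_addgt0Pr => t t0; pose t' := t / (1 + r).
  have t'0 : 0 < t' by rewrite divr_gt0// addr_gt0.
  have [c hc] : exists c, rnorm (hx - \sum_j c j *: fx j) < m + t'.
    by apply: span_dist_lt; rewrite ltrDl.
  apply: le_trans (span_dist_le _ _ c) _.
  have := cmp c; rewrite ler_norml => /andP[_].
  set N := rnorm (hx - _) in hc *; set N' := rnorm _ => hN.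
  have tE : t = t' + r * t' by rewrite -{1}[t']mul1r -mulrDl /t' mulrC divfK// gt_eqF// addr_gt0.
  have : r * N <= r * (m + t') by rewrite ler_wpM2l ?ltW.
  rewrite mulrDr; lra.
have lo : m - e / 2 <= span_dist (fun j => f j a) (h a).
  apply: le_span_dist => c; have := cmp c; rewrite ler_norml => /andP[+ _].
  have := span_dist_le fx hx c; rewrite -/m.
  set N := rnorm (hx - _); set N' := rnorm _ => mN hN.
  have [r1|r1] := leP r 1; last first.
    have : m < r * m by rewrite ltr_pMl.
    have : 0 <= N' by exact: rnorm_ge0.
    rewrite rm; lra.
  have : (1 - r) * m <= (1 - r) * N by rewrite ler_wpM2l// subr_ge0.
  rewrite !mulrBl !mul1r rm; lra.
rewrite ltr_norml; apply/andP; split; lra.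
Qed.

End Filtered.

(** A continuous choice of almost best approximations in a span: the weights
below are positive exactly at the points of a dense sequence of coefficients
that approximate within twice the distance. *)
Lemma near_best_approximation (V : set X) d (f : 'I_d -> forall x, fiber x)
    (h : forall x, fiber x) :
  (forall x j, V x -> continuous_within V (f j) x) ->
  (forall x, V x -> continuous_within V h x) ->
  (forall x, V x -> independent (extend_family (fun j => f j x) (h x))) ->
  exists l : 'I_d -> X -> R[i],
    (forall x j, V x -> l j @ within V (nbhs x) --> l j x) /\
    (forall x, V x -> rnorm (h x - \sum_j l j x *: f j x) <=
      2 * span_dist (fun j => f j x) (h x)).
Proof.
move=> fc hc fi; have [y yd] := dense_coefficients R d.
pose m x := span_dist (fun j => f j x) (h x).
pose N k x := rnorm (h x - \sum_j y k j *: f j x).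
pose Y k : R := 1 + \sum_j cabs (y k j).
have Y1 k : 1 <= Y k by rewrite lerDl sumr_ge0// => j _; exact: rnorm_ge0.
have Y0 k : 0 < Y k by exact: lt_le_trans (Y1 k).
(* Dividing by [Y k] bounds the products of weights and coefficients as well. *)
pose w k x := Num.max (2 * m x - N k x) 0 / Y k.
have m0 x : V x -> 0 < m x by move=> Vx; exact: span_dist_gt0 (fi x Vx).
have w0 k x : 0 <= w k x.
  by rewrite divr_ge0 ?(ltW (Y0 k))// le_max lexx orbT.
have wM k x : 0 <= m x -> w k x * Y k <= 2 * m x.
  move=> mx; rewrite divfK ?gt_eqF// ge_max mulr_ge0// andbT gerBl.
  exact: rnorm_ge0.
have bound k x M : 0 <= m x -> 2 * m x <= M ->
    0 <= w k x <= M /\ forall j, w k x * cabs (y k j) <= M.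
  move=> mx mM; have wY : w k x * Y k <= M by exact: le_trans (wM k x mx) mM.
  split; first by rewrite w0; apply: le_trans wY; rewrite ler_peMr.
  move=> j; apply: le_trans wY; rewrite ler_wpM2l// /Y (bigD1 j)//= addrCA lerDl.
  by rewrite addr_ge0// sumr_ge0// => i _; exact: rnorm_ge0.
have D0 x : V x -> 0 < dyadic_sum (w^~ x).
  move=> Vx; have mx := m0 x Vx.
  have [c hcx] : exists c, rnorm (h x - \sum_j c j *: f j x) < 2 * m x.
    by apply: span_dist_lt; rewrite -/(m x) ltr_pMl// ltr1n.
  pose S : R := 1 + \sum_j rnorm (f j x).
  have S0 : 0 < S by rewrite ltr_pwDl// sumr_ge0// => j _; exact: rnorm_ge0.
  set r := rnorm _ in hcx.
  have gap : 0 < (2 * m x - r) / S by rewrite divr_gt0// subr_gt0.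
  have [k hk] := yd c _ gap.
  have Nk : N k x < 2 * m x.
    have -> : N k x = rnorm ((h x - \sum_j c j *: f j x) -
        \sum_j (y k j - c j) *: f j x).
      under [X in _ - _ - X]eq_bigr do rewrite scalerBl.
      by rewrite sumrB opprB addrA subrK.
    apply: le_lt_trans (rnormD _ _) _; rewrite rnormN -/r -ltrBrDl.
    apply: le_lt_trans (rnorm_sum _ _ _) _.
    apply: (@le_lt_trans _ _ ((2 * m x - r) / S * \sum_j rnorm (f j x))).
      rewrite mulr_sumr; apply: ler_sum => j _.
      by rewrite rnormZ ler_wpM2r ?rnorm_ge0// ltW.
    by rewrite mulrAC ltr_pdivrMr// ltr_pM2l ?subr_gt0// /S ltrDr.
  apply: (@dyadic_sum_gt0 _ _ (2 * m x) k).
    by move=> i; have [] := bound i x _ (ltW mx) (lexx _).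
  by rewrite divr_gt0// lt_max subr_gt0 Nk.
exists (fun j x => dyadic_mean (w^~ x) (y^~ j)); split.
  move=> x j Vx; have mx := m0 x Vx; set F := within V (nbhs x).
  have FF : Filter F by exact: within_filter.
  have Fx : id @ F --> x by exact: cvg_within.
  have fF i : tends F (q := id) (f i) (f i x) by exact: fc.
  have hF : tends F (q := id) h (h x) by exact: hc.
  have mF : m @ F --> m x.
    exact: (@cvg_span_dist X F id x d FF f h (fun j => f j x) (h x) Fx fF hF (fi x Vx)).
  pose M := 2 * (m x + 1).
  apply: (@cvg_dyadic_mean R X F FF w (w^~ x) (y^~ j) M).
  - move=> k; apply: cvgMl.
    have NF : N k @ F --> N k x.
      apply: (@tends_norm R X E X F id FF (fun x => h x - \sum_j y k j *: f j x)).
      apply: (@tendsB R X E X F id FF h) => //.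
      by apply: (@tends_sum R X E X F id FF) => // i; apply: tendsZ => //; exact: cvg_cst.
    have dF : (fun x => 2 * m x - N k x) @ F --> 2 * m x - N k x.
      by apply: cvgB => //; apply: cvgMr.
    exact: cvg_max0.
  - have mM : \forall z \near F, m z < m x + 1 by apply: cvgr_lt mF _ _; rewrite ltrDl.
    have mp : \forall z \near F, V z.
      by rewrite /F; apply: (@filterS _ (nbhs x) _ setT); last exact: filterT.
    apply: filterS2 mM mp => z zM Vz k.
    have [] := bound k z M (ltW (m0 z Vz)) _; last by [].
    by rewrite /M ler_wpM2l// ltW.
  - move=> k; have [] := bound k x M (ltW mx) _; last by [].
    by rewrite /M ler_wpM2l// lerDl.
  - exact: D0.
move=> x Vx; have mx := m0 x Vx.
apply: (@dyadic_mean_dist R X E x d (h x) (fun j => f j x) (w^~ x) y (2 * m x)).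
- by move=> k; have [] := bound k x _ (ltW mx) (lexx _).
- by move=> k j; have [_] := bound k x _ (ltW mx) (lexx _).
- move=> k; rewrite /w pmulr_lgt0 ?invr_gt0// lt_max ltxx orbF subr_gt0.
  exact: ltW.
- exact: D0.
Qed.

End Conditioning.

Lemma extend_independent_inv (F : fieldType) (V : lmodType F) d (e : 'I_d -> V) v :
  independent (extend_family e v) -> independent e /\ ~ in_span e v.
Proof.
move=> ei; split=> [c c0 i|[c cv]].
  have := ei (fun k => if unlift ord_max k is Some j then c j else 0).
  rewrite extend_family_sum unlift_none scale0r addr0.
  under eq_bigr do rewrite liftK.
  by move=> /(_ c0 (lift ord_max i)); rewrite liftK.
have := ei (fun k => if unlift ord_max k is Some j then - c j else 1).
rewrite extend_family_sum unlift_none scale1r.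
under eq_bigr do rewrite liftK scaleNr.
rewrite sumrN -cv addNr => /(_ erefl ord_max); rewrite unlift_none.
by move/eqP; rewrite oner_eq0.
Qed.

Lemma extend_family_eta (F : fieldType) (V : lmodType F) d (e : 'I_d.+1 -> V) :
  extend_family (fun j => e (lift ord_max j)) (e ord_max) = e.
Proof. by apply/funext => i; rewrite /extend_family; case: unliftP => [j ->|->]. Qed.

Section BoundedFrames.
Variables (R : realType) (X : topologicalType) (E : banach_bundle R X).
Local Notation fiber := (bfiber E).

(** Gram-Schmidt without inner products: subtract from the last vector an almost
best approximation by the previous ones and normalize. The distance of the new
vector to the span of the previous ones is then at least 1/2, which bounds the
last coordinate of [v] by [2 * |v|]; the others are coordinates of a vector of
norm at most [3 * |v|], whence the constant [3 ^ d]. That the new vectors lie in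
the span of the old ones is what keeps the induction going. *)
Lemma bounded_frame (V : set X) d (e : 'I_d -> forall x, fiber x) :
  (forall x j, V x -> continuous_within V (e j) x) ->
  (forall x, V x -> independent (fun j => e j x)) ->
  exists e' : 'I_d -> forall x, fiber x,
  [/\ forall x j, V x -> continuous_within V (e' j) x,
      forall x j, V x -> in_span (fun i => e i x) (e' j x),
      forall x j, V x -> rnorm (e' j x) <= 1 &
      forall x (c : 'I_d -> R[i]) j, V x ->
        cabs (c j) <= 3 ^+ d * rnorm (\sum_i c i *: e' i x)].
Proof.
elim: d e => [e _ _|d ih e ec ei]; first by exists e; split=> [x []|x []|x []|x c []].
have ei' x : V x -> independent (fun j => e (lift ord_max j) x) /\
    ~ in_span (fun j => e (lift ord_max j) x) (e ord_max x).
  move=> Vx; apply: extend_independent_inv.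
  by rewrite (extend_family_eta (fun i => e i x)); exact: ei.
have [|x Vx|f [fc fs f1 fb]] := ih (fun j => e (lift ord_max j)).
- by move=> x j; exact: ec.
- exact: (ei' x Vx).1.
have e3 k : 0 < (3 : R) ^+ k by rewrite exprn_gt0.
have fi x : V x -> independent (extend_family (fun j => f j x) (e ord_max x)).
  move=> Vx; apply: extend_independent.
    apply: (@lower_bound_independent _ _ _ _ _ _ (3 ^+ d)^-1).
      by rewrite invr_gt0.
    by move=> c j; rewrite mulrC ler_pdivrMr// mulrC fb.
  by move=> /(in_span_trans (fun j => fs x j Vx)); exact: (ei' x Vx).2.
have [l [lc ld]] := near_best_approximation fc (fun x => ec x ord_max) fi.
pose r x := e ord_max x - \sum_j l j x *: f j x.
have d0 x : V x -> 0 < span_dist (fun j => f j x) (e ord_max x).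
  by move=> /fi; exact: span_dist_gt0.
have r0 x : V x -> 0 < rnorm (r x).
  by move=> Vx; apply: lt_le_trans (d0 x Vx) _; exact: span_dist_le.
pose g x : fiber x := ((rnorm (r x))^-1%:C)%C *: r x.
have gc x : V x -> continuous_within V g x.
  move=> Vx; have rc : continuous_within V r x.
    apply: (@tendsB R X E X (within V (nbhs x)) id _ (e ord_max)); first exact: ec.
    apply: (@tends_sum R X E X (within V (nbhs x)) id); first exact: cvg_within.
    move=> j; apply: (@tendsZ R X E X (within V (nbhs x)) id); last exact: fc.
    exact: lc.
  apply: continuous_within_scale (rc); apply: cvgV.
    by rewrite gt_eqF ?r0.
  exact: (@tends_norm R X E X (within V (nbhs x)) id _ r x _ rc).
pose e' i x := extend_family (fun j => f j x) (g x) i.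
exists e'; split.
- move=> x i Vx; rewrite /e' /extend_family; case: unlift => [j|]; last exact: gc.
  exact: fc.
- have lift_span x v : in_span (fun j => e (lift ord_max j) x) v ->
      in_span (fun i => e i x) v.
    apply: in_span_trans => j.
    exact: (in_span_mem (fun i => e i x) (lift ord_max j)).
  move=> x i Vx; rewrite /e' /extend_family; case: unlift => [j|].
    by apply: lift_span; exact: fs.
  have /choice[a fa] j := lift_span x _ (fs x j Vx).
  pose b i := (if i == ord_max then 1 else 0) - \sum_j l j x * a j i.
  exists (fun i => ((rnorm (r x))^-1%:C)%C * b i).
  under eq_bigr do rewrite -scalerA.
  rewrite -scaler_sumr; congr (_ *: _); rewrite /r /b.
  under [RHS]eq_bigr do rewrite scalerBl.
  rewrite sumrB; congr (_ - _).
    by rewrite (bigD1 ord_max)//= eqxx scale1r big1 ?addr0// => k /negbTE ->; rewrite scale0r.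
  under [LHS]eq_bigr do rewrite fa scaler_sumr.
  rewrite exchange_big; apply: eq_bigr => k _ /=.
  by rewrite scaler_suml; apply: eq_bigr => j _; rewrite scalerA.
- move=> x i Vx; rewrite /e' /extend_family; case: unlift => [j|]; first exact: f1.
  by rewrite /g rnormZ cabs_real ger0_norm ?invr_ge0 ?rnorm_ge0// mulVf// gt_eqF// r0.
- move=> x c i Vx; rewrite /e' extend_family_sum.
  set a := \sum_j _; set v := a + _.
  have cmax : cabs (c ord_max) <= 2 * rnorm v.
    have [c0|c0] := eqVneq (c ord_max) 0; first by rewrite c0 rnorm0 mulr_ge0// rnorm_ge0.
    have rx0 : ((rnorm (r x))%:C%C : R[i]) != 0 by rewrite fmorph_eq0 gt_eqF// r0.
    pose t : R[i] := c ord_max / (rnorm (r x))%:C%C.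
    have t0 : t != 0 by rewrite mulf_neq0// invr_eq0.
    have -> : v = t *: (e ord_max x -
        \sum_j (l j x - t^-1 * c (lift ord_max j)) *: f j x).
      under eq_bigr do rewrite scalerBl -scalerA.
      rewrite sumrB -scaler_sumr -/a opprB addrCA scalerDr scalerA mulfV// scale1r.
      by rewrite /v /g scalerA fmorphV.
    rewrite rnormZ /t cabsM cabsV cabs_real gtr0_norm ?r0//.
    set p := cabs (c ord_max); set y := rnorm (r x).
    set z := rnorm (e ord_max x - _).
    have -> : 2 * (p / y * z) = p * (2 * z / y) by ring.
    rewrite ler_peMr ?rnorm_ge0// ler_pdivlMr ?r0// mul1r.
    apply: le_trans (ld x Vx) _; rewrite ler_pM2l//; exact: span_dist_le.
  have gx : rnorm (g x) = 1.
    by rewrite /g rnormZ cabs_real ger0_norm ?invr_ge0 ?rnorm_ge0// mulVf// gt_eqF// r0.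
  have av : rnorm a <= 3 * rnorm v.
    have -> : a = v - c ord_max *: g x by rewrite /v addrK.
    rewrite (le_trans (rnormD _ _))// rnormN rnormZ gx mulr1.
    by move: cmax; set p := cabs _; set p' := rnorm _; lra.
  have v0 : 0 <= rnorm v by exact: rnorm_ge0.
  case: (unliftP ord_max i) => [j ->|->].
    apply: le_trans (fb x (fun j => c (lift ord_max j)) j Vx) _.
    by rewrite exprSr -mulrA ler_pM2l.
  apply: le_trans cmax _; rewrite ler_wpM2r// exprS.
  have : 1 <= (3 : R) ^+ d by rewrite exprn_ege1// ler1n.
  lra.
Qed.

End BoundedFrames.

(** * Summable sequences *)

Section Summability.
Variable R : realType.
Implicit Types (a : nat -> R) (p : R).

(** For nonnegative [a], membership in l^p, freed from extended real numbers. *)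
Definition p_summable p a := exists B, forall n, \sum_(k < n) a k `^ p <= B.

Lemma in_ellP (T : Type) (N : T -> R) p (v : nat -> T) : p != 0 ->
  in_ell N p v <-> p_summable p (fun n => N (v n)).
Proof.
move=> p0; have pi0 : p^-1 != 0 by rewrite invr_eq0.
have u0 i : (0%R <= ((N (v i)) `^ p)%:E)%E by rewrite lee_fin powR_ge0.
have sumE n : (\sum_(0 <= i < n) ((N (v i)) `^ p)%:E)%E =
    (\sum_(k < n) (N (v k)) `^ p)%:E by rewrite sumEFin big_mkord.
rewrite /in_ell /seq_norm; split=> [/(lty_poweRy pi0) sy|[B hB]].
  pose S := (\sum_(0 <= n <oo) ((N (v n)) `^ p)%:E)%E.
  have S0 : (0 <= S)%E by apply: nneseries_ge0 => n _ _.
  have Sf : S \is a fin_num by rewrite ge0_fin_numE.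
  exists (fine S) => n; rewrite -lee_fin fineK// -sumE.
  by apply: nneseries_lim_ge => k _ _.
apply: poweR_lty; apply: (@le_lt_trans _ _ B%:E); last exact: ltry.
apply: lime_le; first by apply: is_cvg_nneseries => n _ _.
by apply: nearW => n; rewrite sumE lee_fin.
Qed.

Lemma p_summable_le p a b : 0 <= p -> (forall n, 0 <= a n <= b n) ->
  p_summable p b -> p_summable p a.
Proof.
move=> p0 ab [B hB]; exists B => n; apply: le_trans (hB n); apply: ler_sum => k _.
have /andP[a0 abk] := ab k.
by apply: ge0_ler_powR => //; rewrite nnegrE// (le_trans a0).
Qed.

Lemma p_summableZ p a (c : R) : 0 <= c -> (forall n, 0 <= a n) ->
  p_summable p a -> p_summable p (fun n => c * a n).
Proof.
move=> c0 a0 [B hB]; exists (c `^ p * B) => n.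
under eq_bigr do rewrite powRM//.
by rewrite -mulr_sumr ler_wpM2l// powR_ge0.
Qed.

Lemma sum_half_le n : \sum_(k < n) (2 ^- k.+1 : R) <= 1.
Proof.
suff -> : \sum_(k < n) (2 ^- k.+1 : R) = 1 - 2 ^- n by rewrite gerBl invr_ge0 exprn_ge0.
elim: n => [|n ih]; first by rewrite big_ord0 expr0 invr1 subrr.
have h : 2 ^- n.+1 = 2 ^- n / 2 :> R by rewrite exprSr invfM.
by rewrite big_ord_recr /= ih h; lra.
Qed.

(** A convergent series of positive terms still converges after multiplication
by suitable weights tending to infinity: the inverse square roots of its
tails. *)
Lemma summable_weights (al : nat -> R) (B : R) : (forall n, 0 < al n) ->
  (forall n, \sum_(k < n) al k <= B) ->
  exists (ka : nat -> R) (B' : R), [/\ forall n, 0 < ka n,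
    (ka n)^-1 @[n --> \oo] --> (0 : R) & forall n, \sum_(k < n) al k * ka k <= B'].
Proof.
move=> al0 alB; pose s n := \sum_(k < n) al k.
have sS n : s n.+1 = s n + al n by rewrite /s big_ord_recr.
have s_nd : nondecreasing_seq s.
  by apply/nondecreasing_seqP => n; rewrite sS lerDl ltW.
have sc : cvgn s.
  by apply: nondecreasing_is_cvgn => //; exists B => _ [n _ <-]; exact: alB.
pose S := limn s; pose r n := S - s n.
have rS n : r n.+1 = r n - al n by rewrite /r sS opprD addrA.
have r0 n : 0 < r n.
  rewrite subr_gt0; apply: lt_le_trans (_ : s n.+1 <= S); last exact: nondecreasing_cvgn_le.
  by rewrite sS ltrDl.
have rlim : r n @[n --> \oo] --> (0 : R).
  by rewrite -(subrr S); apply: cvgB; [exact: cvg_cst|exact: sc].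
have q0 n : 0 < Num.sqrt (r n) by rewrite sqrtr_gt0.
exists (fun n => (Num.sqrt (r n))^-1), (2 * Num.sqrt (r 0%N)); split.
- by move=> n; rewrite invr_gt0.
- under eq_fun do rewrite invrK.
  have sqrt0 := @sqrt_continuous R 0; rewrite /continuous_at sqrtr0 in sqrt0.
  exact: (cvg_comp _ _ rlim sqrt0).
- move=> n; apply: (@le_trans _ _ (2 * Num.sqrt (r 0%N) - 2 * Num.sqrt (r n))); last first.
    by rewrite gerBl mulr_ge0// ltW.
  elim: n => [|n ih]; first by rewrite big_ord0 subrr.
  rewrite big_ord_recr /=.
  suff : al n / Num.sqrt (r n) <= 2 * Num.sqrt (r n) - 2 * Num.sqrt (r n.+1).
    by move: ih; set x := \sum_(_ < _) _; lra.
  rewrite ler_pdivrMr//.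
  have -> : al n = Num.sqrt (r n) ^+ 2 - Num.sqrt (r n.+1) ^+ 2.
    by rewrite !sqr_sqrtr ?ltW// rS opprB addrCA subrr addr0.
  set x := Num.sqrt (r n); set y := Num.sqrt (r n.+1).
  by rewrite -subr_ge0 (_ : _ - _ = (x - y) ^+ 2) ?sqr_ge0//; ring.
Qed.

(** Room is made in the sequence: [A] is still in l^p but dominates [a] by a factor
that tends to infinity. *)
Lemma p_summable_weights p a : 1 <= p -> (forall n, 0 <= a n) -> p_summable p a ->
  exists (A eps : nat -> R), [/\ p_summable p A, forall n, 0 < A n,
    eps n @[n --> \oo] --> (0 : R) & forall n, a n <= A n * eps n].
Proof.
move=> p1 a0 [B hB]; have p0 : 0 < p by exact: lt_le_trans p1.
have pi0 : 0 < p^-1 by rewrite invr_gt0.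
(* The second summand makes all the terms positive, for the weights to exist. *)
pose al n := a n `^ p + 2 ^- n.+1.
have al0 n : 0 < al n by rewrite ltr_wpDl ?powR_ge0// invr_gt0 exprn_gt0.
have alB n : \sum_(k < n) al k <= B + 1.
  by rewrite big_split lerD//; exact: sum_half_le.
have [ka [B' [ka0 kalim kaB]]] := summable_weights al0 alB.
have powK (x : R) : 0 <= x -> (x `^ p^-1) `^ p = x.
  by move=> x0; rewrite -powRrM mulVf ?gt_eqF// powRr1.
have powK' (x : R) : 0 <= x -> (x `^ p) `^ p^-1 = x.
  by move=> x0; rewrite -powRrM mulfV ?gt_eqF// powRr1.
exists (fun n => (al n * ka n) `^ p^-1), (fun n => (ka n)^-1 `^ p^-1); split.
- exists B' => n; apply: le_trans (kaB n); apply: ler_sum => k _.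
  by rewrite powK// mulr_ge0// ltW.
- by move=> n; rewrite powR_gt0// mulr_gt0.
- apply/real_cvgP => e e0.
  have ep : 0 < e `^ p by exact: powR_gt0.
  have /real_cvgP/(_ _ ep) := kalim; apply: filterS => n.
  rewrite !subr0 !ger0_norm ?invr_ge0 ?powR_ge0 ?(ltW (ka0 n))// => h.
  rewrite -[e]powK' ?ltW//; apply: gt0_ltr_powR => //.
    by rewrite nnegrE invr_ge0 ltW.
  by rewrite nnegrE ltW.
- move=> n; rewrite -powRM ?invr_ge0 ?mulr_ge0 ?(ltW (al0 n)) ?(ltW (ka0 n))//.
  rewrite mulfK ?gt_eqF// -{1}[a n]powK'//.
  apply: ge0_ler_powR; rewrite ?nnegrE ?powR_ge0//; [exact: ltW|exact: ltW|].
  by rewrite /al lerDl invr_ge0 exprn_ge0.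
Qed.

Lemma geometric_p_summable p : 1 <= p -> p_summable p (fun n => 2 ^- n.+1).
Proof.
move=> p1; exists 1 => n; apply: le_trans (sum_half_le n); apply: ler_sum => k _.
apply: ge1r_powR => //; rewrite invr_gt0 exprn_gt0//= invf_le1 ?exprn_gt0//.
by rewrite exprn_ege1// ler1n.
Qed.

(** All but finitely many of the functions stay below [e / 2] everywhere. *)
Lemma continuous_sup (X : topologicalType) (u : nat -> X -> R) (eps : nat -> R) :
  (forall n, continuous (u n)) -> (forall n x, 0 <= u n x <= eps n) ->
  eps n @[n --> \oo] --> (0 : R) ->
  (forall n x, u n x <= sup (range (u^~ x))) /\
  continuous (fun x => sup (range (u^~ x))).
Proof.
move=> uc ue e0.
have [M hM] : exists M, forall n, eps n <= M.
  have /cvg_seq_bounded[M [_ hM]] : cvgn eps by apply/cvg_ex; exists 0.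
  exists (M + 1) => n; apply: le_trans (ler_norm _) _.
  by apply: (hM (M + 1)); rewrite ?ltrDl//.
have ub x : has_ubound (range (u^~ x)).
  by exists M => _ [n _ <-]; have /andP[_ /le_trans->] := ue n x.
have le_sup n x : u n x <= sup (range (u^~ x)).
  by apply: ub_le_sup; [exact: ub|exists n].
split=> // x; apply/real_cvgP => e he; have e20 : 0 < e / 2 by rewrite divr_gt0.
have [N _ hN] := (real_cvgP _ _ _).1 e0 _ e20.
have fin : \forall y \near x, forall n, n \in iota 0 N -> `|u n y - u n x| < e / 2.
  apply: (@near_forall_seq _ _ (nbhs x) _ _ (fun n y => is_true (`|u n y - u n x| < e / 2))).
  by move=> n _; have /real_cvgP/(_ _ e20) := uc n x.
apply: filterS fin => y fin.
have close n : `|u n y - u n x| <= e / 2.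
  have [nN|Nn] := ltnP n N; first by apply/ltW/fin; rewrite mem_iota.
  have := hN n Nn; rewrite subr0 => /(le_lt_trans (ler_norm _)) en.
  have /andP[? ?] := ue n x; have /andP[? ?] := ue n y.
  by rewrite ler_norml; apply/andP; split; lra.
have one_side z t : (forall n, u n z <= u n t + e / 2) ->
    sup (range (u^~ z)) <= sup (range (u^~ t)) + e / 2.
  move=> zt; apply: ge_sup; first by exists (u 0%N z); exists 0%N.
  by move=> _ [n _ <-]; apply: le_trans (zt n) _; rewrite lerD2r.
have h1 : sup (range (u^~ y)) <= sup (range (u^~ x)) + e / 2.
  by apply: one_side => n; have := close n; rewrite ler_norml => /andP[]; lra.
have h2 : sup (range (u^~ x)) <= sup (range (u^~ y)) + e / 2.
  by apply: one_side => n; have := close n; rewrite ler_norml => /andP[]; lra.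
rewrite ltr_norml; apply/andP; split; lra.
Qed.

End Summability.

(** * Decomposition along one stratum *)

Section ScalarExtension.
Variables (R : realType) (X : topologicalType).
Hypothesis X_compact : compact [set: X].
Hypothesis X_hausdorff : hausdorff_space X.

(** Tietze's theorem on real and imaginary parts, which costs a factor 2. *)
Lemma complex_extension (C : set X) (f : X -> R[i]) (b : R) : closed C -> 0 < b ->
  (forall x, C x -> f @ within C (nbhs x) --> f x) ->
  (forall x, C x -> cabs (f x) <= b) ->
  exists g : CX R X, (forall x, C x -> g x = f x) /\
    (forall x, cabs (g x) <= 2 * b).
Proof.
move=> cC b0 fc fb.
have part (p : R[i] -> R) : (forall c, `|p c| <= cabs c) ->
    (forall c c', p (c - c') = p c - p c') ->
    exists g : X -> R, [/\ forall x, C x -> g x = p (f x), continuous g &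
      forall x, `|g x| <= b].
  move=> p1 pB; have nX := compact_normal X_hausdorff X_compact.
  have [||g [gf gc gb]] := @continuous_bounded_extension X R nX C cC
      (fun x => p (f x)) b b0.
  - apply/subspace_continuousP => x Cx; apply/real_cvgP => e e0.
    have /complex_cvgP/(_ e e0) := fc x Cx; apply: (@filterS _ (within C (nbhs x))).
    by move=> y; apply: le_lt_trans; rewrite -pB.
  - by move=> x Cx; apply: le_trans (fb x Cx).
  exists g; split=> // x Cx; rewrite gf//; exact: mem_set.
have [u [uf uc ub]] := part (@complex.Re R) (@cabs_Re R) (fun c c' => raddfB _ c c').
have [v [vf vc vb]] := part (@complex.Im R) (@cabs_Im R) (fun c c' => raddfB _ c c').
have gc : continuous (fun x => ((u x)%:C + 'i * (v x)%:C)%C : R[i]).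
  by move=> x; apply: cvg_complex_parts; [exact: uc|exact: vc].
pose g : CX R X := mkcts gc.
have gE x : g x = ((u x)%:C + 'i * (v x)%:C)%C by [].
exists g; split=> x; rewrite gE; first by move=> Cx; rewrite uf// vf// -complexE.
rewrite (le_trans (rnormD (V := R[i]^o) _ _))// cabsM.
have -> : cabs ('i%C : R[i]) = 1.
  by apply/eqP; rewrite -(eqrXn2 (n := 2)) ?rnorm_ge0// cabs_sqr /= expr0n add0r.
rewrite mul1r !cabs_real; have := ub x; have := vb x; lra.
Qed.

End ScalarExtension.

Section Decomposition.
Variables (R : realType) (X : topologicalType) (E : banach_bundle R X).
Hypothesis X_compact : compact [set: X].
Hypothesis X_hausdorff : hausdorff_space X.
Local Notation fiber := (bfiber E).

Lemma continuous_within_sub (V C : set X) (s : forall x, fiber x) x :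
  V `<=` C -> continuous_within C s x -> continuous_within V s x.
Proof.
by move=> VC sc W /sc; apply: (@filterS _ (nbhs x)) => y h /VC; exact: h.
Qed.

Lemma continuous_within_open (V C U : set X) (s : forall x, fiber x) x :
  open U -> U x -> (forall y, C y -> U y -> V y) ->
  continuous_within V s x -> continuous_within C s x.
Proof.
move=> oU Ux CUV sc W /sc h.
have Un : \forall y \near x, U y by exact: open_nbhs_nbhs.
by apply: (@filterS2 _ (nbhs x)) h Un => y h Uy Cy; apply: h; exact: CUV.
Qed.

Section Weights.
Variables (v : nat -> section E) (A eps : nat -> R).
Hypotheses (A0 : forall n, 0 < A n) (eps0 : eps n @[n --> \oo] --> (0 : R)).
Hypothesis v_le : forall n x, rnorm (section_val (v n) x) <= A n * eps n.

(** The profile is the square root of the supremum of the norms divided by [A n],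
a continuous function because these quotients tend to zero uniformly. The square
root leaves one factor for the generators and one for the coefficients. *)
Lemma exists_profile : exists th : X -> R,
  [/\ continuous th, forall x, 0 <= th x,
      forall n x, rnorm (section_val (v n) x) <= A n * th x ^+ 2 &
      forall x, 0 < th x -> exists n, section_val (v n) x != 0].
Proof.
pose u n x := rnorm (section_val (v n) x) / A n.
have u0 n x : 0 <= u n x by rewrite divr_ge0 ?rnorm_ge0 ?ltW.
have ue n x : 0 <= u n x <= eps n.
  by rewrite u0 /u ler_pdivrMr// mulrC v_le.
have uc n : continuous (u n).
  by move=> x; apply: cvgMl; exact: section_rnorm_continuous.
have [us sc] := continuous_sup uc ue eps0.
pose S x := sup (range (u^~ x)).
have S0 x : 0 <= S x by exact: le_trans (u0 0%N x) (us 0%N x).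
exists (fun x => Num.sqrt (S x)); split.
- move=> x; apply: (cvg_comp S _ (sc x)); exact: sqrt_continuous.
- by move=> x; exact: sqrtr_ge0.
- move=> n x; rewrite sqr_sqrtr// mulrC -ler_pdivrMr//; exact: us.
- move=> x; rewrite sqrtr_gt0 => Sx; apply: contrapT => nv.
  move: Sx; rewrite ltNge => /negP; apply; apply: ge_sup.
    by exists (u 0%N x); exists 0%N.
  move=> _ [n _ <-]; rewrite /u (_ : section_val (v n) x = 0) ?rnorm0 ?mul0r//.
  by apply/eqP; apply: contrapT => /negP vn; apply: nv; exists n.
Qed.

End Weights.

Definition p_dominated p (v : nat -> section E) := exists a : nat -> R,
  [/\ p_summable p a, forall n, 0 <= a n &
      forall n x, rnorm (section_val (v n) x) <= a n].

Definition scalar_p_dominated p (f : nat -> CX R X) := exists a : nat -> R,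
  [/\ p_summable p a, forall n, 0 <= a n & forall n x, cabs (f n x) <= a n].

End Decomposition.

Lemma sum_enum_val (V : nmodType) (T : finType) (F : T -> V) :
  \sum_(q < #|{: T}|) F (enum_val q) = \sum_t F t.
Proof.
rewrite [RHS](reindex (@enum_val T T))/=; first exact: eq_bigr.
by apply: onW_bij; exact: enum_val_bij.
Qed.

Section StratumDecomposition.
Variables (R : realType) (X : topologicalType) (E : banach_bundle R X).
Hypothesis X_compact : compact [set: X].
Hypothesis X_hausdorff : hausdorff_space X.
Local Notation fiber := (bfiber E).

(** The pieces are relatively open in the closed set of points of fibre
dimension at most [d], so continuity of the improved frames on a piece is
continuity relatively to that closed set. *)
Lemma stratum_bounded_frames d :
  (forall k, Fsigma (above E k)) -> finitely_trivialized E d ->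
  exists m (g : 'I_m -> X -> R) (e : 'I_m -> 'I_d -> forall x, fiber x),
  [/\ forall i, continuous (g i), forall i x, 0 <= g i x,
      forall i x, ~ above E d x -> 0 < g i x ->
        [/\ stratum E d x, is_basis (fun j => e i j x),
            forall j, continuous_within (~` above E d) (e i j) x,
            forall j, rnorm (e i j x) <= 1 &
            forall (c : 'I_d -> R[i]) j,
              cabs (c j) <= 3 ^+ d * rnorm (\sum_k c k *: e i k x)] &
      forall x, stratum E d x -> exists i, 0 < g i x].
Proof.
move=> FX ft; have [m [g [e [gc g0 ge gs]]]] := stratum_frames X_compact X_hausdorff FX ft.
pose C := ~` above E d; pose V i := C `&` [set x | 0 < g i x].
have oV i : open [set x | 0 < g i x] by exact: open_gt_continuous.
have /choice[e' he'] i := @bounded_frame R X E (V i) d (e i)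
  (fun x j Vx => let: And3 _ _ ec := ge i x Vx.1 Vx.2 in
     continuous_within_sub (@subIsetl _ C [set x | 0 < g i x]) (ec j))
  (fun x Vx => let: And3 _ eb _ := ge i x Vx.1 Vx.2 in eb.1).
exists m, g, e'; split=> // i x Cx gx; have Vx : V i x by split.
have [dx _ _] := ge i x Cx gx; have [ec _ e1 eb] := he' i.
have ei : independent (fun j => e' i j x).
  apply: (@lower_bound_independent _ _ _ _ _ _ (3 ^+ d)^-1).
    by rewrite invr_gt0 exprn_gt0.
  by move=> c j; rewrite mulrC ler_pdivrMr ?exprn_gt0// mulrC eb.
split=> //.
- by split=> //; exact: dim_eq_span dx ei.
- by move=> j; apply: (continuous_within_open (oV i) gx) (ec x j Vx).
- by move=> j; exact: e1.
- by move=> c j; exact: eb.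
Qed.

(** With the profile [th], functions [psi] of square sum 1 on the stratum and the bounded frames
[e], the generators are [th * psi * e] and the coefficients [psi / th] times the
coordinates of [v n]. Their norms are at most [th * psi], up to constants, and
[th * psi] tends to zero at every point of the closed set where [th] or [psi] is
zero: if [th] is not zero there, some term of the sequence is not, so the point
is in the stratum, where [psi] is continuous. On the
stratum the products of generators and coefficients add up to [v n], since [psi]
has square sum 1. *)
Lemma stratum_decomposition d p :
  (forall k, Fsigma (above E k)) -> finitely_trivialized E d -> 1 <= p ->
  exists K : nat, forall v : nat -> section E, p_dominated p v ->
    (forall n x, ~ at_least E d x -> section_val (v n) x = 0) ->
    exists (f : nat -> 'I_K -> CX R X) (w : 'I_K -> section E),
    [/\ forall i, scalar_p_dominated p (fun n => f n i),
        p_dominated p (fun n => v n - \sum_i f n i *: w i) &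
        forall n x, ~ at_least E d.+1 x ->
          section_val (v n - \sum_i f n i *: w i) x = 0].
Proof.
move=> FX ft p1; have [m [g [e [gc g0 ge gs]]]] := stratum_bounded_frames FX ft.
pose C := ~` above E d; pose I := ('I_m * 'I_d)%type.
have cC : closed C by exact: not_above_closed.
exists #|{: I}| => v [a [a_sum a0 va]] v0.
have [A [eps [A_sum A0 eps0 aA]]] := p_summable_weights p1 a0 a_sum.
have v_le n x : rnorm (section_val (v n) x) <= A n * eps n by exact: le_trans (aA n).
have [th [thc th0 v_th th_v]] := exists_profile A0 eps0 v_le.
have [M M0 thM'] := continuous_bounded X_compact thc.
have thM x : th x <= M by apply: le_trans (thM' x); exact: ler_norm.
pose G x := \sum_i g i x; pose psi i x := Num.sqrt (g i x / G x).
have gG i x : g i x <= G x.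
  by rewrite /G (bigD1 i)//= lerDl sumr_ge0.
have G0 x : 0 <= G x by rewrite sumr_ge0.
have psi0 i x : 0 <= psi i x by exact: sqrtr_ge0.
have psi1 i x : psi i x <= 1.
  rewrite /psi -sqrtr1 ler_wsqrtr//.
  have [->|Gx] := eqVneq (G x) 0; first by rewrite invr0 mulr0 ler01.
  by rewrite ler_pdivrMr ?mul1r// lt_def Gx G0.
have psi_g0 i x : g i x = 0 -> psi i x = 0 by move=> gx; rewrite /psi gx mul0r sqrtr0.
have g_cases i x : g i x = 0 \/ 0 < g i x.
  by have := g0 i x; rewrite le_eqVlt => /orP[/eqP|]; [left|right].
have [k hk] : exists k : 'I_m -> forall x, fiber x -> 'I_d -> R[i],
    forall i x, C x -> 0 < g i x -> forall u, u = \sum_j k i x u j *: e i j x.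
  have hi i : exists k : forall x, fiber x -> 'I_d -> R[i],
      forall x, C x -> 0 < g i x -> forall u, u = \sum_j k x u j *: e i j x.
    apply: (dependent_fun_choice (P := fun x (k : fiber x -> 'I_d -> R[i]) =>
      C x -> 0 < g i x -> forall u, u = \sum_j k u j *: e i j x)) => x.
    have [[Cx gx]|nV] := pselect (C x /\ 0 < g i x); last first.
      by exists (fun _ _ => 0) => Cx gx; case: nV.
    by have [_ [_ /choice[k hk]] _ _ _] := ge i x Cx gx; exists k.
  by have /choice[k hk] := hi; exists k.
have k_le i x u j : C x -> 0 < g i x -> cabs (k i x u j) <= 3 ^+ d * rnorm u.
  by move=> Cx gx; rewrite {2}(hk i x Cx gx u); have [_ _ _ _] := ge i x Cx gx; apply.
have th_stratum x : C x -> 0 < th x -> stratum E d x.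
  move=> Cx /th_v[n vn]; rewrite stratumE; split=> //.
  by apply: contrapT => /(v0 n) vx; rewrite vx eqxx in vn.
have G_pos x : C x -> 0 < th x -> 0 < G x.
  by move=> Cx /(th_stratum x Cx)/gs[i gi]; exact: lt_le_trans gi (gG i x).
have psi_c i x : 0 < G x -> psi i @ x --> psi i x.
  move=> Gx; have q : (fun y => g i y / G y) @ x --> g i x / G x.
    apply: cvgM; first exact: gc.
    apply: cvgV; first by rewrite gt_eqF.
    by apply: cvg_real_sum => l _; exact: gc.
  exact: (cvg_comp _ _ q (@sqrt_continuous R _)).
have th_cases x : th x = 0 \/ 0 < th x.
  by have := th0 x; rewrite le_eqVlt => /orP[/eqP|]; [left|right].
have small i x : C x -> g i x = 0 \/ th x = 0 ->
    (fun y => th y * psi i y) @ within C (nbhs x) --> (0 : R).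
  move=> Cx gth; apply: cvg_restrict; have [thx|thx] := th_cases x.
    apply/real_cvgP => h h0; have /real_cvgP/(_ h h0) := thc x.
    apply: filterS => y; rewrite thx !subr0; apply: le_lt_trans.
    by rewrite normrM ler_piMr// ger0_norm.
  have gx : g i x = 0 by case: gth => // thx'; rewrite thx' ltxx in thx.
  rewrite -(mulr0 (th x)) -(psi_g0 i x gx); apply: cvgM; first exact: thc.
  by apply: psi_c; exact: G_pos.
pose w0 (ij : I) x : fiber x := ((th x * psi ij.1 x)%:C)%C *: e ij.1 ij.2 x.
have w0_le ij x : C x -> rnorm (w0 ij x) <= th x * psi ij.1 x.
  move=> Cx; rewrite /w0 rnormZ cabs_real ger0_norm ?mulr_ge0//.
  have [gx|gx] := g_cases ij.1 x; first by rewrite psi_g0// mulr0 mul0r.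
  by rewrite ler_piMr ?mulr_ge0//; have [_ _ _ + _] := ge ij.1 x Cx gx; apply.
have w0_c ij x : C x -> continuous_within C (w0 ij) x.
  move=> Cx; have [gth|gth] := pselect (g ij.1 x = 0 \/ th x = 0).
    apply: (continuous_within_small _ (w0_le ij)); last exact: small.
    rewrite /w0; case: gth => [/psi_g0 ->|->]; first by rewrite mulr0 scale0r.
    by rewrite mul0r scale0r.
  have gx : 0 < g ij.1 x by case: (g_cases ij.1 x) => // gx; case: gth; left.
  have thx : 0 < th x by case: (th_cases x) => // thx; case: gth; right.
  apply: continuous_within_scale; last by have [_ _ + _ _] := ge ij.1 x Cx gx; apply.
  apply: cvg_restrict; apply: cvgM; first exact: thc.
  by apply: psi_c; exact: G_pos.
pose f0 n (ij : I) x : R[i] :=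
  ((psi ij.1 x / th x)%:C)%C * k ij.1 x (section_val (v n) x) ij.2.
pose B : R := 3 ^+ d; have B0 : 0 < B by rewrite exprn_gt0.
have f0_le n ij x : C x -> cabs (f0 n ij x) <= B * A n * (th x * psi ij.1 x).
  move=> Cx; rewrite /f0 cabsM cabs_real ger0_norm ?divr_ge0//.
  have rhs0 : 0 <= B * A n * (th x * psi ij.1 x).
    by rewrite !mulr_ge0// ltW.
  have [gx|gx] := g_cases ij.1 x; first by rewrite {1}(psi_g0 _ _ gx) !mul0r.
  have [thx|thx] := th_cases x.
    by rewrite [X in psi _ _ / X]thx invr0 mulr0 mul0r.
  apply: (@le_trans _ _ (psi ij.1 x / th x * (B * (A n * th x ^+ 2)))).
    rewrite ler_wpM2l ?divr_ge0//; apply: le_trans (k_le _ _ _ _ Cx gx) _.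
    by rewrite ler_pM2l.
  rewrite le_eqVlt; apply/orP; left; apply/eqP; field.
  by rewrite gt_eqF.
have f0_c n ij x : C x -> f0 n ij @ within C (nbhs x) --> f0 n ij x.
  move=> Cx; have [gth|gth] := pselect (g ij.1 x = 0 \/ th x = 0).
    have -> : f0 n ij x = 0.
      rewrite /f0; case: gth => [/psi_g0 ->|->]; first by rewrite mul0r mul0r.
      by rewrite invr0 mulr0 mul0r.
    apply/complex_cvgP => h h0.
    have sm : (fun y => B * A n * (th y * psi ij.1 y)) @ within C (nbhs x) --> (0 : R).
      by rewrite -(mulr0 (B * A n)); apply: cvgMr; exact: small.
    have /real_cvgP/(_ h h0) := sm; apply: (@filterS _ (nbhs x)) => y hy Cy.
    rewrite subr0; apply: le_lt_trans (hy Cy); rewrite subr0.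
    exact: le_trans (f0_le n ij y Cy) (ler_norm _).
  have gx : 0 < g ij.1 x by case: (g_cases ij.1 x) => // gx; case: gth; left.
  have thx : 0 < th x by case: (th_cases x) => // thx; case: gth; right.
  apply: (@cvgM R[i]).
    apply: cvg_real_complex; apply: cvg_restrict; apply: cvgM.
      by apply: psi_c; exact: G_pos.
    by apply: cvgV; [rewrite gt_eqF|exact: thc].
  have [_ [ei _] ec _ _] := ge ij.1 x Cx gx.
  apply: (@coordinates_cvg R X E X (within C (nbhs x)) _ id x d
    (e ij.1) (fun j => e ij.1 j x) (section_val (v n))
    (fun y => k ij.1 y (section_val (v n) y))) => //.
  - exact: cvg_within.
  - by rewrite -hk//; exact: section_tends_within.
  - have : \forall y \near x, 0 < g ij.1 y by apply: cvgr_gt (gc ij.1 x) _ _.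
    by apply: (@filterS _ (nbhs x)) => y gy Cy; exact: hk.
have thpsi i x : th x * psi i x <= M.
  by apply: le_trans (thM x); rewrite ler_piMr.
have /choice[W hW] ij : exists s : section E, forall x, C x -> section_val s x = w0 ij x.
  apply: (section_extension X_compact X_hausdorff (M := M)) => //; first exact: ltW.
  - by move=> x Cx; exact: le_trans (w0_le ij x Cx) (thpsi _ _).
  - by move=> x Cx; exact: w0_c.
pose b n := B * A n * M.
have b0 n : 0 < b n by rewrite !mulr_gt0.
have /choice[F hF] (nij : nat * I) : exists h : CX R X,
    (forall x, C x -> h x = f0 nij.1 nij.2 x) /\ forall x, cabs (h x) <= 2 * b nij.1.
  apply: (complex_extension X_compact X_hausdorff cC) => //.
  - by move=> x Cx; exact: f0_c.
  - move=> x Cx; apply: le_trans (f0_le _ _ x Cx) _.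
    by rewrite /b ler_wpM2l// ltW// mulr_gt0.
have F_le n ij x : cabs (F (n, ij) x) <= 2 * b n := (hF (n, ij)).2 x.
have sumE n x : section_val (v n - \sum_(q < #|{: I}|) F (n, enum_val q) *: W (enum_val q)) x =
    section_val (v n) x - \sum_(ij : I) F (n, ij) x *: section_val (W ij) x.
  rewrite val_sub val_combination; congr (_ - _).
  exact: (sum_enum_val (fun ij => F (n, ij) x *: section_val (W ij) x)).
have A_scale (c : R) : 0 <= c -> p_summable p (fun n => c * A n) /\ forall n, 0 <= c * A n.
  move=> c0; split; last by move=> n; rewrite mulr_ge0// ltW.
  by apply: p_summableZ => // n; exact: ltW.
exists (fun n q => F (n, enum_val q)), (fun q => W (enum_val q)); split.
- move=> q; exists (fun n => (2 * B * M) * A n).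
  have BM0 : 0 <= 2 * B * M by rewrite !mulr_ge0// ltW.
  have [s1 s2] := A_scale _ BM0.
  split=> // n x; apply: le_trans (F_le n _ x) _.
  by rewrite /b le_eqVlt; apply/orP; left; apply/eqP; ring.
- pose Q := M ^+ 2 + \sum_(ij : I) 2 * B * M * section_norm (W ij).
  have Q0 : 0 <= Q.
    rewrite addr_ge0 ?sqr_ge0// sumr_ge0// => ij _.
    by rewrite !mulr_ge0 ?section_norm_ge0// ltW.
  have [s1 s2] := A_scale Q Q0.
  exists (fun n => Q * A n); split=> // n x.
  rewrite sumE (le_trans (rnormD _ _))// rnormN mulrDl lerD//.
    apply: le_trans (v_th n x) _; rewrite mulrC ler_wpM2r ?(ltW (A0 n))//.
    by rewrite ler_pXn2r ?nnegrE// ltW.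
  rewrite (le_trans (rnorm_sum _ _ _))// mulr_suml; apply: ler_sum => ij _.
  rewrite rnormZ (_ : _ * A n = 2 * b n * section_norm (W ij)); last by rewrite /b; ring.
  by rewrite ler_pM ?rnorm_ge0// section_norm_ub.
- move=> n x; rewrite at_leastS => Cx; rewrite sumE; apply/eqP; rewrite subr_eq0; apply/eqP.
  under eq_bigr do rewrite (hF (n, _)).1// hW//.
  rewrite -(pair_bigA _ (fun i j => f0 n (i, j) x *: w0 (i, j) x)) /=.
  have [thx|thx] := th_cases x.
    rewrite [RHS]big1 => [|i _]; last first.
      by rewrite big1// => j _; rewrite /w0 thx mul0r scale0r scaler0.
    apply/eqP; rewrite -rnorm_eq0 eq_le rnorm_ge0 andbT.
    by apply: le_trans (v_th n x) _; rewrite thx expr0n mulr0.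
  have Gx := G_pos x Cx thx.
  have piece i : \sum_j f0 n (i, j) x *: w0 (i, j) x =
      ((g i x / G x)%:C)%C *: section_val (v n) x.
    have [gx|gx] := g_cases i x.
      rewrite gx mul0r scale0r big1// => j _.
      by rewrite /w0 /= psi_g0// mulr0 scale0r scaler0.
    rewrite [in RHS](hk i x Cx gx (section_val (v n) x)) scaler_sumr.
    apply: eq_bigr => j _; rewrite /f0 /w0 /= !scalerA; congr (_ *: _).
    rewrite mulrAC -rmorphM; congr ((_%:C)%C * _).
    have -> : g i x / G x = psi i x ^+ 2 by rewrite sqr_sqrtr// divr_ge0.
    by field; rewrite gt_eqF.
  under [RHS]eq_bigr do rewrite piece.
  rewrite -scaler_suml -rmorph_sum -mulr_suml divff ?gt_eqF//.
  by rewrite scale1r.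
Qed.

End StratumDecomposition.

(** * Decomposability and spanning sections *)

Section Decomposability.
Variables (R : realType) (X : topologicalType) (E : banach_bundle R X).
Hypothesis X_compact : compact [set: X].
Hypothesis X_hausdorff : hausdorff_space X.
Local Notation fiber := (bfiber E).

(** Each stratum contributes its own generators, applied to the remainder left by
the strata of smaller dimension. *)
Lemma partial_decomposition d p :
  (forall k, Fsigma (above E k)) -> (forall k, finitely_trivialized E k) ->
  1 <= p ->
  exists K : nat, forall v : nat -> section E, p_dominated p v ->
    exists (f : nat -> 'I_K -> CX R X) (w : 'I_K -> section E),
    [/\ forall i, scalar_p_dominated p (fun n => f n i),
        p_dominated p (fun n => v n - \sum_i f n i *: w i) &
        forall n x, ~ at_least E d x ->
          section_val (v n - \sum_i f n i *: w i) x = 0].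
Proof.
move=> FX ft p1; elim: d => [|d [K1 ih]].
  exists 0%N => v vp; exists (fun _ _ => 0), (fun=> 0); split=> [[]//||n x].
    by under eq_fun do rewrite big_ord0 subr0.
  by rewrite at_least0 => /(_ I).
have [K2 step] := stratum_decomposition X_compact X_hausdorff FX (ft d) p1.
exists (K1 + K2)%N => v /ih[f1 [w1 [f1p v1p v1z]]].
have [f2 [w2 [f2p v2p v2z]]] := step _ v1p v1z.
pose f n (i : 'I_(K1 + K2)) := match fintype.split i with inl j => f1 n j | inr j => f2 n j end.
pose w (i : 'I_(K1 + K2)) := match fintype.split i with inl j => w1 j | inr j => w2 j end.
have fwE n : v n - \sum_i f n i *: w i =
    v n - \sum_i f1 n i *: w1 i - \sum_i f2 n i *: w2 i.
  rewrite big_split_ord opprD addrA /f /w; congr (_ - _ - _).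
    by apply: eq_bigr => i _; rewrite (unsplitK (inl i : 'I_K1 + 'I_K2)).
  by apply: eq_bigr => i _; rewrite (unsplitK (inr i : 'I_K1 + 'I_K2)).
exists f, w; split.
- by move=> i; rewrite /f; case: fintype.split => j.
- by under eq_fun do rewrite fwE.
- by move=> n x; rewrite fwE; exact: v2z.
Qed.

(** No fibre has dimension greater than [N], so nothing remains after the stratum
[N]. *)
Lemma condition_a_decomposable p : condition_a E -> 1 <= p -> ell_decomposable E p.
Proof.
move=> [[N hN] ft FX] p1; have p0 : 0 < p by exact: lt_le_trans p1.
have pn0 : p != 0 by rewrite gt_eqF.
have [K hK] := partial_decomposition N.+1 FX ft p1.
exists K => v /(in_ellP _ _ pn0) vp.
have [|f [w [fp _ fz]]] := hK v.
  exists (fun n => section_norm (v n)); split=> // [n|n x].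
    exact: section_norm_ge0.
  exact: section_norm_ub.
exists f, w; split=> [i|n].
  have [a [ap a0 fa]] := fp i; apply/in_ellP => //.
  apply: p_summable_le ap; first exact: ltW.
  move=> n; rewrite CX_norm_ge0//=; exact: CX_norm_le.
apply: section_eq => x; apply/eqP; rewrite -subr_eq0 -val_sub; apply/eqP.
by apply: fz => -[e ei]; have [k kN dk] := hN x; have := dim_eq_independent dk ei;
  rewrite ltnNge kN.
Qed.

(** Countably many sections, once damped, form a sequence in l^p; the few
generators that decompose it therefore generate all of them pointwise. *)
Lemma decomposable_countable_span p : 1 <= p -> ell_decomposable E p ->
  exists K : nat, forall t : nat -> section E, exists w : 'I_K -> section E,
    forall n x, in_span (fun i => section_val (w i) x) (section_val (t n) x).
Proof.
move=> p1 [K hK]; exists K => t; have p0 : 0 < p by exact: lt_le_trans p1.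
pose c n : R := 2 ^- n.+1 / (1 + section_norm (t n)).
have t1 n : 0 < 1 + section_norm (t n) by rewrite ltr_pwDl// section_norm_ge0.
have c0 n : 0 < c n by rewrite divr_gt0// invr_gt0 exprn_gt0.
(* A nonzero constant factor does not change the span. *)
pose v n : section E := CX_cst X (c n)%:C%C *: t n.
have [|f [w [_ vw]]] := hK v.
  apply/in_ellP; first by rewrite gt_eqF.
  apply: p_summable_le (geometric_p_summable p1); first exact: ltW.
  move=> n; rewrite section_norm_ge0//=; apply: section_norm_le => [|x].
    by rewrite invr_ge0 exprn_ge0.
  rewrite val_scale rnormZ cabs_real gtr0_norm// /c mulrAC ler_pdivrMr//.
  rewrite ler_wpM2l ?invr_ge0 ?exprn_ge0//.
  by apply: le_trans (section_norm_ub X_compact (t n) x) _; rewrite lerDr.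
exists w => n x.
have cn : ((c n)%:C%C : R[i]) != 0 by rewrite fmorph_eq0 gt_eqF.
exists (fun i => ((c n)%:C%C)^-1 * f n i x).
have vx : (c n)%:C%C *: section_val (t n) x = \sum_i f n i x *: section_val (w i) x.
  by rewrite -val_combination -vw val_scale.
under eq_bigr do rewrite -scalerA.
by rewrite -scaler_sumr -vx scalerA mulVf// scale1r.
Qed.

(** The stratum is a countable union of compact sets, and sections that form a basis
at one of its points do so at nearby points of it. *)
Lemma stratum_countably_spanned d : (forall k, Fsigma (above E k)) ->
  exists L : nat -> seq (section E), forall x, stratum E d x ->
    exists n, list_spans (L n) x.
Proof.
move=> FX; have [F cF FE] := at_least_Fsigma d FX.
have sF x : stratum E d x -> exists n, (F n `&` ~` above E d) x.
  by rewrite stratumE FE => -[[n _ Fx] Cx]; exists n.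
have Fs n x : (F n `&` ~` above E d) x -> stratum E d x.
  by rewrite stratumE FE => -[Fx Cx]; split=> //; exists n.
have /choice[s hs] x : exists s : 'I_d -> section E, stratum E d x ->
    independent (fun j => section_val (s j) x).
  have [[e [ei _]]|nx] := pselect (stratum E d x); last by exists (fun=> 0).
  have /choice[s se] j := section_through X_compact X_hausdorff (e j).
  by exists s => _; under eq_fun do rewrite se.
have /choice[L hL] n : exists L : seq (section E),
    forall x, (F n `&` ~` above E d) x -> list_spans L x.
  have cK : closed (F n `&` ~` above E d).
    by apply: closedI => //; exact: not_above_closed.
  have cptK : compact (F n `&` ~` above E d).
    exact: subclosed_compact cK X_compact _.
  have [|l [lK lc]] := finite_nbhs_cover
      (V := fun x => [set y | independent (fun j => section_val (s x j) y)]) cptK.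
    by move=> x /(Fs n) dx; apply: sections_near_independent; exact: hs.
  exists (flatten [seq codom (s x) | x <- l]) => y Ky; have [x xl sy] := lc y Ky.
  apply: (list_spans_family (w := s x)) => [j|].
    by apply/flatten_mapP; exists x => //; exact: codom_f.
  by apply: dim_eq_span sy; exact: Fs Ky.
by exists L => x /sF[n Fx]; exists n; exact: hL.
Qed.

(** Finite sequences of sections bound the dimensions by [K]; then one sequence that
runs through spanning lists of all the strata is decomposed. *)
Lemma decomposable_spanning p : 1 <= p -> (forall k, Fsigma (above E k)) ->
  ell_decomposable E p -> exists K (w : 'I_K -> section E), spanning w.
Proof.
move=> p1 FX /(decomposable_countable_span p1)[K hK].
have dimK x : dim_le (fiber x) K.
  apply: contrapT => /dim_gtP[e ei].
  have /choice[s se] j := section_through X_compact X_hausdorff (e j).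
  have [w hw] := hK (fun n => s (inord n)).
  have : (K.+1 <= K)%N.
    apply: (@independent_le _ _ _ _ e (fun i => section_val (w i) x)) => // j.
    by have := hw j x; rewrite inord_val se.
  by rewrite ltnn.
have /choice[L hL] d := stratum_countably_spanned d FX.
pose t k : section E := if unpickle k is Some (d, n, j) then (L d n)`_j else 0.
have [w hw] := hK t; exists K, w => x v.
have [d _ dx] := dimK x; have [n Ln] := hL d x dx.
apply: in_span_trans (Ln v) => j.
by have := hw (pickle (d, n, nat_of_ord j)) x; rewrite /t pickleK.
Qed.

End Decomposability.

(** * The equivalence *)

Theorem theoremA (R : realType) (X : topologicalType)
    (X_compact : compact [set: X]) (X_hausdorff : hausdorff_space X)
    (E : banach_bundle R X) :
  (forall d : nat, open (above E d)) /\
  [<-> condition_a E;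
       topologically_finitely_generated E;
       condition_c_all E;
       condition_c_some E].
Proof.
have b_to_a : topologically_finitely_generated E -> condition_a E.
  move=> [K [w wd]]; apply: (spanning_condition_a (u := w)).
  exact: dense_spanning wd.
split; first by move=> d; exact: above_open.
tfae.
- move=> a; have [K [u us]] := condition_a_spanning X_compact X_hausdorff a.
  by exists K, u; exact: spanning_dense.
- move=> /b_to_a a; split; first by case: a.
  by move=> p p1; exact: condition_a_decomposable.
- by move=> [FX dec]; split=> //; exists 1; [exact: lexx|exact: dec (lexx _)].
- move=> [FX [p p1 dec]].
  have [K [w ws]] := decomposable_spanning X_compact X_hausdorff p1 FX dec.
  exact: spanning_condition_a ws.
Qed.
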